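(* Let $\alpha,\gamma\in(0,1)$ and let $f,D,g$ satisfy: $f\in C^1[0,1]$ with $f(0)=0$; $D\in C^1[0,1]$ with $D>0$ on $(0,\alpha)$ and $D<0$ on $(\alpha,1)$; $g\in C^0[0,1]$ with $g<0$ on $(0,\gamma)$, $g>0$ on $(\gamma,1)$ and $g(0)=g(\gamma)=g(1)=0$. Assume $f$ is strictly concave. Write $q=Dg$ and $\delta(q,\phi_0)(\phi)=\frac{q(\phi)-q(\phi_0)}{\phi-\phi_0}$. Then the equation $\rho_t+f(\rho)_x=(D(\rho)\rho_x)_x+g(\rho)$ admits wavefronts in each of the following cases: (a) $\alpha>\gamma$, $\dot g(\gamma)$ exists and is positive, and $$\dot f(\gamma)-\frac{f(1)-f(\alpha)}{1-\alpha}\ge 2\left(\sqrt{\sup_{[\alpha,1)}\delta(q,1)}+\sqrt{\sup_{[0,\gamma)}\delta(q,\gamma)}\right);\qquad(\ast)$$ (b) $\alpha=\gamma$, $(\ast)$ holds, and there are $L>0$, $\tau\in(0,1)$ with $|g(\phi)|\ge L|\phi-\gamma|^\tau$ in a full neighborhood of $\gamma$; (c) $\alpha<\gamma$ and $$\dot f(\gamma)-\frac{f(1)-f(\gamma)}{1-\gamma}>2\left(\sqrt{\sup_{[\gamma,1)}\delta(q,1)}+\sqrt{\sup_{[0,\gamma]\setminus\{\alpha\}}\delta(q,\alpha)}\right).$$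
   Context: A traveling wave with speed $c$ and profile $\phi$ is a function $\phi\in C(\mathbb R)$ with values in $[0,1]$, differentiable a.e., with $D(\phi)\phi'\in L^1_{\rm loc}$, such that $\int_{\mathbb R}\big(D(\phi)\phi'-f(\phi)+c\phi\big)\psi'-g(\phi)\psi\,d\xi=0$ for all $\psi\in C_0^\infty(\mathbb R)$; a wavefront is such a traveling wave with monotone non-constant profile; here profiles are taken non-increasing with $\phi(-\infty)=1$, $\phi(+\infty)=0$. *)

(* Defs.v *)
From HB Require Import structures.
From mathcomp Require Import all_boot all_order all_algebra.
From mathcomp Require Import all_classical all_reals all_analysis.
Set Implicit Arguments. Unset Strict Implicit. Unset Printing Implicit Defensive.
Import Order.TTheory GRing.Theory Num.Theory.
Import numFieldNormedType.Exports.
Local Open Scope classical_set_scope.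
Local Open Scope ring_scope.

Section Defs.
Variable R : realType.

(* f ∈ C^1[0,1]: there is a function f1 continuous on [0,1] which is the
   (one-sided at the endpoints) derivative of f relative to [0,1]. *)
Definition C1_01 (f : R -> R) : Prop :=
  {within `[0, 1], continuous f} /\
  exists f1 : R -> R, {within `[0, 1], continuous f1} /\
    forall x, x \in `[0, 1] ->
      (fun y => (f y - f x) / (y - x))
        @ within (fun y => y \in `[0, 1] /\ y != x) (nbhs x) --> f1 x.

Definition C0_01 (g : R -> R) : Prop := {within `[0, 1], continuous g}.

Definition strictly_concave_01 (f : R -> R) : Prop :=
  forall x y t, x \in `[0, 1] -> y \in `[0, 1] -> x != y -> 0 < t < 1 ->
    t * f x + (1 - t) * f y < f (t * x + (1 - t) * y).

Definition delta (q : R -> R) (phi0 phi : R) : R := (q phi - q phi0) / (phi - phi0).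

Definition test_function (psi : R -> R) : Prop :=
  (forall n x, derivable (derive1n n psi) x 1) /\
  exists M : R, forall x, M < `|x| -> psi x = 0.

(* traveling wave of  rho_t + f(rho)_x = (D(rho) rho_x)_x + g(rho)
   with speed c and profile phi (weak sense). *)
Definition traveling_wave (f D g : R -> R) (c : R) (phi : R -> R) : Prop :=
  continuous phi /\
  (forall x, 0 <= phi x <= 1) /\
  {ae (@lebesgue_measure R), forall x, derivable phi x 1} /\
  (forall a b : R, (@lebesgue_measure R).-integrable `[a, b]
      (fun x => (D (phi x) * derive1 phi x)%:E)) /\
  (forall psi, test_function psi ->
     (\int[@lebesgue_measure R]_(x in setT)
        ((D (phi x) * derive1 phi x - f (phi x) + c * phi x) * derive1 psi x
         - g (phi x) * psi x)%:E = 0)%E).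

Definition wavefront (f D g : R -> R) (c : R) (phi : R -> R) : Prop :=
  traveling_wave f D g c phi /\
  {homo phi : x y / x <= y >-> y <= x} /\
  phi x @[x --> -oo] --> (1 : R) /\ phi x @[x --> +oo] --> (0 : R).

End Defs.

(* Main.v *)
Require Import Defs.
From HB Require Import structures.
From mathcomp Require Import all_boot all_order all_algebra.
From mathcomp Require Import all_classical all_reals all_analysis.
From mathcomp Require Import measurable_realfun.
From mathcomp Require Import ring lra.
Set Implicit Arguments. Unset Strict Implicit. Unset Printing Implicit Defensive.
Import Order.TTheory GRing.Theory Num.Theory.
Import numFieldNormedType.Exports.
Local Open Scope classical_set_scope.
Local Open Scope ring_scope.

(** Along a decreasing profile the flux z = D(phi) phi', seen as a function of phi, solves
    z' = f' - c - D g / z, is negative where D > 0, positive where D < 0, and vanishes at 0,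
    alpha and 1. Followed from 0, alpha or gamma in the right direction, |z| solves
    W' = k + Q / W with Q > 0; since the right-hand side decreases in W, solutions exist from
    every W(0) >= 0 and depend on W(0) and on k in a Lipschitz way. A solution vanishes at the
    other end as soon as the primitive of k decreases at rate m, Q(s) <= S (l - s) and
    m^2 >= 4 S, for W(0) <= m l / 2. By concavity of f the conditions on the chord slopes and on
    delta(q, .) say exactly this on the relevant pieces. In case (a) the pieces left and right of
    gamma are matched at gamma by varying c; in case (c) both start from the same small positive
    value at gamma. The profile is the inverse of the time map T with T' = D / z. The
    only danger is that T is infinite at alpha, and (z - f + c phi)' = - g T' with
    |g| >= L |phi - alpha|^tau excludes it. Finally V = z(phi) - f(phi) + c phi is C^1 on the
    line with V' = - g(phi), which is the weak equation. *)

(** * Calculus on the real line *)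

(** The condition [m ^+ 2 >= 4 * S] is a discriminant: for [k = - m] and [Q s = S * (l - s)] the
    line [lam * (l - s)] solves the equation when [lam ^+ 2 - m * lam + S = 0], and [m / 2] lies
    between the roots, so the line of that slope is a barrier. Only a primitive of [k] enters, which
    is why chord slopes of [f] suffice. As conditions on the speed, vanishing at 1 asks
    [c >= slope + 2 sqrt S] with a chord slope, and vanishing of the piece leaving 0 asks
    [c <= f' gamma - 2 sqrt S]; the hypotheses say that such speeds exist. Case (b) takes the lower
    end of this range. Case (a) starts shooting at the upper end, where the left piece reaches gamma
    with value 0, and raises [c]; the matched value has to be positive because the flux keeps its
    sign across gamma. A zero value would need both [c < f' gamma] and [c > f' gamma], once
    [g' gamma > 0]. The equation is singular at [W = 0], where most pieces start; existence is
    therefore a limit of regularized problems with [W >= e]. *)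

Lemma derive_ge0_le (R : realType) (F : R -> R) (a b : R) :
  a <= b -> {within `[a, b], continuous F} ->
  (forall x, a < x < b -> exists2 l, is_derive x 1 F l & 0 <= l) -> F a <= F b.
Proof.
rewrite le_eqVlt => /predU1P[->//|ab] cF dF.
have dF' x : x \in `]a, b[ -> is_derive x 1 F (derive1 F x).
  rewrite in_itv/= => /dF[l Fl _].
  by rewrite derive1E; apply: DeriveDef => //; exact: (@ex_derive _ _ _ _ _ _ _ Fl).
have [c cab] := MVT ab dF' cF.
rewrite -subr_ge0 => ->; apply: mulr_ge0; last by rewrite subr_ge0 ltW.
move: cab; rewrite in_itv/= => /dF[l Fl l0].
by rewrite derive1E (@derive_val _ _ _ _ _ _ _ Fl).
Qed.

Lemma continuous_near_ball (R : realType) (d : R -> R) (s e : R) :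
  {for s, continuous d} -> 0 < e ->
  exists2 r, 0 < r & forall y, `|y - s| < r -> `|d y - d s| < e.
Proof.
move=> cd e0.
have /cvgrPdist_lt/(_ e e0) := cd.
move=> /nbhs_ballP[r /= r0 H]; exists r => // y ysr.
by rewrite distrC; apply: H; rewrite /ball/= distrC.
Qed.

Lemma ball_continuous (R : realType) (d : R -> R) (s : R) :
  (forall e, 0 < e -> exists2 r, 0 < r & forall y, `|y - s| < r -> `|d y - d s| < e) ->
  {for s, continuous d}.
Proof.
move=> H; apply/cvgrPdist_lt => e /H[r r0 {}H].
apply/nbhs_ballP; exists r => // y; rewrite /ball/= => ysr.
by rewrite distrC; apply: H; rewrite distrC.
Qed.

(** From the last point before [x] with [d >= 0] on, [d] is negative, hence nondecreasing. Asking
    for the sign of the derivative only where [d < 0] suits equations whose right-hand side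
    decreases in the unknown: that sign is known only on the wrong side of a barrier. *)
Lemma ge0_comparison (R : realType) (d : R -> R) (a b : R) :
  continuous d -> 0 <= d a ->
  (forall x, a < x < b -> d x < 0 -> exists2 l, is_derive x 1 d l & 0 <= l) ->
  forall x, a <= x <= b -> 0 <= d x.
Proof.
move=> cd da0 dd x /andP[ax xb]; rewrite leNgt; apply/negP => dx0.
pose S := [set s | a <= s <= x /\ 0 <= d s].
have Sa : S a by split => //; rewrite lexx.
have hS : has_sup S.
  by split; [exists a|exists x => s [/andP[]]].
pose s := sup S.
have as_ : a <= s by apply: sup_upper_bound.
have sx : s <= x by apply: ge_sup => //; [exists a|move=> u [/andP[]]].
have ds0 : 0 <= d s.
  rewrite leNgt; apply/negP => ds.
  have [|r r0 Hr] := @continuous_near_ball R d s (- d s) (cd s); first lra.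
  have [y [/andP[ay yx] dy] ys] := sup_adherent r0 hS; rewrite -/s in ys.
  have ys' : y <= s by apply: sup_upper_bound => //; split => //; rewrite ay.
  have : `|d y - d s| < - d s by apply: Hr; rewrite ltr_norml; lra.
  by rewrite ltr_norml; lra.
suff : d s <= d x by lra.
apply: derive_ge0_le => //; first exact: continuous_subspaceT.
move=> y /andP[sy yx]; apply: dd; first by lra.
rewrite ltNge; apply/negP => dy.
suff : y <= s by lra.
by apply: sup_upper_bound => //; split => //; lra.
Qed.

Lemma is_derive_near (R : realType) (f g : R -> R) (x l : R) (a b : R) :
  a < x < b -> (forall y, a < y < b -> f y = g y) ->
  is_derive x 1 f l -> is_derive x 1 g l.
Proof.
move=> axb fg fl; apply: near_eq_is_derive fl.
have : x \in `]a, b[ by rewrite in_itv.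
move=> /near_in_itvoo; apply: filterS => y; rewrite in_itv/= => yab.
by rewrite fg.
Qed.

Lemma continuous_is_derive (R : realType) (f : R -> R) (x l : R) :
  is_derive x 1 f l -> {for x, continuous f}.
Proof.
move=> fl; apply: differentiable_continuous; apply/derivable1_diffP.
exact: (@ex_derive _ _ _ _ _ _ _ fl).
Qed.

Lemma within_is_derive (R : realType) (f df : R -> R) (a b : R) :
  (forall x, a <= x <= b -> is_derive x 1 f (df x)) -> {within `[a, b], continuous f}.
Proof.
move=> H; apply: continuous_in_subspaceT => x /set_mem /=; rewrite in_itv/= => /H.
exact: continuous_is_derive.
Qed.

(** Composition with it extends a function constantly beyond a segment, so that data given on a
    segment can be handled as globally continuous and bounded functions. *)
Definition clamp (R : realType) (a b x : R) : R := Num.max a (Num.min x b).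

Lemma clamp_continuous (R : realType) (a b : R) : continuous (clamp a b).
Proof.
move=> x; apply: (@continuous_max _ _ (cst a) (Num.min^~ b)); first exact: cst_continuous.
apply: (@continuous_min _ _ id (cst b)) => //; exact: cst_continuous.
Qed.

Lemma clamp_itv (R : realType) (a b x : R) : a <= b -> a <= clamp a b x <= b.
Proof. by rewrite /clamp => ab; rewrite le_max lexx /= ge_max ab ge_min lexx orbT. Qed.

Lemma clampE (R : realType) (a b x : R) : a <= x <= b -> clamp a b x = x.
Proof. by rewrite /clamp => /andP[ax xb]; rewrite (min_idPl xb) (max_idPr ax). Qed.

Lemma continuous_clamp (R : realType) (f : R -> R) (a b : R) : a <= b ->
  {within `[a, b], continuous f} -> continuous (fun x => f (clamp a b x)).
Proof.
move=> ab cf x.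
have xin := clamp_itv x ab.
apply/cvgrPdist_lt => e e0.
have /cvgrPdist_lt/(_ e e0) := cf (clamp a b x).
rewrite /= /prop_near1 /nbhs /=; rewrite -nbhs_subspace_in; last by rewrite /=.
rewrite /within /= => H.
have := @clamp_continuous R a b x _ H.
rewrite nbhs_filterE /=; apply: filterS => y /=; apply.
by rewrite in_itv/=; exact: clamp_itv.
Qed.

Lemma is_derive_dist (R : realType) (f : R -> R) (x l : R) :
  is_derive x 1 f l <->
  (forall e, 0 < e -> exists2 r, 0 < r & forall y, `|y - x| < r ->
      `|f y - f x - l * (y - x)| <= e * `|y - x|).
Proof.
split => [/is_derive1_caratheodory[g [fg cg gx]] e e0|H].
  have [r r0 Hr] := continuous_near_ball cg e0.
  exists r => // y /Hr; rewrite fg gx => /ltW He.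
  by rewrite -mulrBl normrM ler_wpM2r.
apply/is_derive1_caratheodory.
exists (fun z => if z == x then l else (f z - f x) / (z - x)); split.
- move=> z; case: eqP => [->|/eqP]; first by rewrite !subrr mulr0.
  by rewrite -subr_eq0 => /divfK->.
- apply: ball_continuous => e e0; rewrite eqxx.
  have [|r r0 Hr] := H (e / 2); first by lra.
  exists r => // y yr /=; have [_|yx] := eqVneq y x; first by rewrite subrr normr0.
  have yx0 : y - x != 0 by rewrite subr_eq0.
  have -> : (f y - f x) / (y - x) - l = (f y - f x - l * (y - x)) / (y - x) by field.
  rewrite normrM normfV ltr_pdivrMr ?normr_gt0//.
  apply: le_lt_trans (Hr _ yr) _.
  by rewrite ltr_pM2r ?normr_gt0//; lra.
by rewrite eqxx.
Qed.

Lemma mean_value_dist (R : realType) (f : R -> R) (a b m e : R) :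
  a <= b -> {within `[a, b], continuous f} ->
  (forall x, a < x < b -> exists2 l, is_derive x 1 f l & `|l - m| <= e) ->
  `|f b - f a - m * (b - a)| <= e * (b - a).
Proof.
rewrite le_eqVlt => /predU1P[<- _ _|ab cf H].
  by rewrite !subrr !mulr0 subr0 normr0.
have H' x : x \in `]a, b[ -> is_derive x 1 f (derive1 f x).
  rewrite in_itv/= => /H[l fl _].
  by rewrite derive1E; apply: DeriveDef => //; exact: (@ex_derive _ _ _ _ _ _ _ fl).
have [c cab ->] := MVT ab H' cf.
move: cab; rewrite in_itv/= => /H[l fl le].
rewrite derive1E (@derive_val _ _ _ _ _ _ _ fl) -mulrBl normrM.
by rewrite (@ger0_norm _ (b - a)) ?ler_wpM2r//; lra.
Qed.

(** The mean value inequality on each side of [x] turns closeness of [df] to [df x] into closeness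
    of the difference quotients to [df x]. *)
Lemma is_derive_extend (R : realType) (f df : R -> R) (a b x : R) :
  a < x < b -> {for x, continuous f} -> {for x, continuous df} ->
  (forall y, a < y < b -> y != x -> is_derive y 1 f (df y)) ->
  is_derive x 1 f (df x).
Proof.
move=> /andP[ax xb] cf cdf H; apply/is_derive_dist => e e0.
have [r r0 Hr] := continuous_near_ball cdf e0.
exists (Num.min r (Num.min (x - a) (b - x))).
  by rewrite !lt_min r0 !subr_gt0 ax.
move=> y; rewrite !lt_min => /andP[yr /andP[ya yb]].
have cy z : a < z < b -> {for z, continuous f}.
  by move=> zab; have [->//|zx] := eqVneq z x; apply: continuous_is_derive (H _ zab zx).
have aux s t : a < s -> s <= t -> t < b -> {within `[s, t], continuous f}.
  move=> as_ st tb; apply: continuous_in_subspaceT => z /set_mem /=.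
  by rewrite in_itv/= => ?; apply: cy; lra.
move: yr ya yb; have [yx|xy|->] := ltgtP y x; last by rewrite !subrr mulr0 normr0 subrr normr0 mulr0.
- rewrite ltr0_norm ?subr_lt0// => yr ya yb.
  have : `|f x - f y - df x * (x - y)| <= e * (x - y).
    apply: mean_value_dist; [lra|apply: aux; lra|move=> z zyx].
    exists (df z); first by apply: H; lra.
    by apply/ltW/Hr; rewrite ltr0_norm; lra.
  rewrite opprB -[X in _ -> X <= _]normrN.
  by have -> : - (f y - f x - df x * (y - x)) = f x - f y - df x * (x - y) by ring.
- rewrite gtr0_norm ?subr_gt0// => yr ya yb.
  apply: mean_value_dist; [lra|apply: aux; lra|move=> z zyx].
  exists (df z); first by apply: H; lra.
  by apply/ltW/Hr; rewrite gtr0_norm; lra.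
Qed.

Lemma right_primitive (R : realType) (u : R -> R) (a b : R) :
  (forall t, a <= t < b -> {for t, continuous u}) ->
  exists U : R -> R, forall t, a < t < b -> is_derive t 1 U (u t).
Proof.
move=> cu; exists (fun x => \int[lebesgue_measure]_(t in `[a, x]) u t).
move=> t /andP[at_ tb].
pose v := (t + b) / 2.
have tv : t < v by rewrite /v; lra.
have vb : v < b by rewrite /v; lra.
have iu : (@lebesgue_measure R).-integrable `[a, v] (EFin \o u).
  apply: continuous_compact_integrable; first exact: segment_compact.
  apply: continuous_in_subspaceT => z /set_mem /=; rewrite in_itv/= => ?; apply: cu; lra.
have cut : {for t, continuous u} by apply: cu; lra.
have [dU U'] := @continuous_FTC1_closed R u a t v tv iu at_ cut.
by rewrite -U' derive1E; apply/derivableP.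
Qed.

(** [u] may blow up at both ends, so the base point must be interior. [right_primitive] covers the
    part right of [a0], its reflection the part left of [b0]; the overlap around the midpoint [x0]
    lets the two be matched there with the derivative intact. *)
Lemma primitive_oo (R : realType) (u : R -> R) (a b : R) :
  (forall t, a < t < b -> {for t, continuous u}) ->
  exists U : R -> R, forall t, a < t < b -> is_derive t 1 U (u t).
Proof.
move=> cu; have [ab|ba] := ltP a b; last by exists id => t; lra.
pose x0 := (a + b) / 2; pose a0 := (a + x0) / 2; pose b0 := (x0 + b) / 2.
have [U1 HU1] : exists U : R -> R, forall t, a0 < t < b -> is_derive t 1 U (u t).
  by apply: right_primitive => t; rewrite /a0 /x0 => ?; apply: cu; lra.
have [U2' HU2'] : exists U : R -> R, forall t, - b0 < t < - a -> is_derive t 1 U (u (- t)).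
  apply: (@right_primitive R (fun t => u (- t))) => t; rewrite /b0 /x0 => ?.
  apply: (@continuous_comp _ _ _ -%R u); first exact: opp_continuous.
  by apply: cu; lra.
pose U2 x := - U2' (- x).
have HU2 t : a < t < b0 -> is_derive t 1 U2 (u t).
  move=> tab; have H : is_derive (- t) 1 U2' (u t).
    by rewrite -{2}[t]opprK; apply: HU2'; lra.
  have H2 : is_derive t 1 (U2' \o -%R) (- u t).
    have -> : - u t = u t * (-1) by ring.
    have HN : is_derive t 1 (-%R : R -> R) (-1) by apply: is_deriveN.
    by have := @is_derive1_comp _ U2' -%R t _ _ H HN; rewrite mulrC.
  have -> : u t = - - u t by rewrite opprK.
  exact: is_deriveN.
pose U t := if t <= x0 then U2 t - U2 x0 else U1 t - U1 x0.
have d1 t : a0 < t < b -> is_derive t 1 (fun t => U1 t - U1 x0) (u t).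
  move=> /HU1 H; have -> : u t = u t - 0 by rewrite subr0.
  exact: is_deriveB.
have d2 t : a < t < b0 -> is_derive t 1 (fun t => U2 t - U2 x0) (u t).
  move=> /HU2 H; have -> : u t = u t - 0 by rewrite subr0.
  exact: is_deriveB.
have ab0 : a < a0 /\ a0 < x0 /\ x0 < b0 /\ b0 < b by rewrite /a0 /b0 /x0; lra.
have U12 t : a0 < t < b0 -> U1 t - U1 x0 = U2 t - U2 x0.
  move=> tab.
  have key s r : a0 < s -> s <= r -> r < b0 -> U1 s - U2 s = U1 r - U2 r.
    move=> as_ sr rb.
    have dd y : a0 < y < b0 -> is_derive y 1 (fun t => U1 t - U2 t) 0.
      move=> yab; have -> : 0 = u y - u y by rewrite subrr.
      by apply: is_deriveB; [apply: HU1; lra|apply: HU2; lra].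
    have : `|(U1 r - U2 r) - (U1 s - U2 s) - 0 * (r - s)| <= 0 * (r - s).
      apply: (@mean_value_dist R (fun t => U1 t - U2 t)) => //.
        by apply: (@within_is_derive _ _ (fun=> 0)) => x ?; apply: dd; lra.
      by move=> x ?; exists 0; [apply: dd; lra|rewrite subrr normr0].
    by rewrite !mul0r subr0 normr_le0 => /eqP; lra.
  have [tx|xt] := leP t x0.
    by have := key t x0 _ tx _; lra.
  by have := key x0 t _ (ltW xt) _; lra.
exists U => t /andP[at_ tb].
have [tx|xt] := leP t x0.
  apply: (@is_derive_near _ (fun t => U2 t - U2 x0) _ _ _ a b0); last by apply: d2; lra.
    by lra.
  move=> y yab; rewrite /U; case: leP => // xy.
  by rewrite U12//; lra.
apply: (@is_derive_near _ (fun t => U1 t - U1 x0) _ _ _ a0 b); last by apply: d1; lra.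
  by lra.
move=> y yab; rewrite /U; case: leP => // xy.
by rewrite U12//; lra.
Qed.

Lemma primitive_clamp (R : realType) (u : R -> R) (l : R) : 0 < l -> continuous u ->
  exists U : R -> R, [/\ continuous U, U 0 = 0 &
    forall t, 0 < t < l -> is_derive t 1 U (u t)].
Proof.
move=> l0 cu; have [U HU] := @primitive_oo R u (-1) (l + 1) (fun t _ => cu t).
exists (fun t => U (clamp 0 l t) - U 0); split.
- have : continuous (fun t => U (clamp 0 l t)).
    apply: continuous_clamp; first exact: ltW.
    by apply: (@within_is_derive _ _ u) => x ?; apply: HU; lra.
  by move=> cU x; apply: cvgB; [exact: cU|exact: cvg_cst].
- by rewrite clampE ?subrr// lexx ltW.
move=> t t0l.
apply: (@is_derive_near _ (fun t => U t - U 0) _ _ _ 0 l) => //.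
  by move=> y y0l; rewrite clampE//; lra.
have -> : u t = u t - 0 by rewrite subr0.
by apply: is_deriveB; apply: HU; lra.
Qed.

(** * Uniform limits and Picard iteration *)

(** With [V] a primitive of [v], the derivatives of [y_ n - V] tend to 0 uniformly, so [y - V] is
    constant. *)
Lemma is_derive_limit (R : realType) (y_ v_ : nat -> R -> R) (y v : R -> R) (a b : R)
    (d e : nat -> R) :
  d @ \oo --> (0 : R) -> e @ \oo --> (0 : R) ->
  (forall n t, a < t < b -> `|y_ n t - y t| <= d n) ->
  (forall n t, a < t < b -> `|v_ n t - v t| <= e n) ->
  (forall t, a < t < b -> {for t, continuous v}) ->
  (forall n t, a < t < b -> is_derive t 1 (y_ n) (v_ n t)) ->
  forall t, a < t < b -> is_derive t 1 y (v t).
Proof.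
move=> d0 e0 yd ve cv dy.
have [V HV] := primitive_oo cv.
have key s r : a < s -> s <= r -> r < b -> y s - V s = y r - V r.
  move=> as_ sr rb.
  apply/eqP; rewrite -subr_eq0 -normr_eq0 eq_le normr_ge0 andbT.
  have H n : `|y s - V s - (y r - V r)| <= d n + d n + e n * (r - s).
    have dd z : a < z < b -> is_derive z 1 (fun t => y_ n t - V t) (v_ n z - v z).
      by move=> zab; apply: is_deriveB; [apply: dy; lra|apply: HV; lra].
    have : `|(y_ n r - V r) - (y_ n s - V s) - 0 * (r - s)| <= e n * (r - s).
      apply: (@mean_value_dist R (fun t => y_ n t - V t)) => //.
        by apply: (@within_is_derive _ _ (fun z => v_ n z - v z)) => x ?; apply: dd; lra.
      by move=> x ?; exists (v_ n x - v x); [apply: dd; lra|rewrite subr0; apply: ve; lra].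
    have := yd n s; have := yd n r.
    rewrite mul0r subr0 !ler_norml => yr ys; lra.
  have : d n + d n + e n * (r - s) @[n --> \oo] --> (0 : R).
    have -> : (0 : R) = 0 + 0 + 0 * (r - s) by ring.
    by apply: cvgD; [exact: cvgD|apply: cvgM; [|exact: cvg_cst]].
  move=> lim0; rewrite -(cvg_lim _ lim0)//; apply: limr_ge; first by apply/cvg_ex; exists 0.
  by apply: nearW => n; exact: H.
move=> t tab; apply: (@is_derive_near _ (fun x => V x + (y t - V t)) _ _ _ a b) => //.
  move=> x xab; have [tx|xt] := leP t x.
    by have := key t x _ tx _; lra.
  by have := key x t _ (ltW xt) _; lra.
have -> : v t = v t + 0 by rewrite addr0.
by apply: is_deriveD; apply: HV.
Qed.

Lemma uniform_cauchy_limit (R : realType) (y_ : nat -> R -> R) (e : nat -> R) :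
  e @ \oo --> (0 : R) -> (forall n, continuous (y_ n)) ->
  (forall n m t, (n <= m)%N -> `|y_ m t - y_ n t| <= e n) ->
  exists2 y, continuous y & forall n t, `|y t - y_ n t| <= e n.
Proof.
move=> e0 cy Hy.
have cv t : cvgn (fun n => y_ n t).
  apply/cauchy_cvgP/cauchy_exP => /= r r0.
  have /cvgrPdist_lt/(_ r r0)[N _ HN] := e0.
  exists (y_ N t); exists N => // n /= Nn; rewrite /ball/= distrC.
  apply: le_lt_trans (Hy _ _ _ Nn) _.
  have := HN N (leqnn N); rewrite /= sub0r normrN.
  exact: le_lt_trans (ler_norm _).
have Hl n t : `|limn (fun n => y_ n t) - y_ n t| <= e n.
  have cn : (fun m => `|y_ m t - y_ n t|) @ \oo --> `|limn (fun n => y_ n t) - y_ n t|.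
    by apply: cvg_norm; apply: cvgB; [exact: cv|exact: cvg_cst].
  rewrite -(cvg_lim _ cn)//; apply: limr_le; first by apply/cvg_ex; eexists; exact: cn.
  by exists n => // m /= nm; exact: Hy.
exists (fun t => limn (fun n => y_ n t)) => // t.
apply: ball_continuous => r r0.
have r3 : 0 < r / 3 by lra.
have /cvgrPdist_lt/(_ _ r3)[N _ HN] := e0.
have eN : e N < r / 3.
  have := HN N (leqnn N); rewrite /= sub0r normrN.
  exact: le_lt_trans (ler_norm _).
have [q q0 Hq] := continuous_near_ball (cy N t) r3.
exists q => // x /Hq.
have := Hl N x; have := Hl N t; rewrite !ler_norml !ltr_norml; lra.
Qed.

Lemma norm_le_derive (R : realType) (u w du dw : R -> R) (l : R) :
  continuous u -> continuous w -> `|u 0| <= w 0 ->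
  (forall t, 0 < t < l -> is_derive t 1 u (du t)) ->
  (forall t, 0 < t < l -> is_derive t 1 w (dw t)) ->
  (forall t, 0 < t < l -> `|du t| <= dw t) ->
  forall t, 0 <= t <= l -> `|u t| <= w t.
Proof.
move=> cu cw; rewrite ler_norml => /andP[u0 u0'] Du Dw H t /andP[t0 tl].
rewrite ler_norml; apply/andP; split.
- have : w 0 + u 0 <= w t + u t.
    apply: (@derive_ge0_le R (fun t => w t + u t)) => //.
      by apply: continuous_subspaceT => x; apply: cvgD; [exact: cw|exact: cu].
    move=> x xt; exists (dw x + du x).
      by apply: is_deriveD; [apply: Dw; lra|apply: Du; lra].
    have := H x; rewrite ler_norml => /(_ ltac:(lra)); lra.
  by lra.
- have : w 0 - u 0 <= w t - u t.
    apply: (@derive_ge0_le R (fun t => w t - u t)) => //.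
      by apply: continuous_subspaceT => x; apply: cvgB; [exact: cw|exact: cu].
    move=> x xt; exists (dw x - du x).
      by apply: is_deriveB; [apply: Dw; lra|apply: Du; lra].
    have := H x; rewrite ler_norml => /(_ ltac:(lra)); lra.
  by lra.
Qed.

Lemma continuous_bounded (R : realType) (u : R -> R) (a b : R) : a <= b ->
  continuous u -> exists2 C, 0 < C & forall t, a <= t <= b -> `|u t| <= C.
Proof.
move=> ab cu.
have cu' : {within `[a, b], continuous (fun t => `|u t|)}.
  by apply: continuous_subspaceT => x; apply: cvg_norm; exact: cu.
have [c cab H] := EVT_max ab cu'.
exists (`|u c| + 1) => [|t tab]; first by have := normr_ge0 (u c); lra.
by have := H t; rewrite in_itv/= => /(_ tab); lra.
Qed.

Lemma eq0_of_norm_le (R : realType) (x : R) (d : nat -> R) :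
  d @ \oo --> (0 : R) -> (forall n, `|x| <= d n) -> x = 0.
Proof.
move=> d0 H; apply/eqP; rewrite -normr_eq0 eq_le normr_ge0 andbT.
rewrite -(cvg_lim _ d0)//; apply: limr_ge; first by apply/cvg_ex; eexists; exact: d0.
exact: nearW.
Qed.

Lemma is_derive_mulc (R : realType) (f : R -> R) (c t l : R) :
  is_derive t 1 f l -> is_derive t 1 (fun t => c * f t) (c * l).
Proof. exact: is_deriveZ. Qed.

Lemma is_derive_scaled_exp (R : realType) (c k t : R) :
  is_derive t 1 (fun t => c * expR (k * t)) (c * (k * expR (k * t))).
Proof.
have H : is_derive t 1 (fun t : R => k * t) k.
  by have := @is_derive_mulc R id k t 1 (is_derive_id t 1); rewrite mulr1.
apply: is_derive_mulc; rewrite mulrC.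
exact: (@is_derive1_comp _ expR (fun t => k * t) t _ _ (is_derive_expR _) H).
Qed.

(* Successive iterates contract by 1/2 for the weight [expR (2 * L * t)]. *)
Lemma picard (R : realType) (F : R -> R -> R) (L l y0 : R) : 0 < L -> 0 < l ->
  (forall y, continuous y -> continuous (fun t => F t (y t))) ->
  (forall t u v, `|F t u - F t v| <= L * `|u - v|) ->
  exists y : R -> R, [/\ continuous y, y 0 = y0, (forall t, y t = y (clamp 0 l t)) &
    forall t, 0 < t < l -> is_derive t 1 y (F t (y t))].
Proof.
move=> L0 l0 cF LF.
have step (y : R -> R) : exists J : R -> R, continuous y ->
    [/\ continuous J, J 0 = y0, (forall t, J t = J (clamp 0 l t)) &
      forall t, 0 < t < l -> is_derive t 1 J (F t (y t))].
  have [cy|ncy] := pselect (continuous y); last by exists id.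
  have [U [cU U0 dU]] := primitive_clamp l0 (cF _ cy).
  (* The clamp freezes each iterate outside [[0, l]], so that estimates on the segment become
     estimates on the whole line. *)
  exists (fun t => y0 + U (clamp 0 l t)) => _; split.
  - move=> x; apply: cvgD; first exact: cvg_cst.
    apply: (@continuous_comp _ _ _ (clamp 0 l) U); first exact: clamp_continuous.
    exact: cU.
  - by rewrite clampE ?U0 ?addr0// lexx ltW.
  - by move=> t; congr (_ + U _); rewrite [RHS]clampE// clamp_itv// ltW.
  move=> t tl; apply: (@is_derive_near _ (fun t => y0 + U t) _ _ _ 0 l) => //.
    by move=> y1 yl; rewrite clampE//; lra.
  have -> : F t (y t) = 0 + F t (y t) by rewrite add0r.
  by apply: is_deriveD; exact: dU.
have [J HJ] := choice step.
pose y_ n := iter n J (cst y0).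
have cy n : continuous (y_ n).
  by elim: n => [|n IH] /=; [exact: cst_continuous|have [] := HJ _ IH].
have y_0 n : y_ n 0 = y0.
  by case: n => [//|n] /=; have [] := HJ _ (cy n).
have y_c n t : y_ n t = y_ n (clamp 0 l t).
  by case: n => [//|n] /=; have [] := HJ _ (cy n).
have dy n t : 0 < t < l -> is_derive t 1 (y_ n.+1) (F t (y_ n t)).
  by have [_ _ _] := HJ _ (cy n); exact.
have c1 n : continuous (fun t => y_ n.+1 t - y_ n t).
  by move=> x; apply: cvgB; exact: cy.
have [C C0 HC] := continuous_bounded (ltW l0) (c1 0%N).
have bnd n t : 0 <= t <= l ->
    `|y_ n.+1 t - y_ n t| <= C * 2^-1 ^+ n * expR (2 * L * t).
  elim: n t => [|n IH] t tl.
    rewrite expr0 mulr1; apply: le_trans (HC _ tl) _.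
    have e1 : expR 0 <= expR (2 * L * t) by rewrite ler_expR; apply: mulr_ge0; lra.
    by rewrite expR0 in e1; apply: ler_peMr => //; exact: ltW.
  apply: (@norm_le_derive R (fun t => y_ n.+2 t - y_ n.+1 t)
    (fun t => C * 2^-1 ^+ n.+1 * expR (2 * L * t))
    (fun t => F t (y_ n.+1 t) - F t (y_ n t))
    (fun t => C * 2^-1 ^+ n.+1 * (2 * L * expR (2 * L * t))) l) => //.
  - by move=> x; exact: continuous_is_derive (is_derive_scaled_exp _ _ _).
  - rewrite !y_0 subrr normr0; apply: mulr_ge0; last exact: expR_ge0.
    by apply: mulr_ge0; [lra|apply: exprn_ge0; lra].
  - by move=> x xl; apply: is_deriveB; exact: dy.
  - by move=> x xl; exact: is_derive_scaled_exp.
  - move=> x xl; apply: le_trans (LF _ _ _) _.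
    have /(ler_wpM2l (ltW L0))/le_trans := IH x ltac:(lra).
    apply; rewrite exprS le_eqVlt; apply/orP; left; apply/eqP.
    by field.
(* The factor 2 is the sum of the geometric series: the bound for one step becomes the difference of
   consecutive terms [E * 2^-1 ^+ n], and the steps telescope. *)
pose E := 2 * (C * expR (2 * L * l)).
have E0 : 0 < E by apply: mulr_gt0 => //; apply: mulr_gt0 => //; exact: expR_gt0.
have h0 n : 0 <= (2^-1 : R) ^+ n by apply: exprn_ge0; lra.
have bnd1 n t : `|y_ n.+1 t - y_ n t| <= E * 2^-1 ^+ n - E * 2^-1 ^+ n.+1.
  rewrite (y_c n.+1) (y_c n).
  have /andP[t0 tl] := clamp_itv t (ltW l0).
  apply: le_trans (bnd n _ _) _; first by rewrite t0.
  have -> : E * 2^-1 ^+ n - E * 2^-1 ^+ n.+1 = C * 2^-1 ^+ n * expR (2 * L * l).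
    by rewrite /E exprS; field.
  apply: ler_wpM2l; first by apply: mulr_ge0 => //; lra.
  by rewrite ler_expR ler_wpM2l//; lra.
have bnd2 n m t : (n <= m)%N -> `|y_ m t - y_ n t| <= E * 2^-1 ^+ n.
  move=> nm; have : `|y_ m t - y_ n t| <= E * 2^-1 ^+ n - E * 2^-1 ^+ m.
    rewrite -(subnK nm); elim: (m - n)%N => [|j IH].
      by rewrite add0n !subrr normr0.
    have := bnd1 (j + n)%N t; move: IH; rewrite addSn !ler_norml; lra.
  move=> /le_trans; apply; rewrite gerBl; apply: mulr_ge0 => //; exact: ltW.
have lim0 c : c * (2^-1 : R) ^+ n @[n --> \oo] --> (0 : R).
  rewrite -(mulr0 c); apply: cvgM; first exact: cvg_cst.
  by apply: cvg_expr; rewrite ger0_norm; lra.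
have [y cy' Hy] := uniform_cauchy_limit (lim0 E) cy bnd2.
exists y; split => //.
- have : y 0 - y0 = 0.
    by apply: (eq0_of_norm_le (lim0 E)) => n; have := Hy n 0; rewrite y_0.
  by move/eqP; rewrite subr_eq0 => /eqP.
- move=> t; apply/eqP; rewrite -subr_eq0; apply/eqP.
  apply: (eq0_of_norm_le (lim0 (2 * E))) => n; have := Hy n t; have := Hy n (clamp 0 l t); rewrite -y_c.
  by rewrite !ler_norml; lra.
apply: (@is_derive_limit R (fun n => y_ n.+1) (fun n t => F t (y_ n t)) y
  (fun t => F t (y t)) 0 l (fun n => E * 2^-1 ^+ n) (fun n => L * E * 2^-1 ^+ n)) => //.
- move=> n t _; rewrite distrC; apply: le_trans (Hy n.+1 t) _.
  by apply: ler_wpM2l; [exact: ltW|rewrite exprS ler_piMl//; lra].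
- move=> n t _; apply: le_trans (LF _ _ _) _.
  by rewrite -mulrA; apply: ler_wpM2l; [exact: ltW|rewrite distrC].
- by move=> t _; exact: cF.
Qed.

(** * The singular equation W' = k + Q / W *)

Lemma max_dist (R : realType) (u v e : R) : `|Num.max u e - Num.max v e| <= `|u - v|.
Proof.
have := ler_norm (u - v); have := ler_norm (v - u); rewrite (distrC v) => h1 h2.
by rewrite ler_norml; case: (leP u e) => ?; case: (leP v e) => ?; lra.
Qed.

(* Truncating [k] below at [- Q / e] makes [e] a lower barrier: where [W <= e], the
   right-hand side is nonnegative. *)
Lemma regularized_saddle (R : realType) (k Q : R -> R) (l B p e : R) :
  continuous k -> continuous Q -> 0 < l -> 0 < e -> 0 <= p -> 0 < B ->
  (forall s, 0 <= Q s <= B) ->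
  exists W : R -> R, [/\ continuous W, W 0 = p + e,
    (forall t, W t = W (clamp 0 l t)), (forall t, e <= W t) &
    forall t, 0 < t < l -> is_derive t 1 W (Num.max (k t) (- (Q t / e)) + Q t / W t)].
Proof.
move=> ck cQ l0 e0 p0 B0 Qb.
have me (w : R) : e <= Num.max w e by rewrite le_max lexx orbT.
have me0 (w : R) : 0 < Num.max w e by apply: lt_le_trans (me w).
pose F t w := Num.max (k t) (- (Q t / e)) + Q t / Num.max w e.
have L0 : 0 < B / (e * e) by apply: divr_gt0 => //; exact: mulr_gt0.
have cF y : continuous y -> continuous (fun t => F t (y t)).
  move=> cy t; apply: cvgD.
    apply: (@continuous_max _ _ k (fun t => - (Q t / e))); first exact: ck.
    by apply: cvgN; apply: cvgM; [exact: cQ|exact: cvg_cst].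
  apply: cvgM; first exact: cQ.
  apply: cvgV; first by apply: lt0r_neq0; exact: me0.
  by apply: (@continuous_max _ _ y (cst e)); [exact: cy|exact: cst_continuous].
have LF t u v : `|F t u - F t v| <= B / (e * e) * `|u - v|.
  rewrite /F; set x := Num.max u e; set y := Num.max v e.
  have x0 : 0 < x by exact: me0.
  have y0 : 0 < y by exact: me0.
  have -> : Num.max (k t) (- (Q t / e)) + Q t / x - (Num.max (k t) (- (Q t / e)) + Q t / y)
    = Q t / (x * y) * (y - x).
    by field; rewrite !gt_eqF.
  have /andP[Q0 QB] := Qb t.
  rewrite normrM ger0_norm; last by apply: divr_ge0 => //; apply/ltW/mulr_gt0.
  apply: ler_pM => //; last by rewrite distrC; exact: max_dist.
    by apply: divr_ge0 => //; apply/ltW/mulr_gt0.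
  apply: ler_pM => //; first by rewrite invr_ge0; apply/ltW/mulr_gt0.
  rewrite lef_pV2 ?posrE; [|exact: mulr_gt0..].
  by apply: ler_pM; rewrite ?me//; exact: ltW.
have [W [cW W0 Wc dW]] := picard (p + e) L0 l0 cF LF.
have We t : e <= W t.
  rewrite Wc; have := clamp_itv t (ltW l0); move: (clamp 0 l t) => {}t tl.
  rewrite -subr_ge0; apply: (@ge0_comparison R (fun t => W t - e) 0 l) => //.
  - by move=> x; apply: cvgB; [exact: cW|exact: cvg_cst].
  - by rewrite W0; lra.
  move=> x xl We; exists (F x (W x) - 0); first by apply: is_deriveB; exact: dW.
  have Wx : Num.max (W x) e = e by apply: max_r; lra.
  have : - (Q x / e) <= Num.max (k x) (- (Q x / e)) by rewrite le_max lexx orbT.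
  by rewrite /F Wx; lra.
exists W; split => // t tl; have := dW t tl.
by rewrite /F (max_l (We t)).
Qed.

(** The equation is imposed only inside the interval: at the ends [W] may vanish, and there [Q / W]
    has no meaning as a slope. Continuity is all that ties the end values to the solution. *)
Definition saddle (R : realType) (k Q : R -> R) (l : R) (W : R -> R) : Prop :=
  continuous W /\
  forall s, 0 < s < l -> 0 < W s /\ is_derive s 1 W (k s + Q s / W s).

Section RegularizedComparison.
Variables (R : realType) (k Q : R -> R) (l M : R).
Hypothesis k_bounded : forall s, `|k s| <= M.
Hypothesis Q_ge0 : forall s, 0 <= Q s.

Definition regularized (e : R) (W : R -> R) : Prop :=
  [/\ continuous W, (forall t, W t = W (clamp 0 l t)), (forall t, e <= W t) &
    forall t, 0 < t < l -> is_derive t 1 W (Num.max (k t) (- (Q t / e)) + Q t / W t)].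

Lemma ge_maxk e s : 0 < e -> - M <= Num.max (k s) (- (Q s / e)) <= M.
Proof.
move=> e0; have := k_bounded s; rewrite ler_norml => /andP[k1 k2].
have Qe : 0 <= Q s / e by apply: divr_ge0 => //; exact: ltW.
by rewrite le_max ge_max k1 k2/=; lra.
Qed.

Lemma maxkE e s : 0 < e -> M * e <= Q s -> Num.max (k s) (- (Q s / e)) = k s.
Proof.
move=> e0 H; apply: max_l; have := k_bounded s; rewrite ler_norml => /andP[k1 k2].
have : M <= Q s / e by rewrite ler_pdivlMr.
by lra.
Qed.

Lemma regularized_diff (e e' p sigma : R) W W' :
  0 < l -> 0 < e' -> e' <= e -> 0 < sigma -> sigma < l / 2 ->
  (forall s, sigma <= s <= l - sigma -> M * e <= Q s) ->
  regularized e W -> regularized e' W' -> W 0 = p + e -> W' 0 = p + e' ->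
  forall t, 0 <= t <= l -> `|W t - W' t| <= e + 2 * M * sigma.
Proof.
move=> l0 e'0 e'e s0 sl HQ [cW _ We dW] [cW' _ We' dW'] W0 W0' t tl.
have e0 : 0 < e by lra.
have M0 : 0 <= M by apply: le_trans (k_bounded 0); exact: normr_ge0.
have cd : continuous (fun t => W t - W' t).
  by move=> x; apply: cvgB; [exact: cW|exact: cW'].
pose dd x := Num.max (k x) (- (Q x / e)) + Q x / W x -
  (Num.max (k x) (- (Q x / e')) + Q x / W' x).
have ddP x : 0 < x < l -> is_derive x 1 (fun t => W t - W' t) (dd x).
  by move=> xl; apply: is_deriveB; [exact: dW|exact: dW'].
have kk x : - (Q x / e') <= - (Q x / e).
  by rewrite lerN2; apply: ler_wpM2l => //; rewrite lef_pV2 ?posrE.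
have kk1 x : Num.max (k x) (- (Q x / e')) <= Num.max (k x) (- (Q x / e)).
  by rewrite ge_max le_max lexx /= le_max kk orbT.
have WV x : 0 < W x by apply: lt_le_trans (We x).
have WV' x : 0 < W' x by apply: lt_le_trans (We' x).
have d0 : forall x, 0 <= x <= l -> 0 <= W x - W' x.
  apply: ge0_comparison => //; first by rewrite W0 W0'; lra.
  move=> x xl Wx; exists (dd x); first exact: ddP.
  have : Q x / W' x <= Q x / W x.
    by apply: ler_wpM2l => //; rewrite lef_pV2 ?posrE ?WV ?WV'//; lra.
  by have := kk1 x; rewrite /dd; lra.
have QW x : 0 < x < l -> Q x / W x <= Q x / W' x.
  by move=> xl; apply: ler_wpM2l => //; rewrite lef_pV2 ?posrE ?WV ?WV'//; have := d0 x ltac:(lra); lra.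
have ddM x : 0 < x < l -> dd x <= M.
  move=> xl; have := QW x xl; rewrite /dd.
  suff : Num.max (k x) (- (Q x / e)) - Num.max (k x) (- (Q x / e')) <= M by lra.
  have Qe : 0 <= Q x / e by apply: divr_ge0 => //; exact: ltW.
  have := k_bounded x; rewrite ler_norml => /andP[k1 k2].
  have k3 : k x <= Num.max (k x) (- (Q x / e')) by rewrite le_max lexx.
  by case: (leP (k x) (- (Q x / e))) => ?; lra.
have dd0 x : sigma < x < l - sigma -> dd x <= 0.
  move=> xs; have := QW x; rewrite /dd => /(_ ltac:(lra)).
  have Qx : M * e <= Q x by apply: HQ; lra.
  rewrite !maxkE//; first by lra.
  by apply: le_trans Qx; apply: ler_wpM2l.
have inc a b c : 0 <= a -> a <= b -> b <= l -> (forall x, a < x < b -> dd x <= c) ->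
    W b - W' b <= W a - W' a + c * (b - a).
  move=> a0 ab bl Hc.
  have : c * a - (W a - W' a) <= c * b - (W b - W' b).
    apply: (@derive_ge0_le R (fun x => c * x - (W x - W' x))) => //.
      apply: continuous_subspaceT => x; apply: cvgB; last exact: cd.
      by apply: cvgM; [exact: cvg_cst|exact: cvg_id].
    move=> x xab; exists (c * 1 - dd x); last by have := Hc x ltac:(lra); lra.
    apply: is_deriveB; last by apply: ddP; lra.
  by lra.
rewrite ger0_norm ?d0//.
have W00 : W 0 - W' 0 <= e by rewrite W0 W0'; lra.
have H1 x : 0 <= x <= sigma -> W x - W' x <= e + M * sigma.
  move=> xs; have Hc y : 0 < y < x -> dd y <= M by move=> yx; apply: ddM; lra.
  have := inc 0 x M (lexx _) ltac:(lra) ltac:(lra) Hc.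
  by have : M * (x - 0) <= M * sigma by [apply: ler_wpM2l; lra]; lra.
have H2 x : 0 <= x <= l - sigma -> W x - W' x <= e + M * sigma.
  move=> xs; have [xs'|xs'] := leP x sigma; first by apply: H1; lra.
  have Hc y : sigma < y < x -> dd y <= 0 by move=> yx; apply: dd0; lra.
  have := inc sigma x 0 ltac:(lra) ltac:(lra) ltac:(lra) Hc.
  by have := H1 sigma ltac:(lra); lra.
have [ts|ts] := leP t (l - sigma).
  by have := H2 t ltac:(lra); have := mulr_ge0 M0 (ltW s0); lra.
have Hc y : l - sigma < y < t -> dd y <= M by move=> yt; apply: ddM; lra.
have := inc (l - sigma) t M ltac:(lra) ltac:(lra) ltac:(lra) Hc.
have : M * (t - (l - sigma)) <= M * sigma by [apply: ler_wpM2l; lra].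
by have := H2 (l - sigma) ltac:(lra); lra.
Qed.

(** Below a line through [(s1, 0)] of small slope, [Q / W] exceeds [M + 1], so [W] grows at rate at
    least 1 and cannot stay below. The bound does not depend on [e]; this is what keeps the limit
    positive. *)
Lemma regularized_lower (e s1 s2 eta : R) W :
  0 < e -> 0 < s1 -> s1 < s2 -> s2 < l -> 0 < eta ->
  (forall s, s1 <= s <= s2 -> eta <= Q s) -> regularized e W ->
  forall x, s1 <= x <= s2 -> Num.min 1 (eta / (l * (M + 1))) * (x - s1) <= W x.
Proof.
move=> e0 s10 s12 s2l eta0 HQ [cW _ We dW] x xs.
have l0 : 0 < l by lra.
have M0 : 0 <= M by apply: le_trans (k_bounded 0); exact: normr_ge0.
set lam := Num.min _ _.
have den0 : 0 < l * (M + 1) by apply: mulr_gt0 => //; lra.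
have lam0 : 0 < lam by rewrite lt_min ltr01 /=; exact: divr_gt0.
have lam1 : lam <= 1 by rewrite ge_min lexx.
have lam2 : lam * (l * (M + 1)) <= eta.
  by rewrite -ler_pdivlMr// ge_min lexx orbT.
rewrite -subr_ge0.
apply: (@ge0_comparison R (fun x => W x - lam * (x - s1)) s1 s2) => //.
- move=> y; apply: cvgB; first exact: cW.
  apply: cvgM; first exact: cvg_cst.
  by apply: cvgB; [exact: cvg_id|exact: cvg_cst].
- by rewrite subrr mulr0 subr0; apply: le_trans (We s1); exact: ltW.
move=> y ys Wy.
exists (Num.max (k y) (- (Q y / e)) + Q y / W y - lam * (1 - 0)).
  by apply: is_deriveB; apply: dW; lra.
have Wy0 : 0 < W y by apply: lt_le_trans (We y).
have : M + 1 <= Q y / W y.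
  rewrite ler_pdivlMr//; apply: le_trans (HQ y _); last by lra.
  apply: le_trans lam2; rewrite mulrA [lam * l * _]mulrC.
  apply: ler_wpM2l; first by lra.
  have : lam * (y - s1) <= lam * l by [apply: ler_wpM2l; lra]; lra.
have := ge_maxk y e0; lra.
Qed.

End RegularizedComparison.

Lemma positive_min (R : realType) (Q : R -> R) (a b : R) : a <= b -> continuous Q ->
  (forall s, a <= s <= b -> 0 < Q s) ->
  exists2 eta, 0 < eta & forall s, a <= s <= b -> eta <= Q s.
Proof.
move=> ab cQ HQ.
have [c cab H] := EVT_min ab (continuous_subspaceT cQ).
exists (Q c); first by apply: HQ; move: cab; rewrite in_itv.
by move=> s sab; apply: H; rewrite in_itv.
Qed.

(** The regularized solutions are uniformly Cauchy by [regularized_diff]. Locally inside the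
    interval they are bounded below uniformly and the truncation is eventually inactive, so the
    equation passes to the limit. *)
Lemma saddle_exists (R : realType) (k Q : R -> R) (l M B p : R) :
  continuous k -> continuous Q -> 0 < l -> 0 <= p -> 0 < B ->
  (forall s, `|k s| <= M) -> (forall s, 0 <= Q s <= B) ->
  (forall s, 0 < s < l -> 0 < Q s) ->
  exists2 W, saddle k Q l W & W 0 = p.
Proof.
move=> ck cQ l0 p0 B0 Mk Qb Qpos.
have Q0 s : 0 <= Q s by have /andP[] := Qb s.
have M0 : 0 <= M by apply: le_trans (Mk 0); exact: normr_ge0.
(* Width of the end layers; the factor [l / 3] keeps the two layers disjoint. *)
pose sg n := l / 3 * (n.+1%:R)^-1 : R.
have h0 n : 0 < (n.+1%:R^-1 : R) by rewrite invr_gt0 ltr0n.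
have h1 n : (n.+1%:R^-1 : R) <= 1 by rewrite invf_le1 ?ler1n ?ltr0n.
have hm n m : (n <= m)%N -> (m.+1%:R^-1 : R) <= n.+1%:R^-1.
  by move=> nm; rewrite lef_pV2 ?posrE ?ltr0n// ler_nat ltnS.
have sg0 n : 0 < sg n by apply: mulr_gt0 => //; lra.
have sgl n : sg n < l / 2.
  have : sg n <= l / 3 * 1 by [apply: ler_wpM2l => //; lra]; lra.
have ex_e n : exists e, 0 < e /\ e <= n.+1%:R^-1 /\
    forall s, sg n <= s <= l - sg n -> M * e <= Q s.
  have [|s ss|eta eta0 He] := @positive_min R Q (sg n) (l - sg n) _ cQ.
  - by have := sgl n; lra.
  - by apply: Qpos; have := sg0 n; lra.
  (* The denominator is [M + 1] because [M] may be 0. *)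
  exists (Num.min (n.+1%:R^-1) (eta / (M + 1))); split.
    by rewrite lt_min h0/=; apply: divr_gt0 => //; lra.
  split; first by rewrite ge_min lexx.
  move=> s ss; apply: le_trans (He s ss).
  have : (M + 1) * Num.min (n.+1%:R^-1) (eta / (M + 1)) <= eta.
    rewrite mulrC -ler_pdivlMr; last by lra.
    by rewrite ge_min lexx orbT.
  apply: le_trans; apply: ler_wpM2r; last by lra.
  by rewrite le_min ltW//=; apply: divr_ge0; lra.
have [e_ He] := choice ex_e.
have e0 n : 0 < e_ n by have [] := He n.
have eh n : e_ n <= n.+1%:R^-1 by have [_ []] := He n.
have eQ n : forall s, sg n <= s <= l - sg n -> M * e_ n <= Q s by have [_ []] := He n.
have ex_W n : exists W, regularized k Q l (e_ n) W /\ W 0 = p + e_ n.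
  have [W [cW W0 Wc We dW]] := regularized_saddle ck cQ l0 (e0 n) p0 B0 Qb.
  by exists W.
have [W_ HW] := choice ex_W.
pose d n := (1 + 2 * M * (l / 3)) * n.+1%:R^-1 : R.
have dlim : d @ \oo --> (0 : R).
  rewrite -(mulr0 (1 + 2 * M * (l / 3))).
  by apply: cvgM; [exact: cvg_cst|exact: cvg_harmonic].
have dE n : e_ n + 2 * M * sg n <= d n by have := eh n; rewrite /d /sg; move: (_^-1) => h; lra.
have dm n m : (n <= m)%N -> d m <= d n.
  move=> /hm; rewrite /d; apply: ler_wpM2l.
  by apply: addr_ge0 => //; apply: mulr_ge0; lra.
have Wc n t : W_ n t = W_ n (clamp 0 l t) by have [[_ + _ _] _] := HW n; exact.
have cW n : continuous (W_ n) by have [[]] := HW n.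
have Wd n m t : (n <= m)%N -> `|W_ m t - W_ n t| <= d n.
  move=> nm; rewrite Wc (Wc n).
  have := clamp_itv t (ltW l0); move: (clamp 0 l t) => {}t tl.
  have [Rn Wn] := HW n; have [Rm Wm] := HW m.
  (* The parameters [e_ n] are not ordered by [n]; whichever is larger supplies the layer estimate,
     and monotonicity of [d] reduces both cases to [d n]. *)
  have [enm|enm] := leP (e_ n) (e_ m).
    apply: le_trans (dm _ _ nm); apply: le_trans (dE m).
    exact: (@regularized_diff R k Q l M Mk Q0 _ (e_ n) p _ (W_ m) (W_ n) l0 _ _ _ _ (eQ m)).
  apply: le_trans (dE n); rewrite distrC.
  exact: (@regularized_diff R k Q l M Mk Q0 _ (e_ m) p _ (W_ n) (W_ m) l0 _ (ltW enm) _ _ (eQ n)).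
have [W cW' HWl] := uniform_cauchy_limit dlim cW Wd.
have W0 : W 0 = p.
  apply/eqP; rewrite -subr_eq0; apply/eqP.
  have lim2 : (fun n => d n + n.+1%:R^-1) @ \oo --> (0 : R).
    by rewrite -[X in _ --> X]addr0; apply: cvgD => //; exact: cvg_harmonic.
  apply: (eq0_of_norm_le lim2) => n.
  have := HWl n 0; have [_ ->] := HW n; have := eh n; have := e0 n.
  by rewrite !ler_norml; move: (n.+1%:R^-1) => h; lra.
exists W => //; split => // s /andP[s0 sl].
have s12 : s / 2 < (s + l) / 2 by lra.
have [|x xs|eta eta0 Heta] := @positive_min R Q (s / 2) ((s + l) / 2) _ cQ.
- exact: ltW.
- by apply: Qpos; lra.
have low n x : s / 2 <= x <= (s + l) / 2 ->
    Num.min 1 (eta / (l * (M + 1))) * (x - s / 2) <= W_ n x.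
  have [Rn _] := HW n.
  by apply: (regularized_lower Mk Q0 (e0 n) _ s12 _ eta0 Heta Rn); lra.
set lam := Num.min _ _ in low.
have lam0 : 0 < lam.
  by rewrite lt_min ltr01/=; apply: divr_gt0 => //; apply: mulr_gt0; lra.
pose b := lam * (s / 4).
have b0 : 0 < b by apply: mulr_gt0 => //; lra.
pose a1 := 3 / 4 * s; pose a2 := (s + l) / 2.
have lowb n x : a1 < x < a2 -> b <= W_ n x.
  rewrite /a1 /a2 => xa; apply: le_trans (low n x _); last by lra.
  by apply: ler_wpM2l; lra.
have lowW x : a1 < x < a2 -> b <= W x.
  move=> xa; have cx : W_ n x @[n --> \oo] --> W x.
    apply/cvgrPdist_lt => r r0; have /cvgrPdist_lt/(_ r r0)[N _ HN] := dlim.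
    exists N => // n /= Nn; apply: le_lt_trans (HWl n x) _.
    have := HN n Nn; rewrite /= sub0r normrN.
    exact: le_lt_trans (ler_norm _).
  rewrite -(cvg_lim _ cx)//; apply: limr_ge; first by apply/cvg_ex; eexists; exact: cx.
  by apply: nearW => n; exact: lowb.
have sa : a1 < s < a2 by rewrite /a1 /a2; lra.
split; first by apply: lt_le_trans (lowW s sa).
(* From index [N] on, [M * e_ n <= eta <= Q] around [s], so there the regularized equation is the
   original one. *)
have [N HN] : exists N : nat, M * N.+1%:R^-1 <= eta.
  have lM : M * (n.+1%:R^-1 : R) @[n --> \oo] --> (0 : R).
    by rewrite -(mulr0 M); apply: cvgM; [exact: cvg_cst|exact: cvg_harmonic].
  have /cvgrPdist_lt/(_ eta eta0)[N _ HN] := lM.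
  exists N; have := HN N (leqnn N); rewrite /= sub0r normrN => /ltW.
  exact: le_trans (ler_norm _).
have kE n x : a1 < x < a2 -> Num.max (k x) (- (Q x / e_ (N + n)%N)) = k x.
  rewrite /a1 /a2 => xa; apply: (maxkE Mk) => //.
  apply: le_trans (Heta x _); last by lra.
  apply: le_trans HN; apply: ler_wpM2l => //.
  by apply: le_trans (eh _) _; apply: hm; exact: leq_addr.
apply: (@is_derive_limit R (fun n => W_ (N + n)%N) (fun n x => k x + Q x / W_ (N + n)%N x)
  W (fun x => k x + Q x / W x) a1 a2 d (fun n => B / (b * b) * d n)) => //.
- by rewrite -(mulr0 (B / (b * b))); apply: cvgM; [exact: cvg_cst|].
- move=> n x xa; rewrite distrC; apply: le_trans (HWl _ _) _.
  by apply: dm; exact: leq_addl.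
- move=> n x xa; set m := (N + n)%N.
  have Wm0 : 0 < W_ m x by apply: lt_le_trans (lowb m x xa).
  have W0' : 0 < W x by apply: lt_le_trans (lowW x xa).
  have -> : k x + Q x / W_ m x - (k x + Q x / W x) = Q x / (W_ m x * W x) * (W x - W_ m x).
    by field; rewrite !gt_eqF.
  have QW0 : 0 <= Q x / (W_ m x * W x) by apply: divr_ge0 => //; apply/ltW/mulr_gt0.
  rewrite normrM ger0_norm//; apply: ler_pM => //.
    apply: ler_pM => //.
    - by rewrite invr_ge0; apply/ltW/mulr_gt0.
    - by have /andP[] := Qb x.
    rewrite lef_pV2 ?posrE; [|exact: mulr_gt0..].
    by apply: ler_pM; [exact: ltW|exact: ltW|exact: lowb|exact: lowW].
  by apply: le_trans (HWl _ _) _; apply: dm; exact: leq_addl.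
- move=> t ta; apply: cvgD; first exact: ck.
  apply: cvgM; first exact: cQ.
  apply: cvgV; last exact: cW'.
  by apply: lt0r_neq0; apply: lt_le_trans (lowW t ta).
- move=> n t ta; rewrite -[X in X + _](kE n t ta).
  have [[_ _ _ dW] _] := HW (N + n)%N; apply: dW.
  by move: ta; rewrite /a1 /a2; lra.
Qed.

(** * Comparison, vanishing at the far end, and shooting *)

Lemma saddle_ge0 (R : realType) (k Q W : R -> R) (l : R) :
  0 < l -> saddle k Q l W -> 0 <= W l.
Proof.
move=> l0 [cW HW]; rewrite leNgt; apply/negP => Wl.
have [|r r0 Hr] := @continuous_near_ball R W l (- W l) (cW l); first lra.
pose x := Num.max (l / 2) (l - r / 2).
have xr : l / 2 <= x /\ l - r / 2 <= x /\ x < l.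
  by rewrite /x !le_max !lexx orbT gt_max; do !split => //; lra.
have : `|W x - W l| < - W l by apply: Hr; rewrite ltr_norml; lra.
have [] := HW x ltac:(lra).
by rewrite ltr_norml; lra.
Qed.

(** Wherever [W1] exceeds [W2 + e * s] it also exceeds [W2], so [Q / W1 <= Q / W2] and the gap
    closes. With [e = 0] this is monotonicity in [k] and in the initial value; with [e] the distance
    of two speeds it is the Lipschitz dependence used in the shooting. *)
Lemma saddle_comparison (R : realType) (k1 k2 Q W1 W2 : R -> R) (l e : R) :
  0 < l -> (forall s, 0 < s < l -> 0 <= Q s) ->
  (forall s, 0 < s < l -> k1 s <= k2 s + e) ->
  saddle k1 Q l W1 -> saddle k2 Q l W2 -> W1 0 <= W2 0 ->  0 <= e ->
  forall s, 0 <= s <= l -> W1 s <= W2 s + e * s.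
Proof.
move=> l0 Q0 k12 [c1 H1] [c2 H2] W0 e0 s sl; rewrite -subr_ge0.
have cs : continuous (fun s : R => e * s).
  by move=> x; apply: cvgM; [exact: cvg_cst|exact: cvg_id].
apply: (@ge0_comparison R (fun s => W2 s + e * s - W1 s) 0 l) => //.
- move=> x; apply: cvgB; last exact: c1.
  by apply: cvgD; [exact: c2|exact: cs].
- by rewrite mulr0 addr0 subr_ge0.
move=> x xl Wx; have [W1p D1] := H1 x xl; have [W2p D2] := H2 x xl.
exists (k2 x + Q x / W2 x + e * 1 - (k1 x + Q x / W1 x)).
  have dM := @is_derive_mulc R id e x 1 (is_derive_id _ _).
  by apply: is_deriveB; exact: is_deriveD.
have : 0 <= e * x by apply: mulr_ge0; lra.
move=> ex; have : Q x / W1 x <= Q x / W2 x.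
  by apply: ler_wpM2l; [exact: Q0|rewrite lef_pV2 ?posrE//; lra].
by have := k12 x xl; lra.
Qed.

Lemma last_nonpos (R : realType) (u : R -> R) (a b : R) :
  continuous u -> a <= b -> u a <= 0 -> 0 < u b ->
  exists s, [/\ a <= s, s < b, u s <= 0 & forall x, s < x <= b -> 0 < u x].
Proof.
move=> cu ab ua ub.
pose S := [set s | a <= s <= b /\ u s <= 0].
have Sa : S a by split => //; rewrite lexx.
have hS : has_sup S by split; [exists a|exists b => s [/andP[]]].
pose s := sup S.
have as_ : a <= s by apply: sup_upper_bound.
have sb : s <= b by apply: ge_sup => //; [exists a|move=> x [/andP[]]].
have us : u s <= 0.
  rewrite leNgt; apply/negP => us.
  have [r r0 Hr] := continuous_near_ball (cu s) us.
  have [y [/andP[ay yb] uy] ys] := sup_adherent r0 hS; rewrite -/s in ys.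
  have ys' : y <= s by apply: sup_upper_bound => //; split => //; rewrite ay.
  have : `|u y - u s| < u s by apply: Hr; rewrite ltr_norml; lra.
  by rewrite ltr_norml; lra.
exists s; split => //.
  by rewrite lt_neqAle sb andbT; apply/eqP => E; move: us; rewrite E; lra.
move=> x /andP[sx xb]; rewrite ltNge; apply/negP => ux.
have : x <= s by apply: sup_upper_bound => //; split => //; lra.
by lra.
Qed.

(* Right of the last point where [W <= m / 2 * (l - s)] one has [Q / W <= m / 2], and
   integrating from there to [l] gives [W l <= 0]. *)
Lemma saddle_node (R : realType) (k Q K W : R -> R) (l m S : R) :
  0 < l -> saddle k Q l W -> continuous K ->
  (forall s, 0 < s < l -> is_derive s 1 K (k s)) ->
  (forall s, 0 <= s <= l -> K l - K s <= - m * (l - s)) ->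
  (forall s, 0 < s < l -> Q s <= S * (l - s)) ->
  0 < m -> 4 * S <= m ^+ 2 -> W 0 <= m / 2 * l -> W l = 0.
Proof.
move=> l0 HW cK dK HK HQ m0 Sm W0; apply/eqP; rewrite eq_le (saddle_ge0 l0 HW) andbT.
have [cW W_] := HW.
rewrite leNgt; apply/negP => Wl.
have cu : continuous (fun s => W s - m / 2 * (l - s)).
  move=> x; apply: cvgB; first exact: cW.
  apply: cvgM; first exact: cvg_cst.
  by apply: cvgB; [exact: cvg_cst|exact: cvg_id].
have [||s1 [s10 s1l Ws1 Wpos]] := last_nonpos cu (ltW l0).
- by rewrite subr0; lra.
- by rewrite subrr mulr0 subr0.
have Sm2 : S <= m / 2 * (m / 2) by move: Sm; rewrite expr2; lra.
have : m / 2 * s1 - (W s1 - K s1) <= m / 2 * l - (W l - K l).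
  apply: (@derive_ge0_le R (fun s => m / 2 * s - (W s - K s))); first exact: ltW.
    apply: continuous_subspaceT => x; apply: cvgB.
      by apply: cvgM; [exact: cvg_cst|exact: cvg_id].
    by apply: cvgB; [exact: cW|exact: cK].
  move=> x xs; have [Wx dW] := W_ x ltac:(lra).
  have dKx := dK x ltac:(lra).
  have dM := @is_derive_mulc R id (m / 2) x 1 (is_derive_id _ _).
  exists (m / 2 * 1 - (k x + Q x / W x - k x)).
    by apply: is_deriveB; exact: is_deriveB.
  suff : Q x / W x <= m / 2 by lra.
  rewrite ler_pdivrMr//.
  have Wx1 := Wpos x ltac:(lra).
  apply: le_trans (HQ x _) _; first by lra.
  have : S * (l - x) <= m / 2 * (m / 2) * (l - x) by [apply: ler_wpM2r; lra].
  have : m / 2 * (m / 2 * (l - x)) <= m / 2 * W x by [apply: ler_wpM2l; lra].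
  lra.
have := HK s1 ltac:(lra).
by lra.
Qed.

(** If [k l >= 0], then [W' >= - eta] near [l] gives [W <= eta * (l - s)], hence
    [Q / W >= mu / eta >= eta] and [W' >= 0]. A positive [W] could then not come down to 0. *)
Lemma saddle_node_slope (R : realType) (k Q W : R -> R) (l e mu : R) :
  0 < l -> saddle k Q l W -> {for l, continuous k} -> W l = 0 -> 0 < e -> 0 < mu ->
  (forall s, l - e < s < l -> mu * (l - s) <= Q s) -> k l < 0.
Proof.
move=> l0 [cW HW] ck Wl e0 mu0 HQ; rewrite ltNge; apply/negP => kl.
(* Chosen so that [eta * eta < mu], whatever the size of [mu]. *)
pose eta := Num.min 1 (mu / 2).
have eta0 : 0 < eta by rewrite lt_min ltr01/=; lra.
have eta1 : eta <= 1 by rewrite ge_min lexx.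
have eta2 : eta * eta < mu.
  have : eta <= mu / 2 by rewrite ge_min lexx orbT.
  have : eta * eta <= 1 * eta by [apply: ler_wpM2r; lra]; lra.
have [r r0 Hr] := continuous_near_ball ck eta0.
pose a := Num.max (l / 2) (Num.max (l - e) (l - r)).
have al : a < l by rewrite !gt_max; lra.
have a0 : l / 2 <= a by rewrite le_max lexx.
have ae : l - e <= a by rewrite !le_max lexx /= orbT.
have ar : l - r <= a by rewrite !le_max lexx /= !orbT.
have kx x : a < x < l -> - eta <= k x.
  move=> xa; have := Hr x; rewrite !ltr_norml => /(_ ltac:(lra)); lra.
have We x : a < x < l -> W x <= eta * (l - x).
  move=> xa; have : eta * x + W x <= eta * l + W l.
    apply: (@derive_ge0_le R (fun s => eta * s + W s)); first by lra.
      apply: continuous_subspaceT => y; apply: cvgD; last exact: cW.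
      by apply: cvgM; [exact: cvg_cst|exact: cvg_id].
    move=> y yx; have [Wy dW] := HW y ltac:(lra).
    have dM := @is_derive_mulc R id eta y 1 (is_derive_id _ _).
    exists (eta * 1 + (k y + Q y / W y)); first exact: is_deriveD.
    have : 0 <= Q y / W y.
      apply: divr_ge0; last exact: ltW.
      by apply: le_trans (HQ y _); [apply: mulr_ge0; lra|lra].
    by have := kx y ltac:(lra); lra.
  lra.
pose x := (a + l) / 2.
have xa : a < x < l by rewrite /x; lra.
have [Wx _] := HW x ltac:(lra).
suff : W x <= W l by lra.
apply: derive_ge0_le; [lra|exact: continuous_subspaceT|].
move=> y yx; have [Wy dW] := HW y ltac:(lra).
exists (k y + Q y / W y) => //.
suff : eta <= Q y / W y by have := kx y ltac:(lra); lra.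
rewrite ler_pdivlMr//; apply: le_trans (HQ y _); last by lra.
have : eta * W y <= eta * (eta * (l - y)) by [apply: ler_wpM2l; [lra|apply: We; lra]].
have : eta * eta * (l - y) <= mu * (l - y) by [apply: ler_wpM2r; lra].
by lra.
Qed.

(** The slope [M + C + 1] is at least 1, so above the line [s / u <= 1] and [u] grows no faster than
    [M + C]. *)
Lemma linear_upper_bound (R : realType) (u du : R -> R) (l M C : R) :
  continuous u -> u 0 = 0 -> 0 <= M -> 0 <= C ->
  (forall s, 0 < s < l -> is_derive s 1 u (du s)) ->
  (forall s, 0 < s < l -> 0 < u s -> du s <= M + C * s / u s) ->
  forall s, 0 <= s <= l -> u s <= (M + C + 1) * s.
Proof.
move=> cu u0 M0 C0 Du Hu s sl; rewrite -subr_ge0.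
apply: (@ge0_comparison R (fun s => (M + C + 1) * s - u s) 0 l) => //.
- move=> x; apply: cvgB; last exact: cu.
  by apply: cvgM; [exact: cvg_cst|exact: cvg_id].
- by rewrite mulr0 u0 subrr.
move=> x xl ux.
have dM := @is_derive_mulc R id (M + C + 1) x 1 (is_derive_id _ _).
have dux := Du x xl.
exists ((M + C + 1) * 1 - du x); first exact: is_deriveB.
have x1 : 0 <= (M + C) * x by apply: mulr_ge0; lra.
have ux0 : 0 < u x by lra.
have : C * x / u x <= C.
  by rewrite ler_pdivrMr//; apply: ler_wpM2l => //; lra.
by have := Hu x xl ux0; lra.
Qed.

(** The speed enters the two equations with opposite signs, so the end value of the first piece
    grows with [c] while that of the second falls. Both are Lipschitz in [c], and the intermediate
    value theorem finds a match. *)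
Lemma shooting (R : realType) (k1 k2 Q1 Q2 : R -> R) (l1 l2 M B c0 : R) :
  continuous k1 -> continuous k2 -> continuous Q1 -> continuous Q2 ->
  0 < l1 -> 0 < l2 -> 0 < B ->
  (forall s, `|k1 s| <= M) -> (forall s, `|k2 s| <= M) ->
  (forall s, 0 <= Q1 s <= B) -> (forall s, 0 <= Q2 s <= B) ->
  (forall s, 0 < s < l1 -> 0 < Q1 s) -> (forall s, 0 < s < l2 -> 0 < Q2 s) ->
  (forall W, saddle (fun s => c0 - k1 s) Q1 l1 W -> W 0 = 0 -> W l1 = 0) ->
  exists c W1 W2, [/\ c0 <= c, saddle (fun s => c - k1 s) Q1 l1 W1 /\ W1 0 = 0,
    saddle (fun s => k2 s - c) Q2 l2 W2 /\ W2 0 = 0 & W1 l1 = W2 l2].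
Proof.
move=> ck1 ck2 cQ1 cQ2 l10 l20 B0 kM1 kM2 QB1 QB2 Qp1 Qp2 H0.
have ex1 c : exists W, saddle (fun s => c - k1 s) Q1 l1 W /\ W 0 = 0.
  have [||W] := @saddle_exists R (fun s => c - k1 s) Q1 l1 (`|c| + M) B 0 _ cQ1 l10 (lexx _) B0 _ QB1 Qp1.
  - by move=> x; apply: cvgB; [exact: cvg_cst|exact: ck1].
  - by move=> s; apply: le_trans (ler_normB _ _) _; rewrite lerD2l.
  by exists W.
have ex2 c : exists W, saddle (fun s => k2 s - c) Q2 l2 W /\ W 0 = 0.
  have [||W] := @saddle_exists R (fun s => k2 s - c) Q2 l2 (M + `|c|) B 0 _ cQ2 l20 (lexx _) B0 _ QB2 Qp2.
  - by move=> x; apply: cvgB; [exact: ck2|exact: cvg_cst].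
  - by move=> s; apply: le_trans (ler_normB _ _) _; rewrite lerD2r.
  by exists W.
have [A HA] := choice ex1; have [C HC] := choice ex2.
have Q10 s : 0 < s < l1 -> 0 <= Q1 s by move=> _; have /andP[] := QB1 s.
have Q20 s : 0 < s < l2 -> 0 <= Q2 s by move=> _; have /andP[] := QB2 s.
have compA c c' e : c <= c' + e -> 0 <= e -> A c l1 <= A c' l1 + e * l1.
  move=> cc e0; have [S1 Z1] := HA c; have [S2 Z2] := HA c'.
  apply: (saddle_comparison l10 Q10 _ S1 S2); rewrite ?Z1 ?Z2//; last by lra.
  by move=> s _; lra.
have compC c c' e : c' <= c + e -> 0 <= e -> C c l2 <= C c' l2 + e * l2.
  move=> cc e0; have [S1 Z1] := HC c; have [S2 Z2] := HC c'.
  apply: (saddle_comparison l20 Q20 _ S1 S2); rewrite ?Z1 ?Z2//; last by lra.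
  by move=> s _; lra.
pose F c := A c l1 - C c l2.
have FL c c' : `|F c - F c'| <= (l1 + l2) * `|c - c'|.
  have n0 := normr_ge0 (c - c').
  have h1 := ler_norm (c - c'); have h2 := ler_norm (c' - c); rewrite distrC in h2.
  have a1 := compA c c' `|c - c'| ltac:(lra) n0.
  have a2 := compA c' c `|c - c'| ltac:(lra) n0.
  have a3 := compC c c' `|c - c'| ltac:(lra) n0.
  have a4 := compC c' c `|c - c'| ltac:(lra) n0.
  by rewrite /F ler_norml; lra.
have cF : continuous F.
  move=> c; apply: ball_continuous => e e0; exists (e / (l1 + l2)).
    by apply: divr_gt0 => //; lra.
  move=> y; rewrite ltr_pdivlMr; last by lra.
  by apply: le_lt_trans; rewrite mulrC; exact: FL.
have Fc0 : F c0 <= 0.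
  rewrite /F; have [S Z] := HA c0; rewrite (H0 _ S Z).
  by have := saddle_ge0 l20 (HC c0).1; lra.
(* Since [W1' >= c - M], at this speed the first end value is at least [C c0 l2], which in turn
   bounds the second end value for all larger speeds. *)
pose c1 := Num.max c0 (M + C c0 l2 / l1).
have c01 : c0 <= c1 by rewrite le_max lexx.
have Fc1 : 0 <= F c1.
  have C1 : C c1 l2 <= C c0 l2 by have := compC c1 c0 0 ltac:(lra) (lexx _); lra.
  suff : C c0 l2 <= A c1 l1 by rewrite /F; lra.
  have [[cA SA] Z] := HA c1.
  have : A c1 0 - (c1 - M) * 0 <= A c1 l1 - (c1 - M) * l1.
    apply: (@derive_ge0_le R (fun s => A c1 s - (c1 - M) * s)); first exact: ltW.
      apply: continuous_subspaceT => x; apply: cvgB; first exact: cA.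
      by apply: cvgM; [exact: cvg_cst|exact: cvg_id].
    move=> x xl; have [Ax dA] := SA x xl.
    have dM := @is_derive_mulc R id (c1 - M) x 1 (is_derive_id _ _).
    exists (c1 - k1 x + Q1 x / A c1 x - (c1 - M) * 1); first exact: is_deriveB.
    have : 0 <= Q1 x / A c1 x by apply: divr_ge0; [exact: Q10|exact: ltW].
    by have := kM1 x; rewrite ler_norml; lra.
  have : C c0 l2 <= (c1 - M) * l1.
    rewrite -ler_pdivrMr//.
    have : M + C c0 l2 / l1 <= c1 by rewrite le_max lexx orbT.
    by lra.
  by rewrite Z; lra.
have [|c cin Fc] := @IVT R F c0 c1 0 c01 (continuous_subspaceT cF).
  by rewrite ge_min le_max Fc0 Fc1 orbT.
exists c, (A c), (C c); split => //.
- by move: cin; rewrite in_itv/= => /andP[].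
- by move: Fc; rewrite /F; lra.
Qed.

(** * Finite crossing time at a zero of D *)

Lemma right_limit_of_nondecreasing (R : realType) (B : R -> R) (e K : R) : 0 < e ->
  (forall x y, 0 < x -> x <= y -> y < e -> B x <= B y) ->
  (forall x, 0 < x < e -> K <= B x) ->
  exists l, forall eps, 0 < eps ->
    exists2 r, 0 < r & forall x, 0 < x < r -> `|B x - l| < eps.
Proof.
move=> e0 mB bB; pose S := [set B x | x in `]0, e[%classic].
have S0 : S (B (e / 2)) by exists (e / 2) => //=; rewrite in_itv/=; lra.
have hS : has_inf S.
  split; first by exists (B (e / 2)).
  by exists K => y [x] /=; rewrite in_itv/= => xe <-; exact: bB.
exists (inf S) => eps eps0.
have [z [x /= xe zE] Bx] := inf_adherent eps0 hS.
rewrite in_itv/= in xe; rewrite -{}zE in Bx.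
exists x; first by lra.
move=> y yx; have By : inf S <= B y.
  by apply: ge_inf; [exact: hS.2|exists y => //=; rewrite in_itv/=; lra].
have : B y <= B x by apply: mB; lra.
by rewrite ltr_norml; lra.
Qed.

(** [B] is compared with the integral of [x ^ (- tau)] against [dA], by parts. As [A] is O(x) and
    [tau < 1], the boundary term [A * x ^ (- tau)] stays bounded and the remaining integrand is O(x
    ^ (- tau)), hence integrable; [q] is the constant that absorbs it. *)
Lemma crossing_bound (R : realType) (A B b g : R -> R) (e C L tau : R) :
  0 < e -> 0 < L -> 0 < tau < 1 -> 0 <= C ->
  (forall x, 0 < x < e -> is_derive x 1 A (g x * b x)) ->
  (forall x, 0 < x < e -> is_derive x 1 B (b x)) ->
  (forall x, 0 < x < e -> 0 <= b x) ->
  (forall x, 0 < x < e -> L * x `^ tau <= g x) ->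
  (forall x, 0 < x < e -> `|A x| <= C * x) ->
  exists K, forall x, 0 < x < e -> K <= B x.
Proof.
move=> e0 L0 t01 C0 dA dB b0 HL HA.
have Pt x : 0 < x -> x `^ tau * x `^ (- tau) = 1.
  by move=> x0; rewrite -powRD ?subrr ?powRr0//; apply/implyP => _; rewrite gt_eqF.
have P1 x : 0 < x -> x `^ (- tau - 1) * x = x `^ (- tau).
  move=> x0; have := @powRD R x (- tau - 1) 1.
  rewrite subrK (powRr1 (ltW x0)) => -> //.
  by apply/implyP => _; rewrite gt_eqF.
have P2 x : 0 < x -> x `^ (1 - tau) = x * x `^ (- tau).
  move=> x0; have := @powRD R x 1 (- tau).
  rewrite (powRr1 (ltW x0)) => -> //.
  by apply/implyP => _; rewrite gt_eqF.
(* [H] is nondecreasing, so it is bounded above near 0, while its first and last terms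
   are bounded there. *)
pose q := C * (tau / (1 - tau)).
pose H x := A x * x `^ (- tau) - L * B x + q * x `^ (1 - tau).
have dH x : 0 < x < e -> exists2 h, is_derive x 1 H h & 0 <= h.
  move=> xe; have x0 : 0 < x by lra.
  have dAx := dA x xe; have dBx := dB x xe.
  have dp1 : is_derive x 1 (fun x => x `^ (- tau)) (- tau * x `^ (- tau - 1)) by exact: is_derive1_powR.
  have dp2 : is_derive x 1 (fun x => x `^ (1 - tau)) ((1 - tau) * x `^ (1 - tau - 1)).
    exact: is_derive1_powR.
  have dm : is_derive x 1 (fun x => A x * x `^ (- tau))
      (A x *: (- tau * x `^ (- tau - 1)) + x `^ (- tau) *: (g x * b x)).
    exact: (@is_deriveM _ _ A).
  have dL := @is_derive_mulc R B L x _ dBx.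
  have dq := @is_derive_mulc R (fun x => x `^ (1 - tau)) q x _ dp2.
  exists (A x *: (- tau * x `^ (- tau - 1)) + x `^ (- tau) *: (g x * b x) - L * b x +
    q * ((1 - tau) * x `^ (1 - tau - 1))).
    by apply: is_deriveD; exact: is_deriveB.
  rewrite /GRing.scale/=.
  have -> : 1 - tau - 1 = - tau by ring.
  set p1 := x `^ (- tau - 1); set p := x `^ (- tau).
  have p0 : 0 < p by exact: powR_gt0.
  have p10 : 0 < p1 by exact: powR_gt0.
  have -> : q * ((1 - tau) * p) = C * tau * p by rewrite /q; field; lra.
  have h1 : L <= p * g x.
    have : L * x `^ tau * p <= g x * p by apply: ler_wpM2r; [exact: ltW|exact: HL].
    by rewrite -mulrA Pt// mulr1 [g x * p]mulrC.
  have h2 : L * b x <= p * g x * b x by apply: ler_wpM2r => //; exact: b0.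
  have h3 : A x * (tau * p1) <= C * x * (tau * p1).
    apply: ler_wpM2r; first by apply: mulr_ge0; lra.
    by have := HA x xe; rewrite ler_norml; lra.
  have h4 : C * x * (tau * p1) = C * tau * p by rewrite /p -P1// -/p1; ring.
  by lra.
have incH x y : 0 < x -> x <= y -> y < e -> H x <= H y.
  move=> x0 xy ye; apply: derive_ge0_le => //; last by move=> z ?; apply: dH; lra.
  apply: continuous_in_subspaceT => z /set_mem /=; rewrite in_itv/= => zxy.
  by have [h dh _] := dH z ltac:(lra); exact: continuous_is_derive dh.
have incB x y : 0 < x -> x <= y -> y < e -> B x <= B y.
  move=> x0 xy ye; apply: derive_ge0_le => //.
    by apply: (@within_is_derive _ _ b) => z ?; apply: dB; lra.
  by move=> z ?; exists (b z); [apply: dB|apply: b0]; lra.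
pose y := e / 2.
have K1 x : 0 < x <= y -> (- C * y `^ (1 - tau) - H y) / L <= B x.
  move=> xy; have x0 : 0 < x by lra.
  have := incH x y x0 ltac:(lra) ltac:(rewrite /y; lra).
  rewrite ler_pdivrMr// {1}/H => Hxy.
  have px : 0 <= q * x `^ (1 - tau).
    apply: mulr_ge0; last exact: powR_ge0.
    by apply: mulr_ge0 => //; apply: divr_ge0; lra.
  have h3 : - (C * x) * x `^ (- tau) <= A x * x `^ (- tau).
    apply: ler_wpM2r; first exact: powR_ge0.
    by have := HA x ltac:(rewrite /y in xy; lra); rewrite ler_norml; lra.
  have h4 : C * x `^ (1 - tau) <= C * y `^ (1 - tau).
    by apply: ler_wpM2l => //; apply: ge0_ler_powR; rewrite ?nnegrE; lra.
  rewrite P2// in h4.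
  by lra.
exists ((- C * y `^ (1 - tau) - H y) / L) => x xe.
have [xy|yx] := leP x y; first by apply: K1; lra.
by apply: le_trans (incB y x _ _ _); [apply: K1; rewrite /y| |exact: ltW|]; rewrite /y; lra.
Qed.

(** Here [s] is the distance to alpha, [u] the size of the flux, [B] the time up to sign, and
    [sigma] the sign of [g] on that side. The function [sigma * (u - K)] is O(s), because [u] grows
    at most linearly, and its derivative is [sigma * g] times that of [B]. *)
Lemma crossing_limit (R : realType) (u k d g B K : R -> R) (e M C N L tau sigma : R) :
  0 < e -> 0 < L -> 0 < tau < 1 -> 0 <= M -> 0 <= C -> 0 <= N -> `|sigma| = 1 ->
  continuous u -> u 0 = 0 ->
  (forall s, 0 < s < e -> 0 < u s) ->
  (forall s, 0 < s < e -> is_derive s 1 u (k s + d s * g s / u s)) ->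
  (forall s, 0 < s < e -> is_derive s 1 K (k s)) ->
  (forall s, 0 < s < e -> is_derive s 1 B (d s / u s)) ->
  (forall s, 0 < s < e -> `|k s| <= M) ->
  (forall s, 0 < s < e -> `|K s| <= M * s) ->
  (forall s, 0 < s < e -> 0 <= d s <= C * s) ->
  (forall s, 0 < s < e -> `|g s| <= N) ->
  (forall s, 0 < s < e -> L * s `^ tau <= sigma * g s) ->
  exists l, forall eps, 0 < eps ->
    exists2 r, 0 < r & forall x, 0 < x < r -> `|B x - l| < eps.
Proof.
move=> e0 L0 t01 M0 C0 N0 s1 cu u0 up du dK dB kM KM dC gN gL.
have du0 s : 0 < s < e -> 0 <= d s / u s.
  by move=> se; apply: divr_ge0; [have /andP[] := dC s se|apply/ltW/up].
have ub s : 0 < s < e -> u s <= (M + C * N + 1) * s.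
  move=> se.
  apply: (@linear_upper_bound R u (fun s => k s + d s * g s / u s) e M (C * N)) => //.
  - exact: mulr_ge0.
  - move=> x xe ux; apply: lerD; first by have := kM x xe; rewrite ler_norml; lra.
    apply: ler_wpM2r; first by rewrite invr_ge0 ltW.
    have /andP[d0 d1] := dC x xe.
    apply: le_trans (ler_norm _) _; rewrite normrM ger0_norm// mulrAC.
    by apply: ler_pM => //; exact: gN.
  - by lra.
have [K0 HK0] : exists K0, forall x, 0 < x < e -> K0 <= B x.
  apply: (@crossing_bound R (fun s => sigma * (u s - K s)) B (fun s => d s / u s)
    (fun s => sigma * g s) e (M + C * N + 1 + M) L tau) => //.
  - by have : 0 <= C * N by [exact: mulr_ge0]; lra.
  - move=> x xe; have dux := du x xe; have dKx := dK x xe.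
    have -> : sigma * g x * (d x / u x) = sigma * (k x + d x * g x / u x - k x) by ring.
    by apply: (@is_derive_mulc _ (fun s => u s - K s)); exact: is_deriveB.
  - move=> x xe; rewrite normrM s1 mul1r.
    have := ub x xe; have := KM x xe; have := up x xe; rewrite !ler_norml => h1 h2 h3.
    have : 0 <= C * N * x by apply: mulr_ge0; [exact: mulr_ge0|lra].
    have : 0 <= M * x by apply: mulr_ge0; lra.
    lra.
apply: right_limit_of_nondecreasing e0 _ HK0.
move=> x y x0 xy ye; apply: derive_ge0_le => //.
  by apply: (@within_is_derive _ _ (fun s => d s / u s)) => z ?; apply: dB; lra.
by move=> z ?; exists (d z / u z); [apply: dB|apply: du0]; lra.
Qed.

Lemma is_derive_add_arg (R : realType) (f : R -> R) (a s l : R) :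
  is_derive (a + s) 1 f l -> is_derive s 1 (fun x => f (a + x)) l.
Proof.
move=> H; have Ha : is_derive s 1 (fun x : R => a + x) 1.
  by apply: is_derive_eq; ring.
by have := @is_derive1_comp _ f (fun x => a + x) s _ _ H Ha; rewrite mulr1.
Qed.

Lemma is_derive_sub_arg (R : realType) (f : R -> R) (a s l : R) :
  is_derive (a - s) 1 f l -> is_derive s 1 (fun x => f (a - x)) (- l).
Proof.
move=> H; have Ha : is_derive s 1 (fun x : R => a - x) (- 1).
  by apply: is_derive_eq; ring.
by have := @is_derive1_comp _ f (fun x => a - x) s _ _ H Ha; rewrite mulrN1.
Qed.

Lemma continuous_locally_bounded (R : realType) (f : R -> R) (a : R) :
  {for a, continuous f} ->
  exists2 r, 0 < r & forall x, `|x - a| < r -> `|f x| <= `|f a| + 1.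
Proof.
move=> cf; have [r r0 Hr] := continuous_near_ball cf ltr01.
exists r => // x /Hr xr; rewrite -[f x](subrK (f a)).
by apply: le_trans (ler_normD _ _) _; lra.
Qed.

Lemma is_derive_lipschitz (R : realType) (f : R -> R) (a l : R) :
  is_derive a 1 f l ->
  exists2 r, 0 < r & forall x, `|x - a| < r -> `|f x - f a| <= (`|l| + 1) * `|x - a|.
Proof.
move=> /is_derive_dist/(_ 1 ltr01)[r r0 Hr]; exists r => // x /Hr H.
rewrite -[f x - f a](subrK (l * (x - a))); apply: le_trans (ler_normD _ _) _.
by rewrite normrM; lra.
Qed.

Lemma crossing_local_bounds (R : realType) (alpha c : R) (f D g h : R -> R) (Da Df : R) :
  is_derive alpha 1 f Df -> {for alpha, continuous h} ->
  is_derive alpha 1 D Da -> D alpha = 0 -> {for alpha, continuous g} ->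
  exists r M C N, [/\ 0 < r, 0 <= M, 0 <= C & 0 <= N] /\
    forall x, `|x - alpha| < r ->
      [/\ `|h x - c| <= M, `|f x - f alpha| + `|c| * `|x - alpha| <= M * `|x - alpha|,
          `|D x| <= C * `|x - alpha| & `|g x| <= N].
Proof.
move=> df ch dD Da0 cg.
have [r1 r10 Hh] := continuous_locally_bounded ch.
have [r2 r20 Hg] := continuous_locally_bounded cg.
have [r3 r30 HD] := is_derive_lipschitz dD.
have [r4 r40 Hf] := is_derive_lipschitz df.
have nh := normr_ge0 (h alpha); have nf := normr_ge0 Df.
have nD := normr_ge0 Da; have nc := normr_ge0 c; have ng := normr_ge0 (g alpha).
exists (Num.min (Num.min r1 r2) (Num.min r3 r4)), (`|h alpha| + `|Df| + 1 + `|c|),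
  (`|Da| + 1), (`|g alpha| + 1).
split; first by rewrite !lt_min r10 r20 r30 r40; split => //; lra.
move=> x; rewrite !lt_min => /andP[/andP[/Hh x1 /Hg x2] /andP[/HD x3 /Hf x4]]; split => //.
- by apply: le_trans (ler_normB _ _) _; lra.
- rewrite mulrDl lerD2r; apply: le_trans x4 _.
  by apply: ler_wpM2r => //; lra.
- by move: x3; rewrite Da0 subr0.
Qed.

(** Right of alpha [D < 0 < z], so [crossing_limit] is applied with [u = z], [d = - D] and
    [B = - T]. *)
Lemma crossing_time_right (R : realType) (alpha c L tau sr r M C N : R) (f D g h z T : R -> R) :
  0 < L -> 0 < tau < 1 -> `|sr| = 1 -> 0 < r -> 0 <= M -> 0 <= C -> 0 <= N ->
  (forall x, `|x - alpha| < r ->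
    [/\ `|h x - c| <= M, `|f x - f alpha| + `|c| * `|x - alpha| <= M * `|x - alpha|,
        `|D x| <= C * `|x - alpha| & `|g x| <= N]) ->
  (forall s, 0 < s < r -> L * s `^ tau <= sr * g (alpha + s)) ->
  continuous z -> z alpha = 0 ->
  (forall s, 0 < s < r -> 0 < z (alpha + s)) ->
  (forall s, 0 < s < r -> D (alpha + s) < 0) ->
  (forall s : R, 0 < s < r -> is_derive (alpha + s) 1 f (h (alpha + s))) ->
  (forall s : R, 0 < s < r -> is_derive (alpha + s) 1 z
    (h (alpha + s) - c - D (alpha + s) * g (alpha + s) / z (alpha + s))) ->
  (forall s : R, 0 < s < r -> is_derive (alpha + s) 1 T (D (alpha + s) / z (alpha + s))) ->
  exists l, forall eps, 0 < eps ->
    exists2 q, 0 < q & forall s, 0 < s < q -> `|- T (alpha + s) - l| < eps.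
Proof.
move=> L0 t01 sr1 r0 M0 C0 N0 H gr cz za zp Dn df dz dT.
have np (s : R) : 0 < s -> `|alpha + s - alpha| = s.
  by move=> s0; rewrite addrAC subrr add0r gtr0_norm.
have {}H (s : R) : 0 < s < r ->
    [/\ `|h (alpha + s) - c| <= M, `|f (alpha + s) - f alpha| + `|c| * s <= M * s,
        `|D (alpha + s)| <= C * s & `|g (alpha + s)| <= N].
  by move=> /andP[s0 sr']; have := H (alpha + s); rewrite np//; apply.
apply: (@crossing_limit R (fun s => z (alpha + s)) (fun s => h (alpha + s) - c)
  (fun s => - D (alpha + s)) (fun s => g (alpha + s)) (fun s => - T (alpha + s))
  (fun s => f (alpha + s) - f alpha - c * s) r M C N L tau sr
  r0 L0 t01 M0 C0 N0 sr1 _ _ zp _ _ _ _ _ _ _ gr).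
- move=> x; apply: continuous_comp; last exact: cz.
  by apply: cvgD; [exact: cvg_cst|exact: cvg_id].
- by rewrite addr0.
- move=> s /dz ds; apply: is_derive_add_arg.
  by rewrite mulNr mulNr.
- move=> s /df ds; have dfs := is_derive_add_arg ds.
  have dc := @is_derive_mulc R id c s 1 (is_derive_id _ _).
  have -> : h (alpha + s) - c = h (alpha + s) - 0 - c * 1 by ring.
  by apply: is_deriveB.
- move=> s /dT ds; rewrite mulNr; apply: is_deriveN.
  exact: is_derive_add_arg.
- by move=> s /H[].
- move=> s sr'; have [_ + _ _] := H s sr'; apply: le_trans.
  apply: le_trans (ler_normB _ _) _; rewrite normrM lerD2l (@gtr0_norm _ s)//.
  by case/andP: sr'.
- move=> s sr'; have [_ _ + _] := H s sr'; rewrite ltr0_norm ?Dn// => ->.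
  by rewrite oppr_ge0 ltW ?Dn.
- by move=> s /H[].
Qed.

(** Left of alpha [u = - z] is read backwards; the two sign changes cancel in the derivative, so [k]
    is still [h - c] and [d = D], [B = T]. *)
Lemma crossing_time_left (R : realType) (alpha c L tau sl r M C N : R) (f D g h z T : R -> R) :
  0 < L -> 0 < tau < 1 -> `|sl| = 1 -> 0 < r -> 0 <= M -> 0 <= C -> 0 <= N ->
  (forall x, `|x - alpha| < r ->
    [/\ `|h x - c| <= M, `|f x - f alpha| + `|c| * `|x - alpha| <= M * `|x - alpha|,
        `|D x| <= C * `|x - alpha| & `|g x| <= N]) ->
  (forall s, 0 < s < r -> L * s `^ tau <= sl * g (alpha - s)) ->
  continuous z -> z alpha = 0 ->
  (forall s, 0 < s < r -> z (alpha - s) < 0) ->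
  (forall s, 0 < s < r -> 0 < D (alpha - s)) ->
  (forall s : R, 0 < s < r -> is_derive (alpha - s) 1 f (h (alpha - s))) ->
  (forall s : R, 0 < s < r -> is_derive (alpha - s) 1 z
    (h (alpha - s) - c - D (alpha - s) * g (alpha - s) / z (alpha - s))) ->
  (forall s : R, 0 < s < r -> is_derive (alpha - s) 1 T (D (alpha - s) / z (alpha - s))) ->
  exists l, forall eps, 0 < eps ->
    exists2 q, 0 < q & forall s, 0 < s < q -> `|T (alpha - s) - l| < eps.
Proof.
move=> L0 t01 sl1 r0 M0 C0 N0 H gl cz za zn Dp df dz dT.
have nm (s : R) : 0 < s -> `|alpha - s - alpha| = s.
  by move=> s0; rewrite addrAC subrr add0r normrN gtr0_norm.
have {}H (s : R) : 0 < s < r ->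
    [/\ `|h (alpha - s) - c| <= M, `|f (alpha - s) - f alpha| + `|c| * s <= M * s,
        `|D (alpha - s)| <= C * s & `|g (alpha - s)| <= N].
  by move=> /andP[s0 sl']; have := H (alpha - s); rewrite nm//; apply.
have zp s : 0 < s < r -> 0 < - z (alpha - s) by move=> /zn; rewrite oppr_gt0.
apply: (@crossing_limit R (fun s => - z (alpha - s)) (fun s => h (alpha - s) - c)
  (fun s => D (alpha - s)) (fun s => g (alpha - s)) (fun s => T (alpha - s))
  (fun s => - (f (alpha - s) - f alpha) - c * s) r M C N L tau sl
  r0 L0 t01 M0 C0 N0 sl1 _ _ zp _ _ _ _ _ _ _ gl).
- move=> x; apply: cvgN; apply: (@continuous_comp _ _ _ (fun x => alpha - x) z); last exact: cz.
  by apply: cvgB; [exact: cvg_cst|exact: cvg_id].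
- by rewrite subr0 za oppr0.
- move=> s /dz ds.
  have -> : h (alpha - s) - c + D (alpha - s) * g (alpha - s) / - z (alpha - s) =
    - - (h (alpha - s) - c - D (alpha - s) * g (alpha - s) / z (alpha - s)).
    by rewrite invrN; ring.
  by apply: is_deriveN; exact: is_derive_sub_arg.
- move=> s /df ds; have dfs := is_derive_sub_arg ds.
  have dc := @is_derive_mulc R id c s 1 (is_derive_id _ _).
  have -> : h (alpha - s) - c = - (- h (alpha - s) - 0) - c * 1 by ring.
  by apply: is_deriveB.
- move=> s /dT ds.
  have -> : D (alpha - s) / - z (alpha - s) = - (D (alpha - s) / z (alpha - s)).
    by rewrite invrN; ring.
  exact: is_derive_sub_arg.
- by move=> s /H[].
- move=> s sl'; have [_ + _ _] := H s sl'; apply: le_trans.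
  apply: le_trans (ler_normB _ _) _; rewrite normrN normrM lerD2l (@gtr0_norm _ s)//.
  by case/andP: sl'.
- move=> s sl'; have [_ _ + _] := H s sl'; rewrite gtr0_norm ?Dp// => ->.
  by rewrite ltW ?Dp.
- by move=> s /H[].
Qed.

Lemma continuous_two_sided (R : realType) (T u v : R -> R) (alpha : R) :
  (forall eps, 0 < eps -> exists2 q, 0 < q & forall s, 0 < s < q -> `|u (alpha - s)| < eps) ->
  (forall eps, 0 < eps -> exists2 q, 0 < q & forall s, 0 < s < q -> `|v (alpha + s)| < eps) ->
  (forall x, x < alpha -> T x = u x) -> (forall x, alpha < x -> T x = v x) ->
  T alpha = 0 -> {for alpha, continuous T}.
Proof.
move=> Hu Hv Tu Tv Ta; apply: ball_continuous => eps eps0; rewrite Ta.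
have [q1 q10 Hq1] := Hu eps eps0; have [q2 q20 Hq2] := Hv eps eps0.
exists (Num.min q1 q2); first by rewrite lt_min q10.
move=> y; rewrite lt_min => /andP[y1 y2]; rewrite subr0.
have [ya|ay|->] := ltgtP y alpha; last by rewrite Ta normr0.
- have := Hq1 (alpha - y); rewrite subKr Tu//; apply.
  by rewrite subr_gt0 ya /=; apply: le_lt_trans y1; rewrite distrC; exact: ler_norm.
- have := Hq2 (y - alpha); rewrite [alpha + _]addrC subrK Tv//; apply.
  by rewrite subr_gt0 ay /=; apply: le_lt_trans y2; exact: ler_norm.
Qed.

(** [sl] and [sr] are kept apart because [g] changes sign at alpha when alpha is gamma, and keeps
    its sign there otherwise. *)
Lemma crossing_time (R : realType) (alpha c L tau e sl sr Da : R) (f D g h z : R -> R) :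
  0 < alpha < 1 ->
  (forall x : R, 0 < x < 1 -> is_derive x 1 f (h x)) -> {for alpha, continuous h} ->
  (forall x : R, 0 < x < 1 -> {for x, continuous D}) -> D alpha = 0 ->
  is_derive alpha 1 D Da ->
  (forall x, 0 < x < alpha -> 0 < D x) -> (forall x, alpha < x < 1 -> D x < 0) ->
  {for alpha, continuous g} ->
  0 < L -> 0 < tau < 1 -> 0 < e -> `|sl| = 1 -> `|sr| = 1 ->
  (forall s, 0 < s < e -> L * s `^ tau <= sl * g (alpha - s)) ->
  (forall s, 0 < s < e -> L * s `^ tau <= sr * g (alpha + s)) ->
  continuous z -> z alpha = 0 ->
  (forall x, 0 < x < alpha -> z x < 0) -> (forall x, alpha < x < 1 -> 0 < z x) ->
  (forall x : R, 0 < x < 1 -> x != alpha -> is_derive x 1 z (h x - c - D x * g x / z x)) ->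
  exists T : R -> R, (forall x : R, 0 < x < 1 -> {for x, continuous T}) /\
    (forall x : R, 0 < x < 1 -> x != alpha -> is_derive x 1 T (D x / z x)).
Proof.
move=> /andP[a0 a1] df ch cD Da0 dD Dp Dn cg L0 t01 e0 sl1 sr1 gl gr cz za zn zp dz.
have left01 x : 0 < x < alpha -> 0 < x < 1 /\ x != alpha.
  by move=> /andP[x0 xa]; rewrite x0 (lt_trans xa a1) lt_eqF.
have right01 x : alpha < x < 1 -> 0 < x < 1 /\ x != alpha.
  by move=> /andP[ax x1]; rewrite (lt_trans a0 ax) x1 gt_eqF.
have cDz (x : R) : 0 < x < 1 -> z x != 0 -> {for x, continuous (fun x => D x / z x)}.
  by move=> x01 zx; apply: cvgM; [exact: cD|apply: cvgV; [exact: zx|exact: cz]].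
have [Tl dTl] : exists T : R -> R, forall x, 0 < x < alpha -> is_derive x 1 T (D x / z x).
  apply: primitive_oo => x xa; apply: cDz; first by have [] := left01 x xa.
  by rewrite lt_eqF// zn.
have [Tr dTr] : exists T : R -> R, forall x, alpha < x < 1 -> is_derive x 1 T (D x / z x).
  apply: primitive_oo => x xa; apply: cDz; first by have [] := right01 x xa.
  by rewrite gt_eqF// zp.
have a01 : 0 < alpha < 1 by rewrite a0.
have [r' [M [C [N [[r'0 M0 C0 N0] Hb]]]]] := crossing_local_bounds c (df alpha a01) ch dD Da0 cg.
pose r := Num.min (Num.min r' e) (Num.min alpha (1 - alpha)).
have r0 : 0 < r by rewrite !lt_min r'0 e0 a0 subr_gt0.
have re s : 0 < s < r -> 0 < s < e.
  by rewrite !lt_min => /andP[-> /andP[/andP[_ ->]]].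
have rl s : 0 < s < r -> 0 < alpha - s < alpha.
  by rewrite !lt_min subr_gt0 gtrBl => /andP[-> /andP[_ /andP[-> _]]].
have rr s : 0 < s < r -> alpha < alpha + s < 1.
  by rewrite !lt_min ltrDl -ltrBrDl => /andP[-> /andP[_ /andP[_ ->]]].
have rr' : r <= r' by rewrite !ge_min lexx.
have {}Hb x (xr : `|x - alpha| < r) := Hb x (lt_le_trans xr rr').
have [lr Hlr] := crossing_time_right L0 t01 sr1 r0 M0 C0 N0 Hb
  (fun s sr' => gr s (re s sr')) cz za (fun s sr' => zp _ (rr s sr')) (fun s sr' => Dn _ (rr s sr'))
  (fun s sr' => df _ (right01 _ (rr s sr')).1)
  (fun s sr' => dz _ (right01 _ (rr s sr')).1 (right01 _ (rr s sr')).2)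
  (fun s sr' => dTr _ (rr s sr')).
have [ll Hll] := crossing_time_left L0 t01 sl1 r0 M0 C0 N0 Hb
  (fun s sr' => gl s (re s sr')) cz za (fun s sr' => zn _ (rl s sr')) (fun s sr' => Dp _ (rl s sr'))
  (fun s sr' => df _ (left01 _ (rl s sr')).1)
  (fun s sr' => dz _ (left01 _ (rl s sr')).1 (left01 _ (rl s sr')).2)
  (fun s sr' => dTl _ (rl s sr')).
(* [lr] is the limit of [- Tr], hence the plus sign: both branches tend to 0 at alpha. *)
pose T x := if x < alpha then Tl x - ll else if alpha < x then Tr x + lr else 0.
have TlE x : x < alpha -> T x = Tl x - ll by rewrite /T => ->.
have TrE x : alpha < x -> T x = Tr x + lr by move=> ax; rewrite /T ax ltNge ltW.
have dT (x : R) : 0 < x < 1 -> x != alpha -> is_derive x 1 T (D x / z x).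
  move=> /andP[x0 x1]; rewrite neq_lt => /orP[xa|xa].
    have x0a : 0 < x < alpha by rewrite x0.
    apply: (@is_derive_near _ (fun x => Tl x - ll) _ _ _ 0 alpha x0a).
      by move=> y /andP[_ ya]; rewrite TlE.
    by rewrite -[D x / z x]subr0; apply: is_deriveB; exact: dTl.
  have xa1 : alpha < x < 1 by rewrite xa.
  apply: (@is_derive_near _ (fun x => Tr x + lr) _ _ _ alpha 1 xa1).
    by move=> y /andP[ya _]; rewrite TrE.
  by rewrite -[D x / z x]addr0; apply: is_deriveD; exact: dTr.
exists T; split => // x x01.
have [->|xa] := eqVneq x alpha; last exact: continuous_is_derive (dT x x01 xa).
apply: (@continuous_two_sided R T (fun x => Tl x - ll) (fun x => Tr x + lr)) => //.
- move=> eps /Hlr[q q0 Hq]; exists q => // s /Hq.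
  by rewrite -normrN opprB opprK addrC.
- by rewrite /T ltxx.
Qed.

(** * The profile as the inverse of the time map *)

(** Needed because at the finitely many points where the profile may fail to be differentiable,
    [derive1] returns a value about which nothing is known. *)
Lemma measurable_fun_modified (R : realType) (u w : R -> R) (E : seq R) :
  measurable_fun [set: R] w -> (forall x, x \notin E -> u x = w x) ->
  measurable_fun [set: R] u.
Proof.
elim: E w => [|p E IH] w mw uw.
  by have -> : u = w by apply/funext => x; exact: uw.
apply: (IH (fun x => if x == p then u p else w x)).
  apply: measurable_fun_ifT => //.
  by apply: measurable_fun_eqr.
move=> x xE; case: eqVneq => [->//|xp].
by apply: uw; rewrite inE negb_or xp.
Qed.

Lemma negligible_seq (R : realType) (E : seq R) :
  (@lebesgue_measure R).-negligible [set` E].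
Proof.
have cE : countable [set` E] by apply: finite_set_countable; exact: finite_seq.
exists [set` E]; split => //; last exact: countable_lebesgue_measure0.
by apply: countable_measurable => // t; exact: measurable_set1.
Qed.

Lemma integrable_modified (R : realType) (u w : R -> R) (E : seq R) (a b : R) :
  continuous w -> (forall x, x \notin E -> u x = w x) ->
  (@lebesgue_measure R).-integrable `[a, b] (fun x => (u x)%:E).
Proof.
move=> cw uw.
have mw := continuous_measurable_fun cw.
have mu := measurable_fun_modified mw uw.
have iw : (@lebesgue_measure R).-integrable `[a, b] (EFin \o w).
  by apply: continuous_compact_integrable; [exact: segment_compact|exact: continuous_subspaceT].
apply/integrableP; split.
  by apply/measurable_EFinP; apply: measurable_funTS.
have /integrableP[_] := iw; congr (_ < _)%E; apply: ae_eq_integral => //.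
- apply: measurableT_comp => //; apply/measurable_EFinP; exact: measurable_funTS.
- apply: measurableT_comp => //; apply/measurable_EFinP; exact: measurable_funTS.
apply: negligibleS (negligible_seq E) => x /= H.
apply: contrapT => /negP xE; apply: H => _.
by rewrite uw.
Qed.

(** Off [E] the integrand is the derivative of [V * psi], which vanishes at both ends of an interval
    containing the support of [psi]. *)
Lemma weak_identity (R : realType) (V k U psi : R -> R) (E : seq R) :
  (forall x : R, is_derive x 1 V (k x)) -> continuous k ->
  (forall x, x \notin E -> U x = V x) -> test_function psi ->
  (\int[@lebesgue_measure R]_(x in setT)
     (U x * derive1 psi x + k x * psi x)%:E = 0)%E.
Proof.
move=> dV ck UV [dpsi [M psiM]].
have dp (x : R) : is_derive x 1 psi (derive1 psi x).
  by rewrite derive1E; apply/derivableP; exact: (dpsi 0%N x).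
have cp : continuous psi by move=> x; exact: continuous_is_derive (dp x).
have cp1 : continuous (derive1 psi).
  move=> x; have := dpsi 1%N x; rewrite derive1n1 => /derivableP.
  exact: continuous_is_derive.
have cV : continuous V by move=> x; exact: continuous_is_derive (dV x).
(* [M] may be negative; [N] is positive and strictly larger than [M], so [psi] vanishes at [N] and
   at [- N]. *)
pose N : R := `|M| + 1.
have N0 : 0 < N by rewrite /N; have := normr_ge0 M; lra.
have NM : M < N by rewrite /N; have := ler_norm M; lra.
have psi0 x : N <= `|x| -> psi x = 0 by move=> Nx; apply: psiM; lra.
have psi10 x : N < `|x| -> derive1 psi x = 0.
  move=> Nx; have d0 : is_derive x 1 psi 0.
    have [x0|x0] := leP 0 x.
      rewrite ger0_norm// in Nx.
      apply: (@is_derive_near _ (cst 0) _ _ _ N (x + 1)); first lra.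
      by move=> y yN; rewrite psi0// ger0_norm; lra.
    rewrite ltr0_norm// in Nx.
    apply: (@is_derive_near _ (cst 0) _ _ _ (x - 1) (- N)); first lra.
    by move=> y yN; rewrite psi0// ltr0_norm; lra.
  by rewrite derive1E (@derive_val _ _ _ _ _ _ _ d0).
pose G x := V x * derive1 psi x + k x * psi x.
pose W x := V x * psi x.
have dW (x : R) : is_derive x 1 W (G x).
  have := @is_deriveM _ _ V psi x 1 _ _ (dV x) (dp x).
  rewrite /GRing.scale/= => H; apply: is_derive_eq.
  by rewrite /G /GRing.scale/= [psi x * _]mulrC.
have cG : continuous G.
  by move=> x; apply: cvgD; apply: cvgM; [exact: cV|exact: cp1|exact: ck|exact: cp].
have cW : continuous W by move=> x; exact: continuous_is_derive (dW x).
have F2 : (\int[@lebesgue_measure R]_(x in `[(- N)%R, N]) (G x)%:E = (W N)%:E - (W (- N)%R)%:E)%E.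
  apply: continuous_FTC2; first by lra.
  - exact: continuous_subspaceT.
  - split; first by move=> x _; exact: (@ex_derive _ _ _ _ _ _ _ (dW x)).
    + by apply: cvg_at_right_filter; exact: cW.
    + by apply: cvg_at_left_filter; exact: cW.
  - by move=> x _; rewrite derive1E (@derive_val _ _ _ _ _ _ _ (dW x)).
pose H x := U x * derive1 psi x + k x * psi x.
have HG x : x \notin E -> H x = G x by move=> xE; rewrite /H UV.
have mG := continuous_measurable_fun cG.
have mH := measurable_fun_modified mG HG.
have W0 x : `|x| = N -> W x = 0 by move=> xN; rewrite /W psi0 ?mulr0// xN.
rewrite (@W0 N) ?(@W0 (- N)) ?normrN ?gtr0_norm// -EFinB subrr in F2.
rewrite -[RHS]F2 [RHS]integral_mkcond.
have -> : (fun x => (U x * derive1 psi x + k x * psi x)%:E) =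
    (fun x => (H x)%:E) \_ `[- N, N].
  apply/funext => x; rewrite /patch; case: ifPn => //.
  move/negP; rewrite inE/= in_itv/= => xN.
  have Nx : N < `|x|.
    by rewrite ltNge; apply/negP => xN'; apply: xN; move: xN'; rewrite ler_norml.
  by rewrite /H psi10// psi0 ?ltW// !mulr0 addr0.
rewrite -!integral_mkcond; apply: ae_eq_integral => //.
- by apply/measurable_EFinP; exact: measurable_funTS.
- by apply/measurable_EFinP; exact: measurable_funTS.
apply: negligibleS (negligible_seq E) => x /= Hx.
by apply: contrapT => /negP xE; apply: Hx => _; rewrite HG.
Qed.

(** A finite set is discrete: around [x] there is a ball without other exceptional points, and the
    continuous candidate [df] extends across [x]. *)
Lemma is_derive_off_seq (R : realType) (f df : R -> R) (E : seq R) :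
  continuous f -> continuous df ->
  (forall x : R, x \notin E -> is_derive x 1 f (df x)) ->
  forall x : R, is_derive x 1 f (df x).
Proof.
move=> cf cdf H x.
have [r r0 Hr] : exists2 r, 0 < r & forall y, y \in E -> y != x -> r <= `|y - x|.
  elim: E {H} => [|p E [r r0 Hr]]; first by exists 1.
  have [->|px] := eqVneq p x.
    by exists r => // y; rewrite inE => /predU1P[->|/Hr//]; rewrite eqxx.
  exists (Num.min r `|p - x|); first by rewrite lt_min r0 normr_gt0 subr_eq0.
  move=> y; rewrite inE => /predU1P[->|yE] yx; rewrite ge_min ?lexx ?orbT//.
  by rewrite Hr.
apply: (@is_derive_extend R f df (x - r) (x + r)); [lra|exact: cf|exact: cdf|].
move=> y yx yNx; apply: H; apply/negP => /Hr/(_ yNx).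
by apply/negP; rewrite -ltNge ltr_norml; lra.
Qed.

Section Profile.
Variables (R : realType) (T dT : R -> R) (alpha : R).
Hypothesis time_continuous : forall x : R, 0 < x < 1 -> {for x, continuous T}.
Hypothesis time_derive : forall x : R, 0 < x < 1 -> x != alpha -> is_derive x 1 T (dT x).
Hypothesis dT_lt0 : forall x : R, 0 < x < 1 -> x != alpha -> dT x < 0.

(** At alpha only continuity of [T] is known, so the mean value theorem is used on either side and
    the two inequalities are chained through [T alpha]. *)
Lemma time_decreasing x y : 0 < x -> x < y -> y < 1 -> T y < T x.
Proof.
have side a b : 0 < a -> a < b -> b < 1 -> (b <= alpha) || (alpha <= a) -> T b < T a.
  move=> a0 ab b1 H.
  have dT' (s : R) : s \in `]a, b[ -> is_derive s 1 T (dT s).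
    rewrite in_itv/= => sab; apply: time_derive; first lra.
    by case/orP: H => H; [rewrite lt_eqF//|rewrite gt_eqF//]; lra.
  have cT : {within `[a, b], continuous T}.
    apply: continuous_in_subspaceT => s /set_mem/=; rewrite in_itv/= => ?.
    by apply: time_continuous; lra.
  have [s sab Ts] := MVT ab dT' cT.
  rewrite -subr_lt0 Ts nmulr_rlt0; first by rewrite subr_gt0.
  rewrite in_itv/= in sab; apply: dT_lt0; first lra.
  by case/orP: H => H; [rewrite lt_eqF//|rewrite gt_eqF//]; lra.
move=> x0 xy y1; have [ya|ay] := leP y alpha; first by apply: side; rewrite ?ya.
have [ax|xa] := leP alpha x; first by apply: side; rewrite ?ax ?orbT.
by apply: (lt_trans (side alpha y _ _ _ _) (side x alpha _ _ _ _)); rewrite ?lexx ?orbT//; lra.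
Qed.

(* Including 0 makes the profile 0 after a finite arrival time [sup T]; before [inf T] the
   supremum is 1. *)
Definition profile_set (xi : R) : set R := [set x | x = 0 \/ (0 < x < 1 /\ xi <= T x)].
Definition profile (xi : R) : R := sup (profile_set xi).

Lemma profile_set_sup xi : has_sup (profile_set xi).
Proof. by split; [exists 0; left|exists 1 => x [->//|[/andP[_ /ltW]]]]. Qed.

Lemma profile_ge xi x : 0 < x < 1 -> xi <= T x -> x <= profile xi.
Proof. by move=> x01 xT; apply: sup_upper_bound; [exact: profile_set_sup|right]. Qed.

Lemma profile_le xi b : 0 <= b -> (forall x, 0 < x < 1 -> xi <= T x -> x <= b) ->
  profile xi <= b.
Proof.
by move=> b0 H; apply: ge_sup; [exists 0; left|move=> x [->//|[x01 xT]]; exact: H].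
Qed.

Lemma profile01 xi : 0 <= profile xi <= 1.
Proof.
apply/andP; split; first by apply: sup_upper_bound; [exact: profile_set_sup|left].
by apply: profile_le => // x /andP[_ /ltW].
Qed.

Lemma profile_le_of_lt xi x : 0 < x < 1 -> T x < xi -> profile xi <= x.
Proof.
move=> x01 xT; apply: profile_le => [|y y01 yT]; first lra.
rewrite leNgt; apply/negP => xy.
by have := @time_decreasing x y ltac:(lra) xy ltac:(lra); lra.
Qed.

Lemma profileK x : 0 < x < 1 -> profile (T x) = x.
Proof.
move=> x01; apply/eqP; rewrite eq_le profile_ge// andbT.
apply: profile_le => [|y y01 yT]; first lra.
rewrite leNgt; apply/negP => xy.
by have := @time_decreasing x y ltac:(lra) xy ltac:(lra); lra.
Qed.

Lemma profile_nonincreasing : {homo profile : x y / x <= y >-> y <= x}.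
Proof.
move=> xi eta xe; apply: profile_le; first by have /andP[] := profile01 xi.
by move=> x x01 xT; apply: profile_ge => //; exact: le_trans xT.
Qed.

Lemma time_profile xi : 0 < profile xi < 1 -> T (profile xi) = xi.
Proof.
move=> p01; set x := profile xi in p01 *.
have cT := time_continuous p01.
have [Tx|Tx|//] := ltgtP (T x) xi.
- have [|r r0 Hr] := continuous_near_ball cT (_ : 0 < xi - T x); first lra.
  pose y := Num.max (x / 2) (x - r / 2).
  have yx : x / 2 <= y /\ x - r / 2 <= y /\ y < x.
    by rewrite /y !le_max !lexx orbT gt_max; do !split => //; lra.
  have := Hr y; rewrite !ltr_norml => /(_ ltac:(lra)) h.
  have : x <= y by apply: profile_le_of_lt; lra.
  by lra.
- have [|r r0 Hr] := continuous_near_ball cT (_ : 0 < T x - xi); first lra.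
  pose y := Num.min ((x + 1) / 2) (x + r / 2).
  have yx : y <= (x + 1) / 2 /\ y <= x + r / 2 /\ x < y.
    by rewrite /y !ge_min !lexx orbT lt_min; do !split => //; lra.
  have := Hr y; rewrite !ltr_norml => /(_ ltac:(lra)) h.
  have : y <= x by apply: profile_ge; lra.
  by lra.
Qed.

(** A jump of the profile would be an interval of densities on which [T] is constant, which strict
    decrease forbids. *)
Lemma profile_continuous : continuous profile.
Proof.
move=> xi; have /andP[p0 p1] := profile01 xi; set x := profile xi in p0 p1.
apply: ball_continuous => e e0; rewrite -/x.
have [r1 r10 H1] : exists2 r, 0 < r & forall eta, `|eta - xi| < r -> profile eta < x + e.
  have [x1|x1] := ltP x 1; last first.
    by exists 1 => // eta _; have := profile01 eta; lra.
  pose y := Num.min ((x + 1) / 2) (x + e / 2).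
  have yx : y <= (x + 1) / 2 /\ y <= x + e / 2 /\ x < y.
    by rewrite /y !ge_min !lexx orbT lt_min; do !split => //; lra.
  have Ty : T y < xi.
    rewrite ltNge; apply/negP => h.
    have : y <= x by apply: profile_ge; lra.
    by lra.
  exists (xi - T y); first lra.
  move=> eta; rewrite ltr_norml => h.
  have : profile eta <= y by apply: profile_le_of_lt; lra.
  by lra.
have [r2 r20 H2] : exists2 r, 0 < r & forall eta, `|eta - xi| < r -> x - e < profile eta.
  have [x0|x0] := ltP 0 x; last first.
    by exists 1 => // eta _; have := profile01 eta; lra.
  pose y := Num.max (x / 2) (x - e / 2).
  have yx : x / 2 <= y /\ x - e / 2 <= y /\ y < x.
    by rewrite /y !le_max !lexx orbT gt_max; do !split => //; lra.
  (* The supremum only yields the weak inequality at [y']; passing to the smaller [y] makes it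
     strict. *)
  pose y' := (y + x) / 2.
  have Ty' : xi <= T y'.
    rewrite leNgt; apply/negP => h.
    have : x <= y' by apply: profile_le_of_lt; rewrite /y'; lra.
    by rewrite /y'; lra.
  have Tyy : T y' < T y by apply: time_decreasing; rewrite /y'; lra.
  exists (T y - xi); first lra.
  move=> eta; rewrite ltr_norml => h.
  have : y <= profile eta by apply: profile_ge; lra.
  by lra.
exists (Num.min r1 r2); first by rewrite lt_min r10.
move=> eta; rewrite lt_min => /andP[/H1 ? /H2 ?].
by rewrite ltr_norml; lra.
Qed.

Lemma profile_cvgy : profile x @[x --> +oo] --> (0 : R).
Proof.
apply/cvgrPdist_lt => e e0; near=> xi; rewrite sub0r normrN ger0_norm; last first.
  by have /andP[] := profile01 xi.
pose y := Num.min (1 / 2) (e / 2).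
have ye : y <= 1 / 2 /\ y <= e / 2 /\ 0 < y.
  by rewrite /y !ge_min !lexx orbT lt_min; do !split => //; lra.
have : profile xi <= y.
  apply: profile_le_of_lt; first lra.
  by near: xi; apply: nbhs_pinfty_gt; exact: num_real.
by lra.
Unshelve. all: by end_near. Qed.

Lemma profile_cvgNy : profile x @[x --> -oo] --> (1 : R).
Proof.
apply/cvgrPdist_lt => e e0; near=> xi; rewrite ger0_norm; last first.
  by have /andP[_] := profile01 xi; lra.
pose y := Num.max (1 / 2) (1 - e / 2).
have ye : 1 / 2 <= y /\ 1 - e / 2 <= y /\ y < 1.
  by rewrite /y !le_max !lexx orbT gt_max; do !split => //; lra.
have : y <= profile xi.
  apply: profile_ge; first lra.
  by apply/ltW; near: xi; apply: nbhs_ninfty_lt; exact: num_real.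
by lra.
Unshelve. all: by end_near. Qed.

Lemma profile_derive xi : 0 < profile xi < 1 -> profile xi != alpha ->
  is_derive xi 1 profile (dT (profile xi))^-1.
Proof.
move=> p01 pa; rewrite -{1}(time_profile p01); apply: is_derive_inverse.
- have : profile xi \in `]0, 1[ by rewrite in_itv.
  move=> /near_in_itvoo; apply: filterS => y; rewrite in_itv/= => y01.
  exact: profileK.
- have : profile xi \in `]0, 1[ by rewrite in_itv.
  move=> /near_in_itvoo; apply: filterS => y; rewrite in_itv/= => y01.
  exact: time_continuous.
- exact: time_derive.
- by apply: ltr0_neq0; exact: dT_lt0.
Qed.

(* If the profile never reaches 0 (or 1) the corresponding [inf] (or [sup]) is a junk value,
   and one harmless exceptional point is added. *)
Definition profile_exceptions : seq R :=
  [:: T alpha; inf [set xi | profile xi = 0]; sup [set xi | profile xi = 1]].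

(** By monotonicity the values 0 and 1 are taken on half-lines. Their end points are exceptional, so
    any other point of a half-line is interior to it and the profile is locally constant there. *)
Lemma profile_cases xi : xi \notin profile_exceptions ->
  (0 < profile xi < 1 /\ profile xi != alpha) \/
  exists a b v, a < xi < b /\ (v = 0 \/ v = 1) /\ forall y, a < y < b -> profile y = v.
Proof.
rewrite /profile_exceptions !inE !negb_or => /and3P[xa x0 x1].
have half : 0 < (1 / 2 : R) < 1 by lra.
have [p0|p0] := eqVneq (profile xi) 0.
  right; pose S := [set xi | profile xi = 0].
  have hS : has_inf S.
    split; first by exists xi.
    exists (T (1 / 2)) => y Sy; rewrite leNgt; apply/negP => yT.
    by have := profile_nonincreasing (ltW yT); rewrite profileK// Sy; lra.
  have ix : inf S < xi.
    by rewrite lt_neqAle eq_sym x0/=; apply: ge_inf; [exact: hS.2|].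
  have [y Sy yx] := inf_lt hS.1 ix.
  exists y, (xi + 1), 0; split; first lra.
  split; first by left.
  move=> s ys; apply/eqP; rewrite eq_le; have /andP[-> _] := profile01 s; rewrite andbT.
  by rewrite -Sy; apply: profile_nonincreasing; lra.
have [p1|p1] := eqVneq (profile xi) 1.
  right; pose S := [set xi | profile xi = 1].
  have hS : has_sup S.
    split; first by exists xi.
    exists (T (1 / 2)) => y Sy; rewrite leNgt; apply/negP => yT.
    by have := profile_nonincreasing (ltW yT); rewrite profileK// Sy; lra.
  have ix : xi < sup S.
    by rewrite lt_neqAle x1/=; apply: sup_upper_bound.
  have [y Sy yx] := sup_gt hS.1 ix.
  exists (xi - 1), y, 1; split; first lra.
  split; first by right.
  move=> s ys; apply/eqP; rewrite eq_le; have /andP[_ ->] := profile01 s; rewrite /=.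
  by rewrite -Sy; apply: profile_nonincreasing; lra.
left; have p01 : 0 < profile xi < 1.
  by have /andP[? ?] := profile01 xi; rewrite !lt_neqAle p1 eq_sym p0; apply/andP.
split => //; apply: contraNneq xa => pa.
by rewrite -pa time_profile.
Qed.

End Profile.

(** The weak equation needs [V' = - g phi] everywhere, although [phi] may fail to be differentiable
    at some points: [V] and [- g phi] are continuous, so it is enough to check it off the
    exceptions. *)
Lemma wavefront_of_time (R : realType) (alpha c : R) (f D g h z T : R -> R) :
  {within `[0, 1], continuous f} -> {within `[0, 1], continuous g} ->
  g 0 = 0 -> g 1 = 0 ->
  (forall x : R, 0 < x < 1 -> is_derive x 1 f (h x)) ->
  continuous z -> z 0 = 0 -> z 1 = 0 ->
  (forall x : R, 0 < x < 1 -> x != alpha -> D x / z x < 0) ->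
  (forall x : R, 0 < x < 1 -> x != alpha -> is_derive x 1 z (h x - c - D x * g x / z x)) ->
  (forall x : R, 0 < x < 1 -> {for x, continuous T}) ->
  (forall x : R, 0 < x < 1 -> x != alpha -> is_derive x 1 T (D x / z x)) ->
  exists phi, wavefront f D g c phi.
Proof.
move=> cf cg g0 g1 df cz z0 z1 Dz dz cT dT.
pose phi := profile T.
have p01 x : 0 <= phi x <= 1 by exact: profile01.
have cp : continuous phi by exact: (profile_continuous cT dT Dz).
pose E := profile_exceptions T alpha.
have clampp x : clamp 0 1 (phi x) = phi x by rewrite clampE.
have cfp : continuous (fun x => f (phi x)).
  have -> : (fun x => f (phi x)) = (fun x => f (clamp 0 1 x)) \o phi.
    by apply/funext => x /=; rewrite clampp.
  by move=> x; apply: continuous_comp; [exact: cp|apply: continuous_clamp].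
have cgp : continuous (fun x => - g (phi x)).
  have -> : (fun x => - g (phi x)) = (fun x => - g (clamp 0 1 x)) \o phi.
    by apply/funext => x /=; rewrite clampp.
  move=> x; apply: continuous_comp; first exact: cp.
  by apply: cvgN; apply: continuous_clamp.
pose V x := z (phi x) - f (phi x) + c * phi x.
have cV : continuous V.
  move=> x; apply: cvgD.
    by apply: cvgB; [apply: continuous_comp; [exact: cp|exact: cz]|exact: cfp].
  by apply: cvgM; [exact: cvg_cst|exact: cp].
(* On the sloping part this is the chain rule with [phi' = z / D]. On the constant ends both sides
   vanish, since [z] and [g] are 0 at 0 and at 1. *)
have key (x : R) : x \notin E ->
    (exists2 l, is_derive x 1 phi l & D (phi x) * l = z (phi x)) /\ is_derive x 1 V (- g (phi x)).
  move=> /(profile_cases cT dT Dz)[[px pa]|[a [b [v [axb [v01 pv]]]]]].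
    have dphi : is_derive x 1 phi (D (phi x) / z (phi x))^-1.
      exact: (profile_derive cT dT Dz).
    have DzN := Dz _ px pa.
    have D0 : D (phi x) != 0.
      by apply: contraTneq DzN => ->; rewrite mul0r ltxx.
    have zn0 : z (phi x) != 0.
      by apply: contraTneq DzN => ->; rewrite invr0 mulr0 ltxx.
    split; first by exists (D (phi x) / z (phi x))^-1 => //; field; rewrite ?D0 ?zn0.
    have d1 := @is_derive1_comp _ z phi x _ _ (dz _ px pa) dphi.
    have d2 := @is_derive1_comp _ f phi x _ _ (df _ px) dphi.
    have d3 := @is_derive_mulc R phi c x _ dphi.
    have -> : - g (phi x) = (h (phi x) - c - D (phi x) * g (phi x) / z (phi x)) *
      (D (phi x) / z (phi x))^-1 - h (phi x) * (D (phi x) / z (phi x))^-1 +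
      c * (D (phi x) / z (phi x))^-1.
      by field; rewrite ?D0 ?zn0.
    by apply: is_deriveD; exact: is_deriveB.
  have pxv : phi x = v by exact: pv.
  have gv : g v = 0 by case: v01 => ->.
  have zv : z v = 0 by case: v01 => ->.
  split.
    exists 0; last by rewrite mulr0 pxv zv.
    by apply: (@is_derive_near _ (cst v) _ _ _ a b) => // y yab; rewrite -(pv _ yab).
  rewrite pxv gv oppr0.
  apply: (@is_derive_near _ (cst (z v - f v + c * v)) _ _ _ a b) => // y yab.
  by rewrite /V /phi pv.
have dV (x : R) : is_derive x 1 V (- g (phi x)).
  apply: (@is_derive_off_seq R V (fun x => - g (phi x)) E) => // y yE.
  by have [] := key y yE.
have flux x : x \notin E -> D (phi x) * derive1 phi x = z (phi x).
  move=> /key[[l dl Dl] _].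
  by rewrite derive1E (@derive_val _ _ _ _ _ _ _ dl).
exists phi; split; last first.
  split; first exact: profile_nonincreasing.
  split; first exact: profile_cvgNy.
  exact: (profile_cvgy cT dT Dz).
split => //; split => //; split.
  apply: negligibleS (negligible_seq E) => x /= Hx.
  apply: contrapT => /negP xE; apply: Hx.
  by have [[l dl _] _] := key x xE; exact: (@ex_derive _ _ _ _ _ _ _ dl).
split.
  move=> a b; apply: (@integrable_modified R _ (fun x => z (phi x)) E) => //.
  by move=> x; apply: continuous_comp; [exact: cp|exact: cz].
move=> psi Hpsi.
rewrite -(@weak_identity R V (fun x => - g (phi x))
  (fun x => D (phi x) * derive1 phi x - f (phi x) + c * phi x) psi E dV cgp _ Hpsi).
  by apply: eq_integral => x _; rewrite mulNr.
by move=> x xE; rewrite /V flux.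
Qed.

(** * The flux z as a function of the density *)

Lemma bounded_clamp (R : realType) (f : R -> R) : {within `[0, 1], continuous f} ->
  exists2 M, 0 < M & forall x, `|f (clamp 0 1 x)| <= M.
Proof.
move=> cf; have [M M0 HM] := continuous_bounded ler01 (continuous_clamp ler01 cf).
exists M => // x; have := HM (clamp 0 1 x) (clamp_itv x ler01).
by rewrite (clampE (clamp_itv x ler01)).
Qed.

Lemma within_continuous_at (R : realType) (f : R -> R) (a b x : R) : a < x < b ->
  {within `[a, b], continuous f} -> {for x, continuous f}.
Proof.
move=> axb cf; have ab : a <= b by lra.
have cc := continuous_clamp ab cf.
apply: ball_continuous => e e0.
have [r r0 Hr] := continuous_near_ball (cc x) e0.
exists (Num.min r (Num.min (x - a) (b - x))); first by rewrite !lt_min; lra.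
move=> y; rewrite !lt_min !ltr_norml => yr.
have := Hr y; rewrite !clampE; [|lra..].
by rewrite !ltr_norml; apply; lra.
Qed.

(** At an interior point the relative derivative on [[0, 1]] is the ordinary one. Clamping its
    argument gives a derivative function that is continuous and bounded on the whole line. *)
Lemma C1_01_derive (R : realType) (f : R -> R) : C1_01 f ->
  exists h M, [/\ continuous h, (forall x : R, `|h x| <= M) &
    forall x : R, 0 < x < 1 -> is_derive x 1 f (h x)].
Proof.
move=> [cf [f1 [cf1 Hf1]]].
have [M M0 HM] := bounded_clamp cf1.
exists (fun x => f1 (clamp 0 1 x)), M; split => //.
  exact: continuous_clamp.
move=> x x01; rewrite clampE; last lra.
apply/is_derive_dist => e e0.
have x01' : x \in `[0, 1] by rewrite in_itv/=; lra.
have /cvgrPdist_lt/(_ e e0) := Hf1 x x01'.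
rewrite /within/= => /nbhs_ballP[r /= r0 Hr].
exists (Num.min r (Num.min x (1 - x))); first by rewrite !lt_min; lra.
move=> y; rewrite !lt_min => /andP[yr /andP[yx yx1]].
have [->|yNx] := eqVneq y x; first by rewrite !subrr mulr0 normr0 subrr normr0 mulr0.
have yx0 : y - x != 0 by rewrite subr_eq0.
have y01 : y \in `[0, 1].
  by rewrite in_itv/=; move: yx yx1; rewrite !ltr_norml; lra.
have := Hr y; rewrite /ball/= distrC => /(_ yr (conj y01 yNx)) /ltW H.
have -> : f y - f x - f1 x * (y - x) = - ((f1 x - (f y - f x) / (y - x)) * (y - x)).
  by field.
by rewrite normrN normrM ler_wpM2r.
Qed.

Lemma continuous_glue (R : realType) (u v : R -> R) (a : R) :
  continuous u -> continuous v -> u a = v a ->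
  continuous (fun x => if x < a then u x else v x).
Proof.
move=> cu cv uv x; apply: ball_continuous => e e0.
have [r1 r10 H1] := continuous_near_ball (cu x) e0.
have [r2 r20 H2] := continuous_near_ball (cv x) e0.
have [xa|ax|xE] := ltgtP x a.
- exists (Num.min r1 (a - x)); first by rewrite lt_min; lra.
  move=> y; rewrite lt_min => /andP[y1 y2].
  have -> : y < a by move: y2; rewrite ltr_norml; lra.
  exact: H1.
- exists (Num.min r2 (x - a)); first by rewrite lt_min; lra.
  move=> y; rewrite lt_min => /andP[y1 y2].
  have /le_gtF -> : a <= y by move: y2; rewrite ltr_norml; lra.
  exact: H2.
exists (Num.min r1 r2); first by rewrite lt_min r10.
move=> y; rewrite lt_min => /andP[/H1 y1 /H2 y2].
by case: ifP => _ //; rewrite xE -uv -xE.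
Qed.

(** * Chord inequalities for strictly concave functions *)

Lemma three_chord (R : realType) (f : R -> R) (a b e : R) :
  strictly_concave_01 f -> 0 <= a -> a < b -> b < e -> e <= 1 ->
  (f e - f b) * (b - a) < (f b - f a) * (e - b).
Proof.
move=> cf a0 ab be e1; pose t := (e - b) / (e - a).
have ea : 0 < e - a by lra.
have t01 : 0 < t < 1.
  by rewrite /t; apply/andP; split; [apply: divr_gt0; lra|rewrite ltr_pdivrMr//; lra].
have := cf a e t; rewrite !in_itv/= => /(_ ltac:(lra) ltac:(lra)).
have -> : a != e by rewrite lt_eqF//; lra.
move=> /(_ isT t01).
have -> : t * a + (1 - t) * e = b by rewrite /t; field; rewrite gt_eqF.
rewrite -(ltr_pM2r ea).
have -> : (t * f a + (1 - t) * f e) * (e - a) = (e - b) * f a + (b - a) * f e.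
  by rewrite /t; field; rewrite gt_eqF.
by lra.
Qed.

Lemma concave_chord_right (R : realType) (f : R -> R) (a s : R) :
  strictly_concave_01 f -> 0 <= a -> a <= s <= 1 -> a < 1 ->
  f 1 - f s <= (f 1 - f a) / (1 - a) * (1 - s).
Proof.
move=> cf a0 /andP[]; rewrite le_eqVlt => /predU1P[<- _ a1|as_].
  by rewrite divfK// subr_eq0 gt_eqF.
rewrite le_eqVlt => /predU1P[->|s1 a1]; first by rewrite !subrr mulr0.
have := three_chord cf a0 as_ s1 (lexx _).
rewrite mulrAC ler_pdivlMr; last lra.
by lra.
Qed.

(** If a chord ending at [p] were flatter than the tangent, then the difference quotients just right
    of [p], being close to [d], would exceed its slope, against concavity; [p < 1] leaves the room.
    Chords ending earlier are steeper still. *)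
Lemma concave_chord_left (R : realType) (f : R -> R) (d p u v : R) :
  strictly_concave_01 f -> is_derive p 1 f d -> 0 <= u -> u <= v -> v <= p -> p < 1 ->
  d * (v - u) <= f v - f u.
Proof.
move=> cf df u0 uv vp p1.
have base v' : 0 <= v' -> v' < p -> d * (p - v') <= f p - f v'.
  move=> v0 vp'; rewrite leNgt; apply/negP => H.
  (* Half the gap between the slopes: quotients within [e] of [d] still exceed the chord slope. *)
  pose e := (d - (f p - f v') / (p - v')) / 2.
  have e0 : 0 < e.
    rewrite /e; apply: divr_gt0 => //; rewrite subr_gt0 ltr_pdivrMr; lra.
  have [r r0 Hr] := (is_derive_dist f p d).1 df e e0.
  pose y := Num.min 1 (p + r / 2).
  have yp : p < y /\ y <= 1 /\ y <= p + r / 2.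
    by rewrite /y lt_min !ge_min !lexx orbT; lra.
  have := Hr y; rewrite gtr0_norm; last by lra.
  move=> /(_ ltac:(lra)); rewrite ler_norml => Hy.
  have T := @three_chord R f v' p y cf v0 vp' ltac:(lra) ltac:(lra).
  have m1 : (d - e) * (y - p) * (p - v') <= (f y - f p) * (p - v').
    by apply: ler_wpM2r; lra.
  have pv : p - v' != 0 by rewrite subr_eq0 gt_eqF.
  have E : (d - e) * (p - v') = (f p - f v') + e * (p - v') by rewrite /e; field.
  have m2 : (f p - f v' + e * (p - v')) * (y - p) = (d - e) * (y - p) * (p - v').
    by rewrite -E; ring.
  have : 0 < e * (p - v') * (y - p) by apply: mulr_gt0; [apply: mulr_gt0|]; lra.
  by lra.
move: uv; rewrite le_eqVlt => /predU1P[->|uv]; first by rewrite !subrr mulr0.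
move: vp; rewrite le_eqVlt => /predU1P[E|vp]; first by rewrite E; apply: base; lra.
have T := three_chord cf u0 uv vp (ltW p1).
have B := base v ltac:(lra) vp.
have : d * (p - v) * (v - u) <= (f p - f v) * (v - u) by apply: ler_wpM2r; lra.
move=> h; rewrite -(@ler_pM2r _ (p - v)); last lra.
by lra.
Qed.

Lemma wavefront_of_z (R : realType) (alpha c L tau e sl sr : R) (f D g h z : R -> R) :
  0 < alpha < 1 -> {within `[0, 1], continuous f} -> C1_01 D ->
  {within `[0, 1], continuous g} -> g 0 = 0 -> g 1 = 0 ->
  continuous h -> (forall x : R, 0 < x < 1 -> is_derive x 1 f (h x)) ->
  (forall x, 0 < x < alpha -> 0 < D x) -> (forall x, alpha < x < 1 -> D x < 0) ->
  D alpha = 0 ->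
  0 < L -> 0 < tau < 1 -> 0 < e -> `|sl| = 1 -> `|sr| = 1 ->
  (forall s, 0 < s < e -> L * s `^ tau <= sl * g (alpha - s)) ->
  (forall s, 0 < s < e -> L * s `^ tau <= sr * g (alpha + s)) ->
  continuous z -> z 0 = 0 -> z alpha = 0 -> z 1 = 0 ->
  (forall x, 0 < x < alpha -> z x < 0) -> (forall x, alpha < x < 1 -> 0 < z x) ->
  (forall x : R, 0 < x < 1 -> x != alpha -> is_derive x 1 z (h x - c - D x * g x / z x)) ->
  exists phi, wavefront f D g c phi.
Proof.
move=> a01 cf C1D cg g0 g1 ch df Dp Dn Da L0 t01 e0 sl1 sr1 Hl Hr cz z0 za z1 zn zp dz.
have [Dd [_ [_ _ dD]]] := C1_01_derive C1D.
have cD (x : R) : 0 < x < 1 -> {for x, continuous D}.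
  by move=> x01; exact: continuous_is_derive (dD x x01).
have [T [cT dT]] := crossing_time a01 df (ch alpha) cD Da (dD alpha a01) Dp Dn
  (within_continuous_at a01 cg) L0 t01 e0 sl1 sr1 Hl Hr cz za zn zp dz.
apply: (wavefront_of_time cf cg g0 g1 df cz z0 z1 _ dz cT dT).
move=> x x01; rewrite neq_lt => /orP[xa|xa].
- have h1 := Dp x ltac:(lra); have h2 := zn x ltac:(lra).
  by rewrite pmulr_rlt0// invr_lt0.
- have h1 := Dn x ltac:(lra); have h2 := zp x ltac:(lra).
  by rewrite nmulr_rlt0// invr_gt0.
Qed.

(** Two solutions that meet at [p] with a common nonzero value join to a solution: [F], the
    right-hand side along [z], is then continuous at [p]. *)
Lemma glue_derive (R : realType) (z F : R -> R) (a b p : R) : a < p < b ->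
  continuous z -> {for p, continuous F} ->
  (forall x : R, a < x < p -> is_derive x 1 z (F x)) ->
  (forall x : R, p < x < b -> is_derive x 1 z (F x)) ->
  forall x : R, a < x < b -> is_derive x 1 z (F x).
Proof.
move=> apb cz cF d1 d2 x xab.
have d y : a < y < b -> y != p -> is_derive y 1 z (F y).
  by move=> yab; rewrite neq_lt => /orP[yp|py]; [apply: d1|apply: d2]; lra.
have [->|xp] := eqVneq x p; last exact: d.
by apply: (is_derive_extend apb) => //; exact: cz.
Qed.

(** * Oriented pieces of the flux *)

Section Pieces.
Variables (R : realType) (F h q : R -> R) (M B : R).
Hypothesis F_continuous : continuous F.
Hypothesis h_continuous : continuous h.
Hypothesis q_continuous : continuous q.
Hypothesis h_bounded : forall x : R, `|h x| <= M.
Hypothesis B_gt0 : 0 < B.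
Hypothesis q_bounded : forall x : R, `|q x| <= B.
Hypothesis F_derive : forall x : R, 0 < x < 1 -> is_derive x 1 F (h x).

Section Oriented.
Variables (c p dl ep l : R).
Hypothesis dl1 : dl = 1 \/ dl = -1.
Hypothesis ep1 : ep = 1 \/ ep = -1.
Hypothesis l0 : 0 < l.
Hypothesis in01 : forall s, 0 < s < l -> 0 < p + dl * s < 1.

(* Leaving [p] in the direction [dl] with sign [ep], the flux is
   [z x = ep * W (dl * (x - p))] where [W' = piece_k + piece_Q / W]. *)
Definition piece_k (s : R) := ep * dl * (h (p + dl * s) - c).
Definition piece_Q (s : R) := Num.max 0 (- (dl * q (p + dl * s))).

Lemma sign_norm (x : R) : x = 1 \/ x = -1 -> `|x| = 1.
Proof. by case=> ->; rewrite ?normrN normr1. Qed.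

Lemma sign_sq (x : R) : x = 1 \/ x = -1 -> x * x = 1.
Proof. by case=> ->; rewrite ?mulrNN mulr1. Qed.

Lemma affine_continuous (a b : R) : continuous (fun s : R => a + b * s).
Proof.
move=> x; apply: cvgD; first exact: cvg_cst.
by apply: cvgM; [exact: cvg_cst|exact: cvg_id].
Qed.

Lemma comp_affine_continuous (u : R -> R) (a b : R) : continuous u ->
  continuous (fun s => u (a + b * s)).
Proof.
move=> cu x; apply: (@continuous_comp _ _ _ (fun s => a + b * s) u); last exact: cu.
exact: affine_continuous.
Qed.

Lemma piece_k_continuous : continuous piece_k.
Proof.
move=> x; apply: cvgM; first exact: cvg_cst.
apply: cvgB; last exact: cvg_cst.
by apply: (@continuous_comp _ _ _ (fun s => p + dl * s) h);
  [exact: affine_continuous|exact: h_continuous].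
Qed.

Lemma piece_Q_continuous : continuous piece_Q.
Proof.
move=> x; apply: (@continuous_max _ _ (cst 0) (fun s => - (dl * q (p + dl * s)))).
  exact: cst_continuous.
apply: cvgN; apply: cvgM; first exact: cvg_cst.
by apply: (@continuous_comp _ _ _ (fun s => p + dl * s) q);
  [exact: affine_continuous|exact: q_continuous].
Qed.

Lemma piece_k_bounded s : `|piece_k s| <= M + `|c|.
Proof.
rewrite /piece_k !normrM (sign_norm dl1) (sign_norm ep1) !mul1r.
by apply: le_trans (ler_normB _ _) _; rewrite lerD2r.
Qed.

Lemma piece_Q_bounded s : 0 <= piece_Q s <= B.
Proof.
rewrite /piece_Q le_max lexx/= ge_max ltW//=.
apply: le_trans (ler_norm _) _; rewrite normrN normrM (sign_norm dl1) mul1r.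
exact: q_bounded.
Qed.

Hypothesis q_sign : forall s, 0 < s < l -> 0 < - (dl * q (p + dl * s)).

(** The sign of [q] is known only along the piece, whereas existence asks for a nonnegative [Q] on
    the whole line; the maximum with 0 supplies this and is inactive here. *)
Lemma piece_QE s : 0 < s < l -> piece_Q s = - (dl * q (p + dl * s)).
Proof. by move=> /q_sign H; rewrite /piece_Q max_r// ltW. Qed.

Lemma piece_Q_gt0 s : 0 < s < l -> 0 < piece_Q s.
Proof. by move=> sl; rewrite piece_QE//; exact: q_sign. Qed.

Lemma piece_exists w : 0 <= w -> exists2 W, saddle piece_k piece_Q l W & W 0 = w.
Proof.
move=> w0; exact: (saddle_exists piece_k_continuous piece_Q_continuous l0 w0 B_gt0
  piece_k_bounded piece_Q_bounded piece_Q_gt0).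
Qed.

Lemma piece_arg_continuous (W : R -> R) : continuous W ->
  continuous (fun x => ep * W (dl * (x - p))).
Proof.
move=> cW x; apply: cvgM; first exact: cvg_cst.
apply: (@continuous_comp _ _ _ (fun x => dl * (x - p)) W); last exact: cW.
apply: cvgM; first exact: cvg_cst.
by apply: cvgB; [exact: cvg_id|exact: cvg_cst].
Qed.

Lemma piece_derive W x : saddle piece_k piece_Q l W -> 0 < dl * (x - p) < l ->
  is_derive x 1 (fun x => ep * W (dl * (x - p)))
    (h x - c - q x / (ep * W (dl * (x - p)))).
Proof.
move=> [_ HW] xl; have [Wx dW] := HW _ xl.
have xE : p + dl * (dl * (x - p)) = x by rewrite mulrA (sign_sq dl1) mul1r addrC subrK.
have Ha : is_derive x 1 (fun x : R => dl * (x - p)) dl.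
  by apply: is_derive_eq; rewrite /GRing.scale/=; ring.
have d1 := @is_derive1_comp _ W (fun x => dl * (x - p)) x _ _ dW Ha.
have d2 := @is_derive_mulc R _ ep x _ d1.
apply: (@is_derive_eq _ _ _ _ _ _ _ _ d2).
rewrite piece_QE// /piece_k xE.
have W0 : W (dl * (x - p)) != 0 by rewrite gt_eqF.
by move: W0; case: dl1 => ->; case: ep1 => -> W0; field; rewrite ?W0 ?oppr_eq0 ?W0.
Qed.

(** [piece_k] has the primitive [ep * F (p + dl * s) - ep * dl * c * s], so the decay rate becomes a
    condition on increments of [F], in the form that concavity provides. *)
Lemma piece_node W m S : saddle piece_k piece_Q l W ->
  (forall s, 0 <= s <= l ->
    ep * (F (p + dl * l) - F (p + dl * s)) - ep * dl * c * (l - s) <= - m * (l - s)) ->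
  (forall s, 0 < s < l -> - (dl * q (p + dl * s)) <= S * (l - s)) ->
  0 < m -> 4 * S <= m ^+ 2 -> W 0 <= m / 2 * l -> W l = 0.
Proof.
move=> HW HK HQ m0 Sm W0.
apply: (@saddle_node R piece_k piece_Q
  (fun s => ep * F (p + dl * s) - ep * dl * c * s) W l m S) => //.
- move=> x; apply: cvgB; last by apply: cvgM; [exact: cvg_cst|exact: cvg_id].
  apply: cvgM; first exact: cvg_cst.
  by apply: (@continuous_comp _ _ _ (fun s => p + dl * s) F);
    [exact: affine_continuous|exact: F_continuous].
- move=> s sl.
  have Ha : is_derive s 1 (fun s : R => p + dl * s) dl.
    by apply: is_derive_eq; rewrite /GRing.scale/=; ring.
  have dF := F_derive (in01 sl).
  have d1 := @is_derive1_comp _ F (fun s => p + dl * s) s _ _ dF Ha.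
  have d2 := @is_derive_mulc R _ ep s _ d1.
  have d3 := @is_derive_mulc R id (ep * dl * c) s 1 (is_derive_id _ _).
  have -> : piece_k s = ep * (h (p + dl * s) * dl) - ep * dl * c * 1.
    by rewrite /piece_k; ring.
  exact: is_deriveB.
- by move=> s sl; have := HK s sl; lra.
- by move=> s sl; rewrite piece_QE//; exact: HQ.
Qed.

End Oriented.
End Pieces.

Lemma sup_node_bounds (R : realType) (S m : R) :
  0 < S -> 2 * Num.sqrt S <= m -> 0 < m /\ 4 * S <= m ^+ 2.
Proof.
move=> S0 Sm; have sS : 0 < Num.sqrt S by rewrite sqrtr_gt0.
have SE : Num.sqrt S * Num.sqrt S = S by rewrite -expr2 sqr_sqrtr// ltW.
split; first lra.
have : (2 * Num.sqrt S) * (2 * Num.sqrt S) <= m * m by apply: ler_pM; lra.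
by rewrite expr2; lra.
Qed.

(** Boundedness is a separate premise because [sup] of an unbounded set is a default value. *)
Lemma delta_le_sup (R : realType) (q : R -> R) (p x : R) (A : set R) :
  has_ubound [set delta q p x | x in A] -> A x ->
  delta q p x <= sup [set delta q p x | x in A].
Proof.
move=> ub Ax; apply: sup_upper_bound; last by exists x.
by split => //; exists (delta q p x); exists x.
Qed.

(** Where [g alpha] is nonzero any exponent works, since [s ^ tau <= 1] for small [s]; one half is
    an arbitrary choice. *)
Lemma crossing_of_nonzero (R : realType) (g : R -> R) (alpha sigma : R) :
  {for alpha, continuous g} -> `|sigma| = 1 -> 0 < sigma * g alpha ->
  exists L e, [/\ 0 < L, 0 < e,
    (forall s, 0 < s < e -> L * s `^ 2^-1 <= sigma * g (alpha - s)) &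
    (forall s, 0 < s < e -> L * s `^ 2^-1 <= sigma * g (alpha + s))].
Proof.
move=> cg s1 sg; pose L := sigma * g alpha / 2.
have L0 : 0 < L by rewrite /L; lra.
have [r r0 Hr] := continuous_near_ball cg L0.
exists L, (Num.min 1 r).
have aux y s : 0 < s < Num.min 1 r -> `|y - alpha| = s -> L * s `^ 2^-1 <= sigma * g y.
  rewrite lt_min => /andP[s0 /andP[sl1 sr]] ys.
  have h : `|sigma * (g y - g alpha)| < L by rewrite normrM s1 mul1r; apply: Hr; rewrite ys.
  have p1 : s `^ 2^-1 <= 1.
    have h0 : (0 : R) <= 2^-1 by rewrite invr_ge0.
    have := @ge0_ler_powR R 2^-1 h0 s 1; rewrite powR1 !nnegrE; apply; lra.
  have : L * s `^ 2^-1 <= L * 1 by apply: ler_wpM2l => //; exact: ltW.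
  move: h; rewrite ltr_norml mulrBr /L; lra.
split => //; first by rewrite lt_min ltr01.
- move=> s sl; apply: aux => //.
  have s0 : 0 < s by lra.
  by rewrite addrAC subrr add0r normrN gtr0_norm.
- move=> s sl; apply: aux => //.
  have s0 : 0 < s by lra.
  by rewrite addrAC subrr add0r gtr0_norm.
Qed.

(** * Assembling the flux in the three cases *)

Section Main.
Variables (R : realType) (alpha gamma : R) (f D g : R -> R).
Hypothesis a01 : 0 < alpha < 1.
Hypothesis gamma01 : 0 < gamma < 1.
Hypothesis C1f : C1_01 f.
Hypothesis C1D : C1_01 D.
Hypothesis Dp : forall x, 0 < x < alpha -> 0 < D x.
Hypothesis Dn : forall x, alpha < x < 1 -> D x < 0.
Hypothesis C0g : C0_01 g.
Hypothesis gn : forall x, 0 < x < gamma -> g x < 0.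
Hypothesis gp : forall x, gamma < x < 1 -> 0 < g x.
Hypothesis g0 : g 0 = 0.
Hypothesis gg : g gamma = 0.
Hypothesis g1 : g 1 = 0.
Hypothesis f_concave : strictly_concave_01 f.

Let q0 x := D x * g x.
(** [f] and [q0] are controlled only on [[0, 1]]; the clamped copies [F] and [q] are continuous on
    the line, as the pieces require. *)
Let F x := f (clamp 0 1 x).
Let q x := q0 (clamp 0 1 x).

Lemma D_continuous (x : R) : 0 < x < 1 -> {for x, continuous D}.
Proof. by move=> x01; apply: (within_continuous_at x01); have [] := C1D. Qed.

Lemma D_alpha : D alpha = 0.
Proof.
have cD := D_continuous a01.
have al01 := a01.
have [D0|D0|//] := ltgtP (D alpha) 0.
- have [|r r0 Hr] := continuous_near_ball cD (_ : 0 < - D alpha); first lra.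
  pose y := Num.max (alpha / 2) (alpha - r / 2).
  have yx : alpha / 2 <= y /\ alpha - r / 2 <= y /\ y < alpha.
    by rewrite /y !le_max !lexx orbT gt_max; do !split => //; lra.
  have := @Dp y ltac:(lra); have := Hr y; rewrite !ltr_norml => /(_ ltac:(lra)); lra.
- have [r r0 Hr] := continuous_near_ball cD D0.
  pose y := Num.min ((alpha + 1) / 2) (alpha + r / 2).
  have yx : y <= (alpha + 1) / 2 /\ y <= alpha + r / 2 /\ alpha < y.
    by rewrite /y !ge_min !lexx orbT lt_min; do !split => //; lra.
  have := @Dn y ltac:(lra); have := Hr y; rewrite !ltr_norml => /(_ ltac:(lra)); lra.
Qed.

Lemma f_within : {within `[0, 1], continuous f}. Proof. by have [] := C1f. Qed.

Lemma q0_within : {within `[0, 1], continuous q0}.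
Proof. by move=> x; apply: cvgM; [have [cD _] := C1D; exact: cD|exact: C0g]. Qed.

Lemma F_continuous : continuous F.
Proof. exact: continuous_clamp ler01 f_within. Qed.

Lemma q_continuous : continuous q.
Proof. exact: continuous_clamp ler01 q0_within. Qed.

Lemma FE x : 0 <= x <= 1 -> F x = f x.
Proof. by move=> x01; rewrite /F clampE. Qed.

Lemma qE x : 0 <= x <= 1 -> q x = D x * g x.
Proof. by move=> x01; rewrite /q clampE. Qed.

Lemma q_at1 : q 1 = 0. Proof. by rewrite qE ?g1 ?mulr0// lexx ler01. Qed.
Lemma q_at_gamma : q gamma = 0.
Proof. by have ga01 := gamma01; rewrite qE ?gg ?mulr0//; lra. Qed.
Lemma q_at_alpha : q alpha = 0.
Proof. by have al01 := a01; rewrite qE ?D_alpha ?mul0r//; lra. Qed.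

Lemma F_derive h : (forall x : R, 0 < x < 1 -> is_derive x 1 f (h x)) ->
  forall x : R, 0 < x < 1 -> is_derive x 1 F (h x).
Proof.
move=> df x x01; apply: (@is_derive_near _ f _ _ _ 0 1) => //; last exact: df.
by move=> y y01; rewrite FE//; lra.
Qed.

Lemma q_data : exists2 B, 0 < B & forall x : R, `|q x| <= B.
Proof. exact: bounded_clamp q0_within. Qed.

Lemma delta_q0 p x : 0 <= x <= 1 -> 0 <= p <= 1 -> q p = 0 -> x != p ->
  delta q0 p x * (x - p) = q x.
Proof.
move=> x01 p1 qp xp; rewrite /delta -/(q0 p) (_ : q0 p = 0); last first.
  by rewrite -qp qE.
by rewrite subr0 divfK ?subr_eq0// qE.
Qed.

Lemma F_chord_right p s : 0 < p -> p <= s <= 1 -> p < 1 ->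
  F 1 - F s <= (f 1 - f p) / (1 - p) * (1 - s).
Proof.
move=> p0 ps p1; rewrite !FE; [|lra..].
by apply: concave_chord_right => //; lra.
Qed.

Lemma F_chord_left (d p u v : R) : is_derive p 1 f d -> 0 < p < 1 -> 0 <= u -> u <= v -> v <= p ->
  d * (v - u) <= F v - F u.
Proof.
move=> df p01 u0 uv vp; rewrite !FE; [|lra..].
by apply: (@concave_chord_left R f d p) => //; lra.
Qed.

(** As [q 1 = 0], [delta q0 1 s] is the ratio of [- q s] to [1 - s]. Strict positivity of [S] comes
    from the sign of [q] and later makes the decay rate positive. *)
Lemma sup_right_bound p S : 0 < p < 1 -> (forall x, p < x < 1 -> q x < 0) ->
  has_ubound [set delta q0 1 x | x in `[p, 1[%classic] ->
  S = sup [set delta q0 1 x | x in `[p, 1[%classic] ->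
  0 < S /\ forall s, p <= s -> s < 1 -> - q s <= S * (1 - s).
Proof.
move=> p01 qn ub ->; set S' := sup _.
have key s : p <= s -> s < 1 -> delta q0 1 s <= S'.
  by move=> ps s1; apply: delta_le_sup => //=; rewrite in_itv/= ps.
have dq s : p <= s -> s < 1 -> delta q0 1 s * (s - 1) = q s.
  by move=> ps s1; apply: delta_q0 => //; [lra|lra|exact: q_at1|rewrite lt_eqF].
split.
  pose x := (p + 1) / 2.
  have xp : p <= x /\ x < 1 /\ p < x by rewrite /x; lra.
  apply: lt_le_trans (key x _ _); [|lra..].
  have := dq x ltac:(lra) ltac:(lra); have := qn x ltac:(lra) => h1 h2.
  rewrite ltNge; apply/negP => h3.
  have : 0 <= delta q0 1 x * (x - 1) by apply: mulr_le0 => //; lra.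
  by lra.
move=> s ps s1; rewrite -(dq s ps s1) -mulrN opprB.
by apply: ler_wpM2r; [lra|exact: key].
Qed.

Let slope p := (f 1 - f p) / (1 - p).

Section WithDerivative.
Variables (h : R -> R) (M B : R).
Hypothesis h_continuous : continuous h.
Hypothesis h_bounded : forall x : R, `|h x| <= M.
Hypothesis f_derive : forall x : R, 0 < x < 1 -> is_derive x 1 f (h x).
Hypothesis B_gt0 : 0 < B.
Hypothesis q_bounded : forall x : R, `|q x| <= B.

Let k c p dl ep := piece_k h c p dl ep.
Let Q p dl := piece_Q q p dl.
Let one1 : (1 : R) = 1 \/ (1 : R) = -1. Proof. by left. Qed.
Let mone1 : (-1 : R) = 1 \/ (-1 : R) = -1. Proof. by right. Qed.

Lemma piece_from_right_exists c p w : 0 < p < 1 -> (forall x, p < x < 1 -> q x < 0) ->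
  0 <= w -> exists2 W, saddle (k c p 1 1) (Q p 1) (1 - p) W & W 0 = w.
Proof.
move=> p01 qn w0; apply: (piece_exists h_continuous q_continuous h_bounded B_gt0 q_bounded) => //.
  by lra.
by move=> s sp; rewrite !mul1r oppr_gt0; apply: qn; lra.
Qed.

(** By concavity chords ending at 1 are at most as steep as the one from [p], so the primitive of
    [h - c] falls at rate [m = c - slope p], and the speed condition reads [2 * sqrt S <= m]. *)
Lemma piece_node_one c p S W : 0 < p < 1 -> (forall x, p < x < 1 -> q x < 0) ->
  has_ubound [set delta q0 1 x | x in `[p, 1[%classic] ->
  S = sup [set delta q0 1 x | x in `[p, 1[%classic] ->
  slope p + 2 * Num.sqrt S <= c ->
  saddle (k c p 1 1) (Q p 1) (1 - p) W -> W 0 <= (c - slope p) / 2 * (1 - p) -> W (1 - p) = 0.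
Proof.
move=> p01 qn ub SE cS HW W0.
have [S0 HS] := sup_right_bound p01 qn ub SE.
have [m0 m1] := @sup_node_bounds R S (c - slope p) S0 ltac:(lra).
apply: (piece_node F_continuous (F_derive f_derive) _ _ _ HW _ _ m0 m1 W0).
- by lra.
- by move=> s sp; rewrite mul1r; lra.
- by move=> s sp; rewrite !mul1r oppr_gt0; apply: qn; lra.
- move=> s sp; rewrite !mul1r.
  have -> : p + (1 - p) = 1 by ring.
  have := @F_chord_right p (p + s) ltac:(lra) ltac:(lra) ltac:(lra).
  by rewrite -/(slope p); lra.
- by move=> s sp; rewrite !mul1r; have := HS (p + s) ltac:(lra) ltac:(lra); lra.
Qed.

Lemma piece_from_zero_exists c b w : 0 < b < 1 -> (forall x, 0 < x < b -> q x < 0) ->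
  0 <= w -> exists2 W, saddle (k c 0 1 (-1)) (Q 0 1) b W & W 0 = w.
Proof.
move=> b01 qn w0; apply: (piece_exists h_continuous q_continuous h_bounded B_gt0 q_bounded) => //.
  by lra.
by move=> s sp; rewrite !mul1r add0r oppr_gt0; apply: qn; lra.
Qed.

(** The negative flux turns [k] into [c - h], and the rate is [d - c]. In all uses [d] is [h gamma],
    also when [b] is alpha left of gamma: chords of [f] further left are steeper. *)
Lemma piece_node_left c b S d W : 0 < b < 1 -> (forall x, 0 < x < b -> q x < 0) ->
  (forall s, 0 <= s <= b -> d * (b - s) <= F b - F s) ->
  0 < S -> (forall s, 0 < s < b -> - q s <= S * (b - s)) ->
  c <= d - 2 * Num.sqrt S ->
  saddle (k c 0 1 (-1)) (Q 0 1) b W -> W 0 <= (d - c) / 2 * b -> W b = 0.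
Proof.
move=> b01 qn Hd S0 HS cS HW W0.
have [m0 m1] := @sup_node_bounds R S (d - c) S0 ltac:(lra).
apply: (piece_node F_continuous (F_derive f_derive) _ _ _ HW _ _ m0 m1 W0).
- by lra.
- by move=> s sp; rewrite mul1r; lra.
- by move=> s sp; rewrite !mul1r add0r oppr_gt0; apply: qn; lra.
- move=> s sp; rewrite !mul1r !add0r.
  by have := Hd s sp; lra.
- by move=> s sp; rewrite !mul1r add0r; exact: HS.
Qed.

Lemma piece_to_z c p dl ep l W z a b : dl = 1 \/ dl = -1 -> ep = 1 \/ ep = -1 ->
  0 <= a -> b <= 1 ->
  (forall s, 0 < s < l -> 0 < - (dl * q (p + dl * s))) ->
  saddle (k c p dl ep) (Q p dl) l W ->
  (forall x, a < x < b -> 0 < dl * (x - p) < l) ->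
  (forall x, a < x < b -> z x = ep * W (dl * (x - p))) ->
  forall x : R, a < x < b ->
    0 < ep * z x /\ is_derive x 1 z (h x - c - D x * g x / z x).
Proof.
move=> dl1 ep1 a0 b1 qs HW Hx zE x xab.
have [Wx _] := HW.2 _ (Hx x xab).
split; first by rewrite zE// mulrA (sign_sq ep1) mul1r.
apply: (@is_derive_near _ (fun x => ep * W (dl * (x - p))) _ _ _ a b) => //.
  by move=> y yab; rewrite zE.
rewrite zE// -qE; last by lra.
by apply: (piece_derive dl1 ep1 qs HW); exact: Hx.
Qed.

Lemma derive_gamma : derive1 f gamma = h gamma.
Proof.
have df := f_derive gamma01.
by rewrite derive1E (@derive_val _ _ _ _ _ _ _ df).
Qed.

(** [A] is a parameter because the supremum runs over [[0, gamma[] in two cases and over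
    [[0, gamma]] without alpha in the third; the estimate itself concerns only the points of
    [(0, p)]. *)
Lemma delta_left_bound p (A : set R) S : 0 < p < 1 -> q p = 0 ->
  (forall x, 0 < x < p -> A x) -> (forall x, 0 < x < p -> q x < 0) ->
  has_ubound [set delta q0 p x | x in A] -> S = sup [set delta q0 p x | x in A] ->
  0 < S /\ forall s, 0 < s < p -> - q s <= S * (p - s).
Proof.
move=> p01 qp HA qn ub ->; set S' := sup _.
have key s : 0 < s < p -> delta q0 p s <= S' by move=> sp; apply: delta_le_sup => //; exact: HA.
have dq s : 0 < s < p -> delta q0 p s * (s - p) = q s.
  by move=> sp; apply: delta_q0 => //; [lra|lra|rewrite lt_eqF//; lra].
split.
  have xp : 0 < p / 2 < p by lra.
  apply: lt_le_trans (key _ xp).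
  have := dq _ xp; have := qn _ xp => h1 h2.
  rewrite ltNge; apply/negP => h3.
  have : 0 <= delta q0 p (p / 2) * (p / 2 - p) by apply: mulr_le0 => //; lra.
  by lra.
move=> s sp; rewrite -(dq s sp) -mulrN opprB.
by apply: ler_wpM2r; [lra|exact: key].
Qed.

Lemma wavefront_of_flux (c : R) (z : R -> R) L tau e sl sr :
  0 < L -> 0 < tau < 1 -> 0 < e -> `|sl| = 1 -> `|sr| = 1 ->
  (forall s, 0 < s < e -> L * s `^ tau <= sl * g (alpha - s)) ->
  (forall s, 0 < s < e -> L * s `^ tau <= sr * g (alpha + s)) ->
  continuous z -> z 0 = 0 -> z alpha = 0 -> z 1 = 0 ->
  (forall x : R, 0 < x < alpha ->
    0 < -1 * z x /\ is_derive x 1 z (h x - c - D x * g x / z x)) ->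
  (forall x : R, alpha < x < 1 ->
    0 < 1 * z x /\ is_derive x 1 z (h x - c - D x * g x / z x)) ->
  exists c phi, wavefront f D g c phi.
Proof.
move=> L0 t01 e0 sl1 sr1 Hl Hr cz z0 za z1 Zl Zr; exists c.
apply: (@wavefront_of_z R alpha c L tau e sl sr f D g h z) => //.
- exact: f_within.
- exact: D_alpha.
- by move=> x /Zl[zx _]; lra.
- by move=> x /Zr[zx _]; lra.
move=> x x01; rewrite neq_lt => /orP[xa|xa].
  by have [] := Zl x ltac:(lra).
by have [] := Zr x ltac:(lra).
Qed.

Lemma wavefront_case_b : alpha = gamma ->
  has_ubound [set delta q0 1 x | x in `[alpha, 1[%classic] ->
  has_ubound [set delta q0 gamma x | x in `[0, gamma[%classic] ->
  2 * (Num.sqrt (sup [set delta q0 1 x | x in `[alpha, 1[%classic]) +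
       Num.sqrt (sup [set delta q0 gamma x | x in `[0, gamma[%classic]))
    <= derive1 f gamma - slope alpha ->
  (exists L tau eps : R, 0 < L /\ 0 < tau < 1 /\ 0 < eps /\
     forall x, `|x - gamma| < eps -> L * (`|x - gamma| `^ tau) <= `|g x|) ->
  exists c phi, wavefront f D g c phi.
Proof.
move=> ag ub1 ub2 cond [L [tau [eps [L0 [t01 [e0 HL]]]]]].
have al01 := a01.
have qnr x : alpha < x < 1 -> q x < 0.
  move=> xa; rewrite qE; last lra.
  by rewrite nmulr_rlt0 ?gp -?ag//; exact: Dn.
have qnl x : 0 < x < gamma -> q x < 0.
  move=> xa; rewrite qE; last by rewrite -ag in xa; lra.
  by rewrite pmulr_rlt0 ?gn//; apply: Dp; rewrite ag.
rewrite derive_gamma in cond.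
set S1 := sup _ in cond; set S2 := sup _ in cond.
have A2 x : 0 < x < gamma -> (`[0, gamma[%classic : set R) x.
  by move=> /andP[x0 xg]; rewrite /= in_itv/= ltW.
have [S20 HS2] := delta_left_bound gamma01 q_at_gamma A2 qnl ub2 (erefl S2).
have s1 := sqrtr_ge0 S1; have s2 := sqrtr_ge0 S2.
pose c := slope alpha + 2 * Num.sqrt S1.
have [WR HR WR0] := piece_from_right_exists c a01 qnr (lexx 0).
have [WL HL' WL0] := piece_from_zero_exists c gamma01 qnl (lexx 0).
have WR1 : WR (1 - alpha) = 0.
  apply: (piece_node_one a01 qnr ub1 erefl _ HR); first by rewrite -/S1.
  by rewrite WR0; apply: mulr_ge0; rewrite /c; lra.
have WL1 : WL gamma = 0.
  apply: (piece_node_left gamma01 qnl _ S20 HS2 _ HL' (d := h gamma)).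
  - move=> s sg; apply: (F_chord_left (f_derive gamma01)) => //; lra.
  - by rewrite /c; lra.
  - by rewrite WL0; apply: mulr_ge0; [rewrite /c|have := gamma01]; lra.
(* Keeps [alpha - s] and [alpha + s] in [(0, 1)], where the sign of [g] removes the absolute value
   in the lower bound. *)
pose e := Num.min eps (Num.min alpha (1 - alpha)).
have e1 : 0 < e by rewrite !lt_min; lra.
have eE s : 0 < s < e -> [/\ s < eps, s < alpha & s < 1 - alpha].
  by rewrite !lt_min => /andP[_ /and3P[]].
pose z x := if x < alpha then -1 * WL (1 * (x - 0)) else 1 * WR (1 * (x - alpha)).
apply: (@wavefront_of_flux c z L tau e (-1) 1) => //.
- by rewrite normrN normr1.
- by rewrite normr1.
- move=> s se; have [s_e sa s1a] := eE s se.
  have s0 : 0 < s by lra.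
  have := HL (alpha - s); rewrite -ag.
  have -> : `|alpha - s - alpha| = s by rewrite addrAC subrr add0r normrN gtr0_norm.
  rewrite ltr0_norm; last by apply: gn; rewrite -ag; lra.
  by rewrite mulN1r; apply.
- move=> s se; have [s_e sa s1a] := eE s se.
  have s0 : 0 < s by lra.
  have := HL (alpha + s); rewrite -ag.
  have -> : `|alpha + s - alpha| = s by rewrite addrAC subrr add0r gtr0_norm.
  rewrite gtr0_norm; last by apply: gp; rewrite -ag; lra.
  by rewrite mul1r; apply.
- apply: continuous_glue; [exact: piece_arg_continuous HL'.1|
    exact: piece_arg_continuous HR.1|].
  by rewrite !mul1r subr0 subrr WR0 {1}ag WL1 mulr0.
- by rewrite /z; have /andP[-> _] := al01; rewrite subrr mulr0 WL0 mulr0.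
- by rewrite /z ltxx subrr mulr0 WR0 mulr0.
- by rewrite /z; have /andP[_ /ltW/le_gtF->] := al01; rewrite !mul1r.
- move=> x xa; apply: (piece_to_z one1 mone1 (lexx 0) _ _ HL' _ _ xa).
  + by lra.
  + by move=> s sg; rewrite !mul1r add0r oppr_gt0; apply: qnl.
  + by move=> y ya; rewrite mul1r subr0 -ag.
  + by move=> y /andP[_ ya]; rewrite /z ya.
- move=> x xa; apply: (piece_to_z one1 one1 _ (lexx 1) _ HR _ _ xa).
  + by lra.
  + by move=> s sg; rewrite !mul1r oppr_gt0; apply: qnr; lra.
  + by move=> y ya; rewrite mul1r; lra.
  + by move=> y /andP[/ltW/le_gtF ya _]; rewrite /z ya.
Qed.

Lemma q_lt0_of_D_pos x : 0 < x < 1 -> x < alpha -> x < gamma -> q x < 0.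
Proof.
move=> /andP[x0 x1] xa xg; rewrite qE; last by rewrite !ltW.
by rewrite pmulr_rlt0 ?gn ?Dp// x0.
Qed.

Lemma q_lt0_of_D_neg x : 0 < x < 1 -> alpha < x -> gamma < x -> q x < 0.
Proof.
move=> /andP[x0 x1] ax gx; rewrite qE; last by rewrite !ltW.
by rewrite nmulr_rlt0 ?gp ?Dn ?gx ?ax.
Qed.

(** At gamma the pieces join away from [z = 0], so [D * g / z] is continuous there and the equation
    extends across. *)
Lemma flux_glue (c : R) (z : R -> R) (a b : R) :
  0 <= a -> a < gamma < b -> b <= 1 -> continuous z -> z gamma != 0 ->
  (forall x : R, a < x < gamma -> is_derive x 1 z (h x - c - D x * g x / z x)) ->
  (forall x : R, gamma < x < b -> is_derive x 1 z (h x - c - D x * g x / z x)) ->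
  forall x : R, a < x < b -> is_derive x 1 z (h x - c - D x * g x / z x).
Proof.
move=> a0 agb b1 cz zg; apply: (glue_derive agb cz).
apply: cvgB; first by apply: cvgB; [exact: h_continuous|exact: cvg_cst].
apply: cvgM; last by apply: cvgV => //; exact: cz.
by apply: cvgM; [exact: D_continuous|exact: within_continuous_at gamma01 C0g].
Qed.

Lemma half01 : 0 < (2^-1 : R) < 1.
Proof. by rewrite invr_gt0 ltr0n/= invf_lt1 ?ltr1n. Qed.

(** [W2] and [W3] both leave gamma, in opposite directions and with the same value, which is why
    only one positivity condition appears. At alpha [g] is negative on both sides. *)
Lemma wavefront_of_pieces_c c W1 W2 W3 : alpha < gamma ->
  (forall x, 0 < x < alpha -> q x < 0) -> (forall x, gamma < x < 1 -> q x < 0) ->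
  (forall s, 0 < s < gamma - alpha -> 0 < - (-1 * q (gamma + -1 * s))) ->
  saddle (k c 0 1 (-1)) (Q 0 1) alpha W1 -> W1 0 = 0 -> W1 alpha = 0 ->
  saddle (k c gamma (-1) 1) (Q gamma (-1)) (gamma - alpha) W2 -> W2 (gamma - alpha) = 0 ->
  saddle (k c gamma 1 1) (Q gamma 1) (1 - gamma) W3 -> W3 (1 - gamma) = 0 ->
  W2 0 = W3 0 -> 0 < W3 0 ->
  exists c phi, wavefront f D g c phi.
Proof.
move=> ag q1 q3 q2s H1 W10 W11 H2 W21 H3 W31 W23 W30.
have /andP[a0 a1] := a01; have /andP[c0 c1] := gamma01.
have g_alpha : 0 < -1 * g alpha by rewrite mulN1r oppr_gt0; apply: gn; rewrite a0.
have nm1 : `|-1 : R| = 1 by rewrite normrN normr1.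
have [L [e [L0 e0 Hl Hr]]] := crossing_of_nonzero (within_continuous_at a01 C0g) nm1 g_alpha.
pose z x := if x < gamma then (if x < alpha then -1 * W1 (1 * (x - 0)) else 1 * W2 (-1 * (x - gamma)))
  else 1 * W3 (1 * (x - gamma)).
have cz : continuous z.
  apply: continuous_glue; [|exact: piece_arg_continuous H3.1|].
    apply: continuous_glue; [exact: piece_arg_continuous H1.1|
      exact: piece_arg_continuous H2.1|].
    by rewrite !mul1r subr0 W11 mulr0 mulN1r opprB W21.
  have /ltW/le_gtF -> := ag.
  by rewrite !mul1r subrr mulr0.
have zg : z gamma = W3 0 by rewrite /z ltxx subrr mulr0 mul1r.
have P2 (x : R) : alpha < x < gamma ->
    0 < 1 * z x /\ is_derive x 1 z (h x - c - D x * g x / z x).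
  move=> xa; apply: (piece_to_z mone1 one1 (ltW a0) (ltW c1) q2s H2 _ _ xa).
  - by move=> y /andP[y1 y2]; rewrite mulN1r opprB subr_gt0 y2 ltrD2l ltrN2.
  - by move=> y /andP[/ltW/le_gtF ya yg]; rewrite /z yg ya.
have q3s s : 0 < s < 1 - gamma -> 0 < - (1 * q (gamma + 1 * s)).
  move=> /andP[s0 s1]; rewrite !mul1r oppr_gt0; apply: q3.
  by rewrite ltrDl s0 -ltrBrDl.
have P3 (x : R) : gamma < x < 1 ->
    0 < 1 * z x /\ is_derive x 1 z (h x - c - D x * g x / z x).
  move=> xa; apply: (piece_to_z one1 one1 (ltW c0) (lexx 1) q3s H3 _ _ xa).
  - by move=> y /andP[y1 y2]; rewrite mul1r subr_gt0 y1 ltrD2r.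
  - by move=> y /andP[/ltW/le_gtF ya _]; rewrite /z ya.
apply: (wavefront_of_flux L0 half01 e0 nm1 nm1 Hl Hr cz).
- by rewrite /z c0 a0 subrr mulr0 W10 mulr0.
- by rewrite /z ag ltxx mulN1r opprB W21 mulr0.
- by rewrite /z; have /ltW/le_gtF-> := c1; rewrite !mul1r.
- move=> x xa; apply: (piece_to_z one1 mone1 (lexx 0) (ltW a1) _ H1 _ _ xa).
  + by move=> s sg; rewrite !mul1r add0r oppr_gt0; apply: q1.
  + by move=> y ya; rewrite mul1r subr0.
  + by move=> y /andP[_ ya]; rewrite /z ya (lt_trans ya ag).
- have agc : alpha < gamma < 1 by rewrite ag.
  move=> x xa; split.
    have /andP[x1 x2] := xa.
    have [xg|gx|->] := ltgtP x gamma; last by rewrite zg mul1r.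
      by have [] := P2 x (introT andP (conj x1 xg)).
    by have [] := P3 x (introT andP (conj gx x2)).
  apply: (flux_glue (ltW a0) agc (lexx 1) cz _ _ _ xa).
  + by rewrite zg gt_eqF.
  + by move=> y /P2[_ dzy]; exact: dzy.
  + by move=> y /P3[_ dzy]; exact: dzy.
Qed.

Lemma wavefront_case_c : alpha < gamma ->
  has_ubound [set delta q0 1 x | x in `[gamma, 1[%classic] ->
  has_ubound [set delta q0 alpha x | x in `[0, gamma]%classic `\ alpha] ->
  2 * (Num.sqrt (sup [set delta q0 1 x | x in `[gamma, 1[%classic]) +
       Num.sqrt (sup [set delta q0 alpha x | x in `[0, gamma]%classic `\ alpha]))
    < derive1 f gamma - slope gamma ->
  exists c phi, wavefront f D g c phi.
Proof.
move=> ag ub3 ub4; rewrite derive_gamma => cond.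
have /andP[al0 al1] := a01; have /andP[ga0 ga1] := gamma01.
have q1 x : 0 < x < alpha -> q x < 0.
  move=> /andP[x0 xa]; apply: q_lt0_of_D_pos => //.
    by rewrite x0 (lt_trans xa).
  exact: lt_trans ag.
have q3 x : gamma < x < 1 -> q x < 0.
  move=> /andP[gx x1]; apply: q_lt0_of_D_neg => //.
    by rewrite x1 (lt_trans ga0).
  exact: lt_trans gx.
have q2 x : alpha < x < gamma -> 0 < q x.
  move=> /andP[ax xg]; have x0 := lt_trans al0 ax; have x1 := lt_trans xg ga1.
  by rewrite qE ?nmulr_rgt0 ?Dn ?gn ?ax ?x0// !ltW.
set S3 := sup _ in cond; set S4 := sup _ in cond.
have A4 x : 0 < x < alpha -> (`[0, gamma]%classic `\ alpha : set R) x.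
  move=> /andP[x0 xa]; split; last by move=> /= E; rewrite E ltxx in xa.
  by rewrite /= in_itv/= !ltW// (lt_trans xa).
have [S40 HS4] := delta_left_bound a01 q_at_alpha A4 q1 ub4 (erefl S4).
(* The set in [S4] reaches across alpha, so a single constant serves both pieces that must vanish
   there. *)
have HS4' x : alpha < x < gamma -> q x <= S4 * (x - alpha).
  move=> /andP[ax xg]; have x0 := lt_trans al0 ax; have x1 := lt_trans xg ga1.
  have <- : delta q0 alpha x * (x - alpha) = q x.
    by apply: delta_q0; rewrite ?q_at_alpha ?gt_eqF ?ltW.
  apply: ler_wpM2r; first by rewrite subr_ge0 ltW.
  apply: delta_le_sup => //; split; last by move=> /= E; rewrite E ltxx in ax.
  by rewrite /= in_itv/= !ltW.
have s4 : 0 < Num.sqrt S4 by rewrite sqrtr_gt0.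
have [S30 _] := sup_right_bound gamma01 q3 ub3 (erefl S3).
have s30 : 0 < Num.sqrt S3 by rewrite sqrtr_gt0.
pose c := slope gamma + 2 * Num.sqrt S3.
have c3 : 0 < c - slope gamma by rewrite /c addrC addKr mulr_gt0.
have c4 : 2 * Num.sqrt S4 <= h gamma - c.
  by rewrite /c; move: cond; lra.
have c4' : 0 < h gamma - c by apply: lt_le_trans c4; exact: mulr_gt0.
have l2 : 0 < gamma - alpha by rewrite subr_gt0.
(* The smaller of the two thresholds [m / 2 * l] of [piece_node], one for the piece running to 1 and
   one for the piece running back to alpha. *)
pose w := Num.min ((c - slope gamma) / 2 * (1 - gamma)) ((h gamma - c) / 2 * (gamma - alpha)).
have w0 : 0 < w.
  by rewrite lt_min; apply/andP; split; (apply: mulr_gt0; [exact: divr_gt0|rewrite ?subr_gt0]).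
have [W1 H1 W10] := piece_from_zero_exists c a01 q1 (lexx 0).
have [W3 H3 W30] := piece_from_right_exists c gamma01 q3 (ltW w0).
have q2s s : 0 < s < gamma - alpha -> 0 < - (-1 * q (gamma + -1 * s)).
  move=> /andP[s0 s1]; rewrite !mulN1r opprK; apply: q2.
  by rewrite gtrBl s0 andbT ltrBrDr addrC -ltrBrDr.
have [W2 H2 W20] := piece_exists h_continuous q_continuous h_bounded B_gt0 q_bounded
  c mone1 one1 l2 q2s (ltW w0).
have W31 : W3 (1 - gamma) = 0.
  apply: (piece_node_one gamma01 q3 ub3 erefl _ H3); first by rewrite -/S3.
  by rewrite W30 /w ge_min lexx.
have W11 : W1 alpha = 0.
  apply: (piece_node_left a01 q1 _ S40 HS4 _ H1 (d := h gamma)).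
  - move=> s /andP[s0 sa].
    by apply: (F_chord_left (f_derive gamma01) gamma01 s0 sa (ltW ag)).
  - by rewrite lerBrDr addrC -lerBrDr.
  - by rewrite W10 !mulr_ge0// ltW.
have W21 : W2 (gamma - alpha) = 0.
  have [m0 m1] := sup_node_bounds S40 c4.
  apply: (piece_node F_continuous (F_derive f_derive) l2 _ q2s H2 _ _ m0 m1).
  - move=> s /andP[s0 s1]; rewrite mulN1r.
    have sa : alpha < gamma - s by rewrite ltrBrDr addrC -ltrBrDr.
    by rewrite (lt_trans al0)//= (lt_trans _ ga1)// gtrBl.
  - move=> s /andP[s0 s1]; rewrite !mul1r !mulN1r.
    have -> : gamma - (gamma - alpha) = alpha by ring.
    have sa : alpha <= gamma - s by rewrite lerBrDr addrC -lerBrDr.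
    have sg : gamma - s <= gamma by rewrite gerBl.
    have := F_chord_left (f_derive gamma01) gamma01 (ltW al0) sa sg.
    by lra.
  - move=> s /andP[s0 s1]; rewrite !mulN1r opprK.
    have sa : alpha < gamma - s by rewrite ltrBrDr addrC -ltrBrDr.
    have := HS4' (gamma - s); rewrite sa gtrBl s0 => /(_ isT).
    by lra.
  - by rewrite W20 /w ge_min lexx orbT.
apply: (wavefront_of_pieces_c ag q1 q3 q2s H1 W10 W11 H2 W21 H3 W31); last by rewrite W30.
by rewrite W20 W30.
Qed.

(** Near gamma [D] is at least half of [D gamma > 0] and [g] is at least half as steep as its
    tangent; [mu] is the product of the two halves. *)
Lemma q_slope_at_gamma : gamma < alpha -> derivable g gamma 1 -> 0 < derive1 g gamma ->
  exists mu e, [/\ 0 < mu, 0 < e, e <= gamma & e <= alpha - gamma] /\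
    forall s, 0 < s < e -> mu * s <= - q (gamma - s) /\ mu * s <= q (gamma + s).
Proof.
move=> ga dg dg0; have /andP[al0 al1] := a01; have /andP[ga0 ga1] := gamma01.
have D0 : 0 < D gamma / 2 by apply: divr_gt0 => //; apply: Dp; rewrite ga0.
have [r1 r10 Hr1] := continuous_near_ball (D_continuous gamma01) D0.
set d := derive1 g gamma in dg0.
have dg' : is_derive gamma 1 g d by rewrite /d derive1E; exact/derivableP.
have d0 : 0 < d / 2 by exact: divr_gt0.
have [r2 r20 Hr2] := (is_derive_dist g gamma d).1 dg' (d / 2) d0.
pose e := Num.min (Num.min r1 r2) (Num.min gamma (alpha - gamma)).
have e_gt0 : 0 < e by rewrite !lt_min r10 r20 ga0 subr_gt0.
have eg : e <= gamma by rewrite !ge_min lexx !orbT.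
have ea : e <= alpha - gamma by rewrite !ge_min lexx !orbT.
have er1 : e <= r1 by rewrite !ge_min lexx.
have er2 : e <= r2 by rewrite !ge_min lexx !orbT.
have Dx x : `|x - gamma| < e -> D gamma / 2 <= D x.
  move=> xe; have := Hr1 x (lt_le_trans xe er1).
  by rewrite ltr_norml; lra.
have gx x : `|x - gamma| < e -> `|g x - d * (x - gamma)| <= d / 2 * `|x - gamma|.
  by move=> xe; have := Hr2 x (lt_le_trans xe er2); rewrite gg subr0.
have key s y G : 0 < s -> D gamma / 2 <= D y -> d / 2 * s <= G ->
    D gamma / 2 * (d / 2) * s <= D y * G.
  move=> s0 Dy Gy; rewrite -mulrA; apply: ler_pM => //; first exact: ltW.
  by apply: mulr_ge0; exact: ltW.
exists (D gamma / 2 * (d / 2)), e; split; first by split => //; exact: mulr_gt0.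
move=> s /andP[s0 se].
have n1 : `|gamma - s - gamma| = s by rewrite addrAC subrr add0r normrN gtr0_norm.
have n2 : `|gamma + s - gamma| = s by rewrite addrAC subrr add0r gtr0_norm.
have sg : s <= gamma by apply: le_trans eg; exact: ltW.
have sa : s < 1 - gamma.
  by apply: lt_trans (lt_le_trans se ea) _; rewrite ltrD2r.
split.
- rewrite qE; last by rewrite subr_ge0 sg lerBlDr (le_trans (ltW ga1))// lerDl ltW.
  rewrite -mulrN; apply: key => //; first by apply: Dx; rewrite n1.
  have := gx (gamma - s); rewrite n1 ler_norml => /(_ se).
  by lra.
- rewrite qE; last by apply/andP; split; [by apply: addr_ge0; exact: ltW|by rewrite -lerBrDl ltW].
  apply: key => //; first by apply: Dx; rewrite n2.
  have := gx (gamma + s); rewrite n2 ler_norml => /(_ se).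
  by lra.
Qed.

(** [W1] and [W2] run towards gamma from 0 and from alpha, so their end values are what has to
    agree. At alpha [g] is positive on both sides. *)
Lemma wavefront_of_pieces_a c W1 W2 W3 : gamma < alpha ->
  (forall s, 0 < s < gamma -> 0 < - (1 * q (0 + 1 * s))) ->
  (forall s, 0 < s < alpha - gamma -> 0 < - (-1 * q (alpha + -1 * s))) ->
  (forall x, alpha < x < 1 -> q x < 0) ->
  saddle (k c 0 1 (-1)) (Q 0 1) gamma W1 -> W1 0 = 0 ->
  saddle (k c alpha (-1) (-1)) (Q alpha (-1)) (alpha - gamma) W2 -> W2 0 = 0 ->
  saddle (k c alpha 1 1) (Q alpha 1) (1 - alpha) W3 -> W3 0 = 0 -> W3 (1 - alpha) = 0 ->
  W1 gamma = W2 (alpha - gamma) -> 0 < W1 gamma ->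
  exists c phi, wavefront f D g c phi.
Proof.
move=> ga q1s q2s q3 H1 W10 H2 W20 H3 W30 W31 W12 W1g.
have /andP[a0 a1] := a01; have /andP[c0 c1] := gamma01.
have g_alpha : 0 < 1 * g alpha by rewrite mul1r; apply: gp; rewrite ga.
have [L [e [L0 e0 Hl Hr]]] :=
  crossing_of_nonzero (within_continuous_at a01 C0g) (@normr1 R) g_alpha.
pose z x := if x < alpha then (if x < gamma then -1 * W1 (1 * (x - 0)) else -1 * W2 (-1 * (x - alpha)))
  else 1 * W3 (1 * (x - alpha)).
have cz : continuous z.
  apply: continuous_glue; [|exact: piece_arg_continuous H3.1|].
    apply: continuous_glue; [exact: piece_arg_continuous H1.1|
      exact: piece_arg_continuous H2.1|].
    by rewrite mul1r subr0 W12 (mulN1r (gamma - alpha)) opprB.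
  have /ltW/le_gtF -> := ga.
  by rewrite subrr !mulr0 W20 W30 !mulr0.
have zg : z gamma = - W1 gamma.
  by rewrite /z ga ltxx W12 (mulN1r (gamma - alpha)) opprB mulN1r.
have P1 (x : R) : 0 < x < gamma ->
    0 < -1 * z x /\ is_derive x 1 z (h x - c - D x * g x / z x).
  move=> xa; apply: (piece_to_z one1 mone1 (lexx 0) (ltW c1) q1s H1 _ _ xa).
  - by move=> y ya; rewrite mul1r subr0.
  - by move=> y /andP[_ ya]; rewrite /z ya (lt_trans ya ga).
have P2 (x : R) : gamma < x < alpha ->
    0 < -1 * z x /\ is_derive x 1 z (h x - c - D x * g x / z x).
  move=> xa; apply: (piece_to_z mone1 mone1 (ltW c0) (ltW a1) q2s H2 _ _ xa).
  - by move=> y /andP[y1 y2]; rewrite mulN1r opprB subr_gt0 y2 ltrD2l ltrN2.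
  - by move=> y /andP[/ltW/le_gtF ya yg]; rewrite /z yg ya.
apply: (wavefront_of_flux L0 half01 e0 (@normr1 R) (@normr1 R) Hl Hr cz).
- by rewrite /z a0 c0 subrr mulr0 W10 mulr0.
- by rewrite /z ltxx subrr mulr0 W30 mulr0.
- by rewrite /z; have /ltW/le_gtF-> := a1; rewrite !mul1r.
- have gca : 0 < gamma < alpha by rewrite c0.
  move=> x xa; split.
    have /andP[x1 x2] := xa.
    have [xg|gx|->] := ltgtP x gamma; last by rewrite zg mulN1r opprK.
      by have [] := P1 x (introT andP (conj x1 xg)).
    by have [] := P2 x (introT andP (conj gx x2)).
  apply: (flux_glue (lexx 0) gca (ltW a1) cz _ _ _ xa).
  + by rewrite zg oppr_eq0 gt_eqF.
  + by move=> y /P1[_ dzy]; exact: dzy.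
  + by move=> y /P2[_ dzy]; exact: dzy.
- move=> x xa; apply: (piece_to_z one1 one1 (ltW a0) (lexx 1) _ H3 _ _ xa).
  + move=> s /andP[s0 s1]; rewrite !mul1r oppr_gt0; apply: q3.
    by rewrite ltrDl s0 -ltrBrDl.
  + by move=> y /andP[y1 y2]; rewrite mul1r subr_gt0 y1 ltrD2r.
  + by move=> y /andP[/ltW/le_gtF ya _]; rewrite /z ya.
Qed.

(** [q] is negative left of gamma and positive between gamma and alpha, so both pieces must be
    followed towards gamma, where neither value can be prescribed; the speed is the free
    parameter. *)
Lemma wavefront_case_a : gamma < alpha -> derivable g gamma 1 -> 0 < derive1 g gamma ->
  has_ubound [set delta q0 1 x | x in `[alpha, 1[%classic] ->
  has_ubound [set delta q0 gamma x | x in `[0, gamma[%classic] ->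
  2 * (Num.sqrt (sup [set delta q0 1 x | x in `[alpha, 1[%classic]) +
       Num.sqrt (sup [set delta q0 gamma x | x in `[0, gamma[%classic]))
    <= derive1 f gamma - slope alpha ->
  exists c phi, wavefront f D g c phi.
Proof.
move=> ga dg dg0 ub1 ub2; rewrite derive_gamma => cond.
have /andP[al0 al1] := a01; have /andP[ga0 ga1] := gamma01.
have q1 x : 0 < x < gamma -> q x < 0.
  move=> /andP[x0 xa]; apply: q_lt0_of_D_pos => //; last exact: lt_trans ga.
  by rewrite x0 (lt_trans xa).
have q3 x : alpha < x < 1 -> q x < 0.
  move=> /andP[gx x1]; apply: q_lt0_of_D_neg => //; last exact: lt_trans gx.
  by rewrite x1 (lt_trans al0).
have q2 x : gamma < x < alpha -> 0 < q x.
  move=> /andP[ax xg]; have x0 := lt_trans ga0 ax; have x1 := lt_trans xg al1.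
  by rewrite qE ?pmulr_rgt0 ?Dp ?gp ?ax ?x0// !ltW.
set S1 := sup _ in cond; set S2 := sup _ in cond.
have A2 x : 0 < x < gamma -> (`[0, gamma[%classic : set R) x.
  by move=> /andP[x0 xg]; rewrite /= in_itv/= ltW.
have [S20 HS2] := delta_left_bound gamma01 q_at_gamma A2 q1 ub2 (erefl S2).
have s1 := sqrtr_ge0 S1; have s2 := sqrtr_ge0 S2.
pose c2 := h gamma - 2 * Num.sqrt S2.
pose k1 (s : R) : R := h (0 + 1 * s); pose k2 (s : R) : R := h (alpha + -1 * s).
have k1E c : (fun s => c - k1 s) = k c 0 1 (-1).
  by apply/funext => s; rewrite /k /piece_k /k1; ring.
have k2E c : (fun s => k2 s - c) = k c alpha (-1) (-1).
  by apply/funext => s; rewrite /k /piece_k /k2; ring.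
have q1s s : 0 < s < gamma -> 0 < - (1 * q (0 + 1 * s)).
  by move=> sg; rewrite !mul1r add0r oppr_gt0; exact: q1.
have q2s s : 0 < s < alpha - gamma -> 0 < - (-1 * q (alpha + -1 * s)).
  move=> /andP[s0 s1']; rewrite !mulN1r opprK; apply: q2.
  by rewrite gtrBl s0 andbT ltrBrDr addrC -ltrBrDr.
have l2 : 0 < alpha - gamma by rewrite subr_gt0.
have ck1 : continuous k1 := comp_affine_continuous h_continuous.
have ck2 : continuous k2 := comp_affine_continuous h_continuous.
have node0 W : saddle (fun s => c2 - k1 s) (Q 0 1) gamma W -> W 0 = 0 -> W gamma = 0.
  rewrite k1E => HW W0.
  apply: (piece_node_left gamma01 q1 _ S20 HS2 _ HW (d := h gamma)) => //.
  - move=> s /andP[s0 sa].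
    by apply: (F_chord_left (f_derive gamma01) gamma01 s0 sa (lexx gamma)).
  - rewrite W0 /c2 opprB addrC subrK; apply: mulr_ge0; last exact: ltW.
    by apply: divr_ge0 => //; exact: mulr_ge0.
have [c [W1 [W2 [c2c [H1 W10] [H2 W20] W12]]]] :=
  shooting ck1 ck2 (@piece_Q_continuous R q q_continuous 0 1)
    (@piece_Q_continuous R q q_continuous alpha (-1))
    ga0 l2 B_gt0 (fun s => h_bounded _) (fun s => h_bounded _)
    (piece_Q_bounded B_gt0 q_bounded 0 one1) (piece_Q_bounded B_gt0 q_bounded alpha mone1)
    (piece_Q_gt0 q1s) (piece_Q_gt0 q2s) node0.
(* If the common value were 0, [saddle_node_slope] on the left would give [c < h gamma] and on the
   right [h gamma < c]. *)
have W1g : 0 < W1 gamma.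
  rewrite lt_neqAle (saddle_ge0 ga0 H1) andbT; apply/eqP => W1E.
  have [mu [e [[mu0 e0 eg ea] Hmu]]] := q_slope_at_gamma ga dg dg0.
  have cg1 : c - k1 gamma < 0.
    apply: (saddle_node_slope ga0 H1 _ (esym W1E) e0 mu0).
      by apply: cvgB; [exact: cvg_cst|exact: ck1].
    move=> s /andP[se sg]; have s0 : 0 < s by apply: le_lt_trans se; rewrite subr_ge0.
    rewrite /Q (piece_QE q1s) ?s0// !mul1r add0r.
    have [] := Hmu (gamma - s); first by rewrite subr_gt0 sg ltrBlDr -ltrBlDl.
    by rewrite subKr.
  have cg2 : k2 (alpha - gamma) - c < 0.
    apply: (saddle_node_slope l2 H2 _ _ e0 mu0).
    - by apply: cvgB; [exact: ck2|exact: cvg_cst].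
    - by rewrite -W12 -W1E.
    move=> s /andP[se sg]; have s0 : 0 < s by apply: le_lt_trans se; rewrite subr_ge0.
    rewrite /Q (piece_QE q2s) ?s0// !mulN1r opprK.
    have [] := Hmu (alpha - gamma - s); first by rewrite subr_gt0 sg ltrBlDr -ltrBlDl.
    by have -> : gamma + (alpha - gamma - s) = alpha - s by ring.
  move: cg1 cg2; rewrite /k1 /k2 mul1r add0r mulN1r subKr.
  by lra.
rewrite k1E in H1; rewrite k2E in H2.
have [W3 H3 W30] := piece_from_right_exists c a01 q3 (lexx 0).
have c_slope : slope alpha + 2 * Num.sqrt S1 <= c.
  by apply: le_trans c2c; rewrite /c2; move: cond; lra.
have W31 : W3 (1 - alpha) = 0.
  apply: (piece_node_one a01 q3 ub1 erefl _ H3); first by rewrite -/S1.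
  rewrite W30; apply: mulr_ge0; last by rewrite subr_ge0 ltW.
  by move: s1 c_slope; lra.
exact: (wavefront_of_pieces_a ga q1s q2s q3 H1 W10 H2 W20 H3 W30 W31 W12 W1g).
Qed.

End WithDerivative.
End Main.

Theorem theorem2p5 (R : realType) (alpha gamma : R) (f D g : R -> R) :
  0 < alpha < 1 -> 0 < gamma < 1 ->
  C1_01 f -> f 0 = 0 ->
  C1_01 D ->
  (forall x, 0 < x < alpha -> 0 < D x) ->
  (forall x, alpha < x < 1 -> D x < 0) ->
  C0_01 g ->
  (forall x, 0 < x < gamma -> g x < 0) ->
  (forall x, gamma < x < 1 -> 0 < g x) ->
  g 0 = 0 -> g gamma = 0 -> g 1 = 0 ->
  strictly_concave_01 f ->
  let q := fun x => D x * g x in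
  let S1 := [set delta q 1 x | x in `[alpha, 1[%classic] in
  let S2 := [set delta q gamma x | x in `[0, gamma[%classic] in
  let condA :=
    has_ubound S1 /\ has_ubound S2 /\
    2 * (Num.sqrt (sup S1) + Num.sqrt (sup S2))
      <= derive1 f gamma - (f 1 - f alpha) / (1 - alpha) in
  let S3 := [set delta q 1 x | x in `[gamma, 1[%classic] in
  let S4 := [set delta q alpha x | x in (`[0, gamma]%classic `\ alpha)] in
  (* (a) *)
  ((gamma < alpha -> derivable g gamma 1 -> 0 < derive1 g gamma -> condA ->
      exists c phi, wavefront f D g c phi) /\
  (* (b) *)
   (alpha = gamma -> condA ->
      (exists L tau eps : R, 0 < L /\ 0 < tau < 1 /\ 0 < eps /\
         forall x, `|x - gamma| < eps -> L * (`|x - gamma| `^ tau) <= `|g x|) ->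
      exists c phi, wavefront f D g c phi) /\
  (* (c) *)
   (alpha < gamma ->
      has_ubound S3 -> has_ubound S4 ->
      2 * (Num.sqrt (sup S3) + Num.sqrt (sup S4))
        < derive1 f gamma - (f 1 - f gamma) / (1 - gamma) ->
      exists c phi, wavefront f D g c phi)).
Proof.
move=> a01 gamma01 C1f _ C1D Dp Dn C0g gn gp g0 gg g1 cf q S1 S2 condA S3 S4.
have [h [M [ch hM df]]] := C1_01_derive C1f.
have [B B0 qB] := q_data C1D C0g.
split; last split.
- move=> ga dg dg0 [ub1 [ub2 cond]].
  exact: (wavefront_case_a a01 gamma01 C1f C1D Dp Dn C0g gn gp g0 gg g1 cf
    ch hM df B0 qB ga dg dg0 ub1 ub2 cond).
- move=> ag [ub1 [ub2 cond]].
  exact: (wavefront_case_b a01 gamma01 C1f C1D Dp Dn C0g gn gp g0 gg g1 cf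
    ch hM df B0 qB ag ub1 ub2 cond).
- move=> ag ub3 ub4 cond.
  exact: (wavefront_case_c a01 gamma01 C1f C1D Dp Dn C0g gn gp g0 g1 cf
    ch hM df B0 qB ag ub3 ub4 cond).
Qed.
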